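(* Let $F_N=F(A)$, where $N\ge 2$ and where $A=\{a_1,\dots,a_N\}$ is a free basis of $F_N$. Then: \begin{enumerate} \item There exists an algorithm that, given $1\ne g\in F_N$, computes $d_{prim}(g)$ and $d_{simp}(g)$. \item There exists an algorithm that, for every $n\ge 1$, computes $f_{prim}(n)$ and $f_{simp}(n)$. \end{enumerate}
   Context: Elements of $F_N$ are given as words over $A^{\pm1}$. In a free group $F$ of finite rank, a nontrivial element is primitive if it belongs to some free basis of $F$, and simple if it belongs to a proper free factor of $F$. For $1\ne g\in F_N$, $d_{prim}(g)$ (respectively $d_{simp}(g)$) is the smallest index $[F_N:H]$ over all finite-index subgroups $H\le F_N$ such that $g\in H$ and $g$ is primitive (respectively simple) in $H$. For $n\ge 1$, $f_{prim}(n)$ (respectively $f_{simp}(n)$) is the maximum of $d_{prim}(g)$ (respectively $d_{simp}(g)$) over all nontrivial $g\in F_N$ that are not proper powers in $F_N$ and satisfy $|g|_A\le n$, where $|g|_A$ is the freely reduced length of $g$ over $A$. *)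

(* Defs.v *)
From HB Require Import structures.
From mathcomp Require Import all_boot.
From mathcomp Require Import boolp classical_sets functions cardinality.

Set Implicit Arguments.
Unset Strict Implicit.
Unset Printing Implicit Defensive.

Local Open Scope classical_set_scope.
Local Open Scope card_scope.
Local Open Scope group_scope.

Definition least (P : nat -> Prop) (k : nat) : Prop :=
  P k /\ forall m, P m -> (k <= m)%N.

(* The letter (x, false) stands for x and (x, true) for x^-1. *)
Definition word (X : Type) : Type := seq (X * bool).

Definition reduced (X : eqType) (w : word X) : bool :=
  sorted (fun p q : X * bool => ~~ ((p.1 == q.1) && (p.2 != q.2))) w.

Section FreeGroups.
Variable F : groupType.
Implicit Types (g h : F) (H K L B : set F).

Definition word_val (X : Type) (v : X -> F) (w : word X) : F :=
  \prod_(l <- w) (if l.2 then (v l.1)^-1 else v l.1).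

Definition subgroup H : Prop :=
  H 1 /\ forall x y, H x -> H y -> H (x * y^-1).

Definition has_index H (k : nat) : Prop :=
  [set [set h * g | h in H] | g in [set: F]] #= `I_k.

Definition word_over B (w : word F) : Prop := forall l, l \in w -> B l.1.

(* [H] is a subgroup and is free on [B]: every element of [H] is the value of a
   unique reduced word over the letters of [B] and their inverses. *)
Definition free_basis H B : Prop :=
  [/\ subgroup H, B `<=` H &
      forall h, H h ->
        exists! w : word F, [/\ word_over B w, reduced w & word_val id w = h]].

(* Normal forms of the free product [K * L]: the tag of a syllable tells which
   factor it is taken from. *)
Definition alternating K L (s : seq (bool * F)) : Prop :=
  sorted (fun p q : bool * F => p.1 != q.1) s /\
  forall p, p \in s -> p.2 <> 1 /\ (if p.1 then L p.2 else K p.2).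

Definition free_product H K L : Prop :=
  [/\ subgroup H, subgroup K /\ subgroup L, K `<=` H /\ L `<=` H &
      forall h, H h ->
        exists! s, alternating K L s /\ \prod_(p <- s) p.2 = h].

Definition free_factor H K : Prop := exists L, free_product H K L.

Definition primitive_in H g : Prop :=
  g <> 1 /\ exists B, free_basis H B /\ B g.

Definition simple_in H g : Prop :=
  g <> 1 /\ exists K, [/\ free_factor H K, K <> H & K g].

Definition d_prim g : nat -> Prop :=
  least (fun k => exists H, [/\ subgroup H, has_index H k, H g & primitive_in H g]).

Definition d_simp g : nat -> Prop :=
  least (fun k => exists H, [/\ subgroup H, has_index H k, H g & simple_in H g]).

Definition proper_power g : Prop := exists h k, (1 < k)%N /\ g = h ^+ k.

Section Basis.
Variables (N : nat) (a : 'I_N -> F).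

Definition freely_generates : Prop :=
  injective a /\ free_basis [set: F] (range a).

Definition word_length g (m : nat) : Prop :=
  exists w : word 'I_N, [/\ reduced w, word_val a w = g & size w = m].

Definition admissible (n : nat) g : Prop :=
  [/\ g <> 1, ~ proper_power g & exists2 m, word_length g m & (m <= n)%N].

(* [d g k] is read "[d(g)] is defined and equal to [k]". *)
Definition max_over (d : F -> nat -> Prop) (n k : nat) : Prop :=
  (exists g, admissible n g /\ d g k) /\
  forall g m, admissible n g -> d g m -> (m <= k)%N.

Definition f_prim : nat -> nat -> Prop := max_over d_prim.
Definition f_simp : nat -> nat -> Prop := max_over d_simp.

End Basis.
End FreeGroups.

(* Programs for the partial (mu-)recursive functions. Arities are left
   implicit: a program is run on a list of arguments, and has no value on a list
   that is too short for it. *)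
Inductive prog : Type :=
| Zero
| Succ
| Proj of nat
| Comp of prog & seq prog
| Rec of prog & prog
| Mu of prog.

(* [eval p xs y]: on the arguments [xs], [p] halts with output [y]. *)
Inductive eval : prog -> seq nat -> nat -> Prop :=
| EvalZero xs : eval Zero xs 0
| EvalSucc x xs : eval Succ (x :: xs) x.+1
| EvalProj i xs : (i < size xs)%N -> eval (Proj i) xs (nth 0 xs i)
| EvalComp p qs xs ys y : evals qs xs ys -> eval p ys y -> eval (Comp p qs) xs y
| EvalRec0 p q xs y : eval p xs y -> eval (Rec p q) (0 :: xs) y
| EvalRecS p q n xs r y :
    eval (Rec p q) (n :: xs) r -> eval q (n :: r :: xs) y ->
    eval (Rec p q) (n.+1 :: xs) y
| EvalMu p xs n (v : nat -> nat) :
    eval p (n :: xs) 0 ->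
    (forall m, (m < n)%N -> eval p (m :: xs) (v m).+1) ->
    eval (Mu p) xs n
with evals : seq prog -> seq nat -> seq nat -> Prop :=
| EvalsNil xs : evals [::] xs [::]
| EvalsCons p ps xs y ys :
    eval p xs y -> evals ps xs ys -> evals (p :: ps) xs (y :: ys).

(* Words and pairs of numbers are presented to programs through the effective
   bijection [CodeSeq.code : seq nat -> nat]. *)
Definition word_code (N : nat) (w : word 'I_N) : nat :=
  CodeSeq.code [seq (l.1.*2 + l.2)%N | l : 'I_N * bool <- w].

Definition pair_code (k l : nat) : nat := CodeSeq.code [:: k; l].

(* Main.v *)
Require Import Defs.
From mathcomp Require Import all_boot zify.
From mathcomp Require Import boolp classical_sets cardinality.

Set Implicit Arguments.
Unset Strict Implicit.
Unset Printing Implicit Defensive.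

Local Open Scope nat_scope.

(** The distances [d_prim g] and [d_simp g] are minima over the subgroups of finite
    index. Three facts make them computable: the subgroups of given index can be
    listed with explicit free bases, the index can be bounded in advance, and it can
    be decided whether a word in a free basis is primitive or simple.

    A subgroup of index [k] is the group of a pointed cover with [k] vertices of the
    rose, that is, of [N] permutations of [k] points that act transitively
    ([subgroup_cover]). Once the vertices are numbered so that each one except [0] has
    a neighbour with a smaller number, a choice of such neighbours is a spanning tree,
    and Schreier's theorem ([schreier_fgen]) rewrites the element as a word in the
    edges off the tree. Marshall Hall's argument ([hall_primitive]) bounds the index: the
    cyclically reduced core of [g], written around a circle, completes to a
    cover in which [g] is a basis element, up to conjugation. In a free group of
    rank at least two primitive elements are simple, so the length of [g] bounds both
    distances.

    Primitive and simple elements are recognized by Whitehead's algorithm in a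
    form that only needs the cut vertex lemma. If [K] is a free factor of [H],
    the elements of [H] whose normal form does not begin with a syllable of the
    complement form a set that is invariant under right multiplication by [K] and has
    finite coboundary in every Cayley graph ([free_factor_separation]). It colours
    the ends of the Cayley tree of a basis, and the axes of elements of [K] have ends
    of one colour. If [K] does not contain all generators that occur in the
    word [c] of an element of [K], the colouring is not constant, and a vertex where
    the colours first separate shows that the Whitehead graph of [c] is disconnected
    or has a cut vertex ([invariant_colouring_shortens]). Then some Whitehead move
    shortens [c] ([free_factor_shortens]). Conversely, after shortening as long as
    possible, the element is primitive if and only if one letter is left, and
    simple if and only if some generator does not occur ([primitive_wordP],
    [simple_wordP]).

    The extremal functions are maxima over the finitely many words of bounded length,
    among which the proper powers are recognized because a power of a reduced word is
    not shorter than the word ([power_root_size]).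

    All searches are bounded, so the algorithms are compositions of iterations
    over numbers and lists. The class of computable functions on coded data is closed
    under these ([comp_natrec], [comp_list_case], [comp_foldl]), which gives
    the programs. *)

Local Arguments reduced : simpl never.

(** * Free reduction *)

Section Words.
Variable X : eqType.
Implicit Types (l : X * bool) (u v w s : word X).

Definition linv l : X * bool := (l.1, ~~ l.2).
Definition winv w : word X := rev (map linv w).
Definition push l s : word X :=
  if s is h :: t then if h == linv l then t else l :: s else [:: l].
Definition red w : word X := foldr push [::] w.
Definition over (G : seq X) w : bool := all (fun l => l.1 \in G) w.
Definition letters (G : seq X) : seq (X * bool) :=
  [seq (x, b) | x <- G, b <- [:: false; true]].

Lemma linvK : involutive linv.
Proof. by case=> x b; rewrite /linv /= negbK. Qed.

Lemma linv_eq l l' : (linv l == l') = (l == linv l').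
Proof. by apply/eqP/eqP => [<-|->]; rewrite linvK. Qed.

Lemma linv_neq l : (linv l == l) = false.
Proof. by case: l => x []; rewrite /linv xpair_eqE eqxx. Qed.

Lemma reducedE w : reduced w = sorted (fun p q => q != linv p) w.
Proof.
case: w => //= l w; apply: eq_path => -[x b] [y c]; rewrite /linv /= xpair_eqE (eq_sym y).
by case: (x == y); case: b c => [] [].
Qed.

Lemma reduced_cons l s :
  reduced (l :: s) = reduced s && (if s is h :: _ then h != linv l else true).
Proof. by rewrite !reducedE; case: s => [|h s] //=; rewrite andbC. Qed.

Lemma reduced_cat u v : reduced (u ++ v) ->
  reduced u /\ reduced v.
Proof. by rewrite !reducedE; case/cat_sorted2. Qed.

Lemma reduced_rcons u l l' :
  reduced (rcons (rcons u l) l') = reduced (rcons u l) && (l' != linv l).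
Proof. by case: u => [|h u]; rewrite !reducedE /= ?andbT // !rcons_path last_rcons. Qed.

Lemma push_reduced l s : reduced s -> reduced (push l s).
Proof.
case: s => [|h s] //= hs; case: ifP => [_|/negbT hl].
  by move: hs; rewrite (reduced_cons h) => /andP[].
by rewrite (reduced_cons l) hs hl.
Qed.

Lemma foldr_push_reduced s w : reduced s -> reduced (foldr push s w).
Proof. by move=> hs; elim: w => //= l w; apply: push_reduced. Qed.

Lemma red_reduced w : reduced (red w).
Proof. exact: foldr_push_reduced. Qed.

(** On reduced words, pushing a letter is undone by pushing its inverse. So the
    letters act on the reduced words by permutations, and the reduced form of a
    word depends only on its class modulo cancellations. *)
Lemma pushK l s : reduced s -> push (linv l) (push l s) = s.
Proof.
case: s => [|h s] hs /=; first by rewrite linvK eqxx.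
case: eqP => [eh|/eqP nh] /=; last by rewrite linvK eqxx.
move: hs; rewrite eh (reduced_cons _ s); case: s => [|h' s] //= /andP[_].
by move/negbTE => ->.
Qed.

Lemma red_id w : reduced w -> red w = w.
Proof.
elim: w => //= l w IH; rewrite (reduced_cons l) => /andP[/IH ->].
by case: w {IH} => //= h w /negbTE ->.
Qed.

Lemma redK w : red (red w) = red w.
Proof. exact: red_id (red_reduced w). Qed.

Lemma red_catE u v : red (u ++ v) = foldr push (red v) u.
Proof. by rewrite /red foldr_cat. Qed.

Lemma red_cat_red u v : red (u ++ red v) = red (u ++ v).
Proof. by rewrite !red_catE redK. Qed.

Lemma foldr_push l s t : reduced s -> reduced t ->
  foldr push s (push l t) = push l (foldr push s t).
Proof.
move=> hs; case: t => [|h t] ht //=; case: eqP => [eh|//].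
by rewrite eh -{1}[l]linvK pushK //; apply: foldr_push_reduced.
Qed.

Lemma red_red_cat u v : red (red u ++ v) = red (u ++ v).
Proof.
rewrite !red_catE; elim: u => //= l u IH.
by rewrite foldr_push ?red_reduced ?IH.
Qed.

Lemma red_congr u u' v v' :
  red u = red u' -> red v = red v' -> red (u ++ v) = red (u' ++ v').
Proof. by move=> eu ev; rewrite -red_red_cat eu red_red_cat -red_cat_red ev red_cat_red. Qed.

Lemma red_cancel l w : red [:: l, linv l & w] = red w.
Proof. by rewrite /= -{1}[l]linvK pushK // red_reduced. Qed.

Lemma winv_cat u v : winv (u ++ v) = winv v ++ winv u.
Proof. by rewrite /winv map_cat rev_cat. Qed.

Lemma winv_cons l w : winv (l :: w) = rcons (winv w) (linv l).
Proof. by rewrite /winv /= rev_cons. Qed.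

Lemma winvK : involutive winv.
Proof.
move=> w; rewrite /winv map_rev revK -map_comp map_id_in // => l _ /=.
by rewrite linvK.
Qed.

Lemma size_winv w : size (winv w) = size w.
Proof. by rewrite size_rev size_map. Qed.

Lemma red_catV w : red (w ++ winv w) = [::].
Proof.
elim: w => //= l w IH; rewrite winv_cons -cats1 catA -red_red_cat IH.
by rewrite /= eqxx.
Qed.

Lemma red_Vcat w : red (winv w ++ w) = [::].
Proof. by rewrite -{2}[w]winvK red_catV. Qed.

Lemma red_catVK u w : red (u ++ w ++ winv w) = red u.
Proof. by rewrite -red_cat_red red_catV cats0. Qed.

Lemma reduced_winv w : reduced w -> reduced (winv w).
Proof.
rewrite !reducedE /winv rev_sorted sorted_map; apply: sub_sorted => p q /=.
by rewrite linvK eq_sym linv_eq.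
Qed.

Lemma size_push l s : size (push l s) <= (size s).+1.
Proof. by case: s => //= h s; case: ifP => //= _; lia. Qed.

Lemma size_push_lb l s : size s <= (size (push l s)).+1.
Proof. by case: s => //= h s; case: ifP => //= _; lia. Qed.

Lemma size_foldr_push u s : size s <= size (foldr push s u) + size u.
Proof.
elim: u => [|l u IH] /=; first by rewrite addn0.
by apply: leq_trans IH _; rewrite addnS -addSn leq_add2r size_push_lb.
Qed.

Lemma size_red w : size (red w) <= size w.
Proof. by elim: w => //= l w IH; apply: leq_trans (size_push _ _) _. Qed.

Lemma over_cat G u v : over G (u ++ v) = over G u && over G v.
Proof. exact: all_cat. Qed.

Lemma over_push G l s : over G (l :: s) -> over G (push l s).
Proof. by case: s => //= h s /and3P[a b c]; case: ifP => //= _; rewrite a b. Qed.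

Lemma over_red G w : over G w -> over G (red w).
Proof.
elim: w => //= l w IH /andP[hl /IH hw]; apply: over_push.
by rewrite /over /= hl.
Qed.

Lemma over_winv G w : over G (winv w) = over G w.
Proof. by rewrite /over /winv all_rev all_map. Qed.

Lemma over_sub G G' w : {subset G <= G'} -> over G w -> over G' w.
Proof. by move=> sG; apply: sub_all => l /sG. Qed.

Lemma mem_letters G l : (l \in letters G) = (l.1 \in G).
Proof.
apply/allpairsP/idP => [[[x b] [xG _ ->]]|lG] //.
by exists l; split=> //; [case: l.2 | case: l {lG}].
Qed.

End Words.

Arguments red {X}.
Arguments linvK {X}.
Arguments winvK {X}.

(** ** Substitutions *)

Section Substitution.
Variables X Y Z : eqType.

Definition sub (f : X * bool -> word Y) (w : word X) : word Y := flatten (map f w).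

(** These are the substitutions that descend to free groups. *)
Definition compatible (f : X * bool -> word Y) :=
  forall l, red (f l ++ f (linv l)) = [::].

Lemma sub_cat f u v : sub f (u ++ v) = sub f u ++ sub f v.
Proof. by rewrite /sub map_cat flatten_cat. Qed.

Lemma red_sub f w : compatible f -> red (sub f (red w)) = red (sub f w).
Proof.
move=> cf; elim: w => //= l w IH.
transitivity (red (f l ++ sub f (red w))); last first.
  by rewrite -red_cat_red IH red_cat_red.
case: (red w) => [|h t] //=; case: eqP => [->|//].
by rewrite /sub /= catA -red_red_cat cf.
Qed.

Lemma sub_congr f u v : compatible f -> red u = red v -> red (sub f u) = red (sub f v).
Proof. by move=> cf e; rewrite -red_sub // e red_sub. Qed.

Lemma over_sub_word (G : seq X) (G' : seq Y) f w :
  (forall l, l.1 \in G -> over G' (f l)) -> over G w -> over G' (sub f w).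
Proof.
move=> hf; elim: w => //= l w IH /andP[hl /IH hw].
by rewrite /sub /= over_cat hf.
Qed.

Lemma red_sub_eq f f' (G : seq X) w : over G w ->
  (forall l, l.1 \in G -> red (f l) = red (f' l)) -> red (sub f w) = red (sub f' w).
Proof.
move=> + h; elim: w => //= l w IH /andP[hl /IH hw].
by apply: red_congr; [apply: h|].
Qed.

End Substitution.

Lemma sub_sub (X Y Z : eqType) (f : X * bool -> word Y) (g : Y * bool -> word Z) w :
  sub g (sub f w) = sub (fun l => sub g (f l)) w.
Proof. by elim: w => //= l w IH; rewrite /sub /= map_cat flatten_cat; congr (_ ++ _). Qed.

Lemma sub_letter (X : eqType) (w : word X) : sub (fun l => [:: l]) w = w.
Proof. by elim: w => //= l w IH; rewrite /sub /=; congr (_ :: _). Qed.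

(** ** Values of words *)

Section Values.
Variables (F : groupType).
Local Open Scope group_scope.

Lemma word_val_nil (X : Type) (v : X -> F) : word_val v [::] = 1.
Proof. exact: big_nil. Qed.

Lemma word_val_cons (X : Type) (v : X -> F) l w :
  word_val v (l :: w) = (if l.2 then (v l.1)^-1 else v l.1) * word_val v w.
Proof. exact: big_cons. Qed.

Lemma word_val_cat (X : Type) (v : X -> F) w w' :
  word_val v (w ++ w') = word_val v w * word_val v w'.
Proof. exact: big_cat. Qed.

Lemma word_val1 (X : Type) (v : X -> F) l :
  word_val v [:: l] = if l.2 then (v l.1)^-1 else v l.1.
Proof. exact: big_seq1. Qed.

Lemma eq_word_val (X : Type) (v v' : X -> F) w : v =1 v' -> word_val v w = word_val v' w.
Proof. by move=> e; apply: eq_bigr => l _; rewrite e. Qed.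

Variable X : eqType.
Implicit Types (v : X -> F) (w : word X).

Lemma word_val_linv v l : word_val v [:: linv l] = (word_val v [:: l])^-1.
Proof. by rewrite !word_val1 /=; case: l.2; rewrite //= invgK. Qed.

Lemma word_val_winv v w : word_val v (winv w) = (word_val v w)^-1.
Proof.
elim: w => [|l w IH]; first by rewrite /winv /= word_val_nil invg1.
rewrite winv_cons -cats1 word_val_cat IH word_val_linv -invgM.
by rewrite -word_val_cat.
Qed.

Lemma word_val_red v w : word_val v (red w) = word_val v w.
Proof.
elim: w => //= l w IH; rewrite -cat1s word_val_cat -IH; case: (red w) => [|h t] /=.
  by rewrite word_val_nil mulg1.
case: eqP => [->|_]; last by rewrite -cat1s word_val_cat.
by rewrite -(cat1s (linv l)) word_val_cat word_val_linv mulVKg.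
Qed.

Lemma word_val_eq v u w : red u = red w -> word_val v u = word_val v w.
Proof. by move=> e; rewrite -word_val_red e word_val_red. Qed.

Lemma word_val_sub (Y : eqType) (v : Y -> F) (v' : X -> F) (f : X * bool -> word Y) w :
  (forall l, l \in w -> word_val v (f l) = word_val v' [:: l]) ->
  word_val v (sub f w) = word_val v' w.
Proof.
elim: w => [|l w IH] h; first by rewrite !word_val_nil.
rewrite /sub /= word_val_cat h ?mem_head // -[l :: w]cat1s word_val_cat.
by congr (_ * _); apply: IH => l' hl'; apply: h; rewrite inE hl' orbT.
Qed.

Lemma word_val_map (Y : Type) (v : Y -> F) (f : X -> Y) w :
  word_val v [seq (f l.1, l.2) | l <- w] = word_val (v \o f) w.
Proof. exact: big_map. Qed.

Lemma word_val_conj v (h : F) w :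
  word_val (fun x => h * v x * h^-1) w = h * word_val v w * h^-1.
Proof.
elim: w => [|[x b] w IH]; first by rewrite !word_val_nil mulg1 mulgV.
rewrite !word_val_cons IH /=; case: b.
  by rewrite !invgM invgK !mulgA mulgVK.
by rewrite !mulgA mulgVK.
Qed.

End Values.
(** * Free generation, free bases and free factors *)

(** ** Grouping a list into maximal blocks of constant tag *)

Section Blocks.
Variables (T : eqType) (tag : T -> bool).

Fixpoint blocks (w : seq T) : seq (bool * seq T) :=
  if w is l :: w' then
    match blocks w' with
    | (b, u) :: r => if b == tag l then (b, l :: u) :: r
                     else (tag l, [:: l]) :: (b, u) :: r
    | [::] => [:: (tag l, [:: l])]
    end
  else [::].

Definition is_block (p : bool * seq T) :=
  p.2 != [::] /\ forall l, l \in p.2 -> tag l = p.1.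

Definition alternates (Y : Type) (r : seq (bool * Y)) :=
  sorted (fun p q : bool * Y => p.1 != q.1) r.

Lemma flatten_blocks w : flatten (unzip2 (blocks w)) = w.
Proof.
elim: w => //= l w; case: (blocks w) => [|[b u] r] /= IH; first by rewrite -IH.
by case: ifP => _ /=; rewrite IH.
Qed.

Lemma blocks_alternate w : alternates (blocks w).
Proof.
elim: w => //= l w; case: (blocks w) => [|[b u] r] //= IH.
rewrite /alternates /=; case: eqP => [_|/eqP ne]; first by case: r IH.
by rewrite /= eq_sym ne.
Qed.

Lemma blocks_is_block w p : p \in blocks w -> is_block p.
Proof.
elim: w p => //= l w; case: (blocks w) => [|[b u] r] /= IH p.
  by rewrite inE => /eqP->; split=> // l'; rewrite inE => /eqP->.
case: ifP => [/eqP e|_]; rewrite inE => /orP[/eqP->|hp].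
- split=> // l' /=; rewrite inE => /orP[/eqP->//|hl].
  by case: (IH (b, u)); rewrite ?mem_head // => _; apply.
- by apply: IH; rewrite inE hp orbT.
- by split=> // l'; rewrite inE => /eqP->.
- exact: IH.
Qed.

Lemma blocks_flatten r : alternates r -> (forall p, p \in r -> is_block p) ->
  blocks (flatten (unzip2 r)) = r.
Proof.
elim: r => // -[b u] r IH alt blk.
have {}IH : blocks (flatten (unzip2 r)) = r.
  apply: IH => [|p hp]; last by apply: blk; rewrite inE hp orbT.
  by move: alt; rewrite /alternates /=; apply: path_sorted.
have [/=] := blk _ (mem_head _ _); case: u {blk} alt => // l u alt _ tg.
rewrite /= -/(unzip2 r).
have eb : b = tag l by rewrite tg ?mem_head.
have {}tg : forall l', l' \in u -> tag l' = tag l.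
  by move=> l' hl'; rewrite !tg ?mem_head // inE hl' orbT.
have {}alt : alternates ((tag l, [::]) :: r : seq (bool * seq T)).
  by rewrite -eb; move: alt; rewrite /alternates; case: r {IH}.
rewrite eb {eb}.
elim: u l tg alt => [|l' u IHu] l tg alt /=.
  rewrite IH; move: alt; rewrite /alternates; case: r {IH} => [|[c x] r] //=.
  by rewrite eq_sym => /andP[/negbTE ->].
have e : tag l' = tag l by rewrite tg ?mem_head.
move: (IHu l'); rewrite /= => ->; first by rewrite e eqxx.
  by move=> l2 h; rewrite e tg // inE h orbT.
by rewrite e.
Qed.

End Blocks.

Section FreeGeneration.
Variable F : groupType.
Local Open Scope group_scope.
Local Open Scope classical_set_scope.
Implicit Types (H K L B : set F) (g h : F).

Lemma subgroup_closed H : subgroup H ->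
  [/\ H 1, (forall x, H x -> H x^-1) & (forall x y, H x -> H y -> H (x * y))].
Proof.
move=> [h1 hm].
have hV x : H x -> H x^-1 by move=> hx; rewrite -[x^-1]mul1g; apply: hm.
by split=> // x y hx hy; rewrite -[y]invgK; apply: hm => //; apply: hV.
Qed.

Lemma subgroup_word (X : eqType) (v : X -> F) H w : subgroup H ->
  (forall l, l \in w -> H (v l.1)) -> H (word_val v w).
Proof.
move=> /subgroup_closed[h1 hV hM]; elim: w => [|l w IH] hw.
  by rewrite word_val_nil.
rewrite word_val_cons; apply: hM.
  by case: l.2; [apply: hV|]; apply: hw; rewrite mem_head.
by apply: IH => l' hl'; apply: hw; rewrite inE hl' orbT.
Qed.

Lemma mem_red (X : eqType) (w : word X) : {subset red w <= w}.
Proof.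
elim: w => //= l w IH l' hl'.
have : l' \in l :: red w.
  move: hl'; case: (red w) => [|h s] //=; case: ifP => // _ h2.
  by rewrite !inE h2 !orbT.
by rewrite !inE => /orP[->//|/IH ->]; rewrite orbT.
Qed.

(** ** The subgroup generated by a set *)

Definition gen B : set F := [set h | exists2 w : word F, word_over B w & word_val id w = h].

Lemma gen_subgroup B : subgroup (gen B).
Proof.
split; first by exists [::]; rewrite ?word_val_nil.
move=> _ _ [u hu <-] [w hw <-]; exists (u ++ winv w); last first.
  by rewrite word_val_cat word_val_winv.
move=> l; rewrite mem_cat => /orP[/hu//|]; rewrite /winv mem_rev => /mapP[l' /hw ? ->].
by [].
Qed.

Lemma gen_sub H B : subgroup H -> B `<=` H -> gen B `<=` H.
Proof. by move=> sH BH _ [w hw <-]; apply: subgroup_word => // l /hw /BH. Qed.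

Lemma gen_single g k : gen [set g] k -> exists n, k = g ^+ n \/ k^-1 = g ^+ n.
Proof.
move=> [w hw <-]; elim: w hw => [|[x b] w IH] hw.
  by exists 0; left; rewrite word_val_nil.
have /= -> : x = g by apply: (hw (x, b)); rewrite mem_head.
have [|n hn] := IH; first by move=> l hl; apply: hw; rewrite inE hl orbT.
rewrite word_val_cons /=; case: b {hw} hn => -[e|e].
- case: n e => [|n] e; first by exists 1%N; right; rewrite e mulg1 invgK.
  by exists n; left; rewrite e expgS mulKg.
- by exists n.+1; right; rewrite invgM e invgK expgSr.
- by exists n.+1; left; rewrite e expgS.
- case: n e => [|n] e; first by exists 1%N; left; rewrite -[word_val _ _]invgK e invg1 mulg1.
  by exists n; right; rewrite invgM e expgSr mulgK.
Qed.

(** Splitting a free basis into two parts splits the group as a free product: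
    cutting the reduced word of an element into its maximal blocks over one part
    gives its normal form, and conversely normal forms spell reduced words,
    because letters from different parts never cancel. *)
Lemma free_basis_split H B B1 : free_basis H B -> B1 `<=` B ->
  free_product H (gen B1) (gen (B `\` B1)).
Proof.
move=> [sH BH fb] B1B.
have [om omP] : exists om : F -> word F, forall h, H h ->
    [/\ word_over B (om h), reduced (om h) & word_val id (om h) = h].
  have /choice[om hom] : forall h, exists w : word F, H h ->
      [/\ word_over B w, reduced w & word_val id w = h].
    move=> h; have [hh|nh] := pselect (H h); last by exists [::].
    by have [w [hw _]] := fb h hh; exists w.
  by exists om.
have om_uniq w : word_over B w -> reduced w -> om (word_val id w) = w.
  move=> ow rw; have hw : H (word_val id w) by apply: subgroup_word => // l /ow /BH.
  have [w0 [_ u]] := fb _ hw.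
  by rewrite -(u _ (omP _ hw)); apply: u.
have om1 : om 1 = [::] by rewrite -(word_val_nil (id : F -> F)) om_uniq.
have om_gen B' k : B' `<=` B -> gen B' k -> word_over B' (om k).
  move=> B'B [w hw <-]; rewrite -(word_val_red _ w) om_uniq ?red_reduced //.
    by move=> l /mem_red /hw.
  by move=> l /mem_red /hw /B'B.
have B2B : B `\` B1 `<=` B by move=> x [].
pose tag (l : F * bool) := ~~ `[< B1 l.1 >].
have fact_tag (p : bool * F) : (if p.1 then gen (B `\` B1) p.2 else gen B1 p.2) ->
    word_over B (om p.2) /\ forall l, l \in om p.2 -> tag l = p.1.
  case: p => -[] k /= hk; have hom := om_gen _ _ _ hk; split=> l /hom h //.
  - by case: (h B2B).
  - by case: (h B2B) => _ n; rewrite /tag; apply/negP => /asboolP.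
  - exact/B1B/h.
  - by rewrite /tag; apply/negbTE; rewrite negbK; apply/asboolP/h.
have val_flat (r : seq (bool * word F)) :
    word_val id (flatten (unzip2 r)) = \prod_(p <- r) word_val id p.2.
  elim: r => [|p r IH] /=; first by rewrite word_val_nil big_nil.
  by rewrite word_val_cat big_cons IH.
have red_flat (r : seq (bool * word F)) : alternates r ->
    (forall p, p \in r -> is_block tag p /\ reduced p.2) -> reduced (flatten (unzip2 r)).
  elim: r => [|[b u] r IH] // alt blk /=.
  have rr : reduced (flatten (unzip2 r)).
    apply: IH => [|p hp]; first by move: alt; apply: path_sorted.
    by apply: blk; rewrite inE hp orbT.
  have [[/= _ tg] ru] := blk _ (mem_head _ _).
  case: u alt blk tg ru {IH} => [|l u] //= alt blk tg.
  move: rr; rewrite !reducedE /= cat_path => + ->; rewrite /=.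
  case: r alt blk => [|[c u'] r] alt blk //=.
  have [|[/= ne tg'] _] := blk (c, u'); first by rewrite !inE eqxx orbT.
  case: u' alt blk ne tg' => [|l' u'] // alt blk _ tg' /= ->; rewrite andbT.
  move: alt; rewrite /alternates /= => /andP[+ _]; apply: contra => /eqP e.
  rewrite -(tg (last l u)) ?mem_last // -(tg' l') ?mem_head // e.
  by rewrite /tag.
split=> //; first by split; apply: gen_subgroup.
  by split; apply: gen_sub => //; [apply: subset_trans BH | apply: subset_trans BH].
move=> h hh; have [oh rh vh] := omP h hh.
exists [seq (p.1, word_val id p.2) | p <- blocks tag (om h)]; split.
  split; last by rewrite big_map -val_flat flatten_blocks.
  split; first by rewrite sorted_map; apply: blocks_alternate.
  move=> _ /mapP[[b u] hu ->] /=.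
  have [/= ne tg] := blocks_is_block hu.
  have sub_u : {subset u <= om h}.
    move=> l hl; rewrite -(flatten_blocks tag (om h)); apply/flattenP; exists u => //.
    by apply/mapP; exists (b, u).
  have ru : reduced u.
    move: rh; rewrite -(flatten_blocks tag (om h)) /unzip2; case/splitPr: hu => r1 r2.
    by rewrite map_cat flatten_cat /= => /reduced_cat[_ /reduced_cat[]].
  have ou : word_over B u by move=> l /sub_u /oh.
  split; first by move=> e1; move: ne; rewrite -(om_uniq u) // e1 om1.
  case: b {hu} tg => tg; exists u => // l hl.
    by split; [apply: ou | move/asboolP; apply/negP; rewrite -/(tag l) tg].
  by apply/asboolP; rewrite -[asbool _]negbK -/(tag l) tg.
move=> s [[alt fs] ps].
pose r := [seq (p.1, om p.2) | p <- s].
have inH (p : bool * F) : p \in s -> H p.2.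
  move=> /fs[_]; case: p.1; apply: gen_sub => //.
  by apply: subset_trans BH.
  by apply: subset_trans BH.
have br p : p \in r -> is_block tag p /\ reduced p.2.
  case/mapP => q hq ->; have [ne fq] := fs _ hq; have [oq tq] := fact_tag q fq.
  have [_ rq vq] := omP _ (inH _ hq).
  split=> //; split=> //=; apply/eqP => e; apply: ne.
  by rewrite -vq e word_val_nil.
have altr : alternates r by rewrite /alternates sorted_map.
have er : flatten (unzip2 r) = om h.
  rewrite -(om_uniq (flatten (unzip2 r))); last exact: red_flat.
    congr om; rewrite val_flat big_map -ps; apply: eq_big_seq => p hp /=.
    by have [_ _ ->] := omP _ (inH _ hp).
  move=> l /flattenP[u /mapP[p /mapP[q hq ->] ->] hl].
  by have [oq _] := fact_tag q (proj2 (fs _ hq)); apply: oq.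
rewrite -er blocks_flatten // => [|p /br[]//].
rewrite /r -map_comp map_id_in // => -[b k] hk /=.
by have [_ _ ->] := omP _ (inH _ hk).
Qed.

(** ** The almost invariant set of a free factor *)

(** In a free product of [K] and [L], take the set of the elements whose normal form
    does not begin with a syllable from [L]. Right multiplication by [K] only
    affects the last syllable, and respects the set; right multiplication by
    [b] in [L] changes the first syllable of [1] and [b^-1] only.  Hence the set
    has finite coboundary for every right multiplication.  A left translate of
    it by an element of [K] separates [1] from a given element outside [K]. *)
Lemma free_factor_separation H K x : free_factor H K -> H x -> ~ K x ->
  exists S : set F, [/\ S 1, ~ S x,
    (forall y k, H y -> K k -> (S (y * k) <-> S y)) &
    (forall b, H b -> exists D : seq F, forall y, H y -> y \notin D ->
        (S (y * b) <-> S y))].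
Proof.
move=> [L [sH [sK sL] [KH LH] nf]] Hx nKx.
have [H1 HV HM] := subgroup_closed sH.
have [K1 KV KM] := subgroup_closed sK.
have [L1 LV LM] := subgroup_closed sL.
pose fact (t : bool) (b : F) := if t then L b else K b.
have factH t b : fact t b -> H b by case: t; [apply: LH|apply: KH].
have factM t b c : fact t b -> fact t c -> fact t (b * c).
  by case: t; [apply: LM|apply: KM].
pose first (s : seq (bool * F)) := (head (false, 1) s).1.
pose prod (s : seq (bool * F)) := \prod_(p <- s) p.2.
have nf_uniq s s' : alternating K L s -> alternating K L s' -> prod s = prod s' -> s = s'.
  move=> as1 as2 e.
  have Hs : H (prod s).
    case: as1 => _; rewrite /prod; elim: s {e} => [|p s IH] h; first by rewrite big_nil.
    rewrite big_cons; apply: HM.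
      by have [_] := h p (mem_head _ _); apply: factH.
    by apply: IH => q hq; apply: h; rewrite inE hq orbT.
  have [s0 [_ u]] := nf _ Hs.
  by rewrite -(u s) // -(u s').
have rcons_alt s p : alternating K L s -> p.2 <> 1 -> fact p.1 p.2 ->
    (last (~~ p.1, 1) s).1 != p.1 -> alternating K L (rcons s p).
  move=> [a f] np fp lp; split; last first.
    by move=> q; rewrite mem_rcons inE => /orP[/eqP->|/f].
  by case: s a f lp => //= q s; rewrite rcons_path => -> _ ->.
have rcons_altV s p : alternating K L (rcons s p) ->
    [/\ alternating K L s, p.2 <> 1, fact p.1 p.2 & (last (~~ p.1, 1) s).1 != p.1].
  move=> [a f]; have [np fp] : p.2 <> 1 /\ fact p.1 p.2 by apply: f; rewrite mem_rcons mem_head.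
  split=> //.
    split; first by move: a; rewrite -cats1 => /cat_sorted2[].
    by move=> q hq; apply: f; rewrite mem_rcons inE hq orbT.
  case: s a {f} => [|q s] /=; first by case: p.1.
  by rewrite rcons_path => /andP[].
(* Only the last syllable changes. The exceptions are those in which [b] creates or
   cancels the only syllable. *)
have step s t b : alternating K L s -> fact t b -> exists2 s', alternating K L s' /\
    prod s' = prod s * b & first s' = first s \/ t /\ (prod s = 1 \/ prod s = b^-1).
  move=> als fb; have [->|nb] := eqVneq b 1.
    by exists s; [rewrite mulg1 | left].
  have prod_rcons s1 p : prod (rcons s1 p) = prod s1 * p.2.
    by rewrite /prod -cats1 big_cat big_seq1.
  have push_new : (last (~~ t, 1) s).1 != t -> exists2 s', alternating K L s' /\
      prod s' = prod s * b & first s' = first s \/ t /\ (prod s = 1 \/ prod s = b^-1).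
    move=> hl; exists (rcons s (t, b)).
      by split; [apply: rcons_alt => //; apply/eqP | rewrite prod_rcons].
    case: s {als hl} => [|q s]; last by left.
    by rewrite /first /=; case: t {fb}; [right; split=> //; left; rewrite /prod big_nil | left].
  case/lastP: s als push_new => [|s p] als; first by apply; case: (t).
  rewrite last_rcons; case: eqVneq => [et _|_]; last exact.
  have [as' np fp lp] := rcons_altV _ _ als.
  rewrite -{}et in fb *; rewrite prod_rcons.
  have [e|ne] := eqVneq (p.2 * b) 1.
    exists s; first by rewrite -mulgA e mulg1.
    case: s {als lp as'} => [|q s]; last by left.
    rewrite /first /= /prod big_nil mul1g; case: (p.1); last by left.
    by right; split=> //; right; rewrite -(mulg1_eq e) invgK.
  exists (rcons s (p.1, p.2 * b)).
    split; last by rewrite prod_rcons mulgA.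
    by apply: rcons_alt => //=; [apply/eqP | apply: factM].
  by left; case: s {als lp as'}.
pose S0 : set F := [set y | exists s, [/\ alternating K L s, prod s = y & ~~ first s]].
have S0E s : alternating K L s -> S0 (prod s) <-> ~~ first s.
  move=> als; split=> [[s' [as' e fs']]|h]; last by exists s.
  by rewrite -(nf_uniq _ _ as' als e).
have S0K y k : H y -> K k -> S0 (y * k) <-> S0 y.
  move=> /nf[s [[als <-] _]] Kk.
  have [s' [as' <-] [e|[]//]] := step s false k als Kk.
  by rewrite !S0E // e.
have S0fin b : H b -> exists D : seq F, forall y, H y -> y \notin D -> (S0 (y * b) <-> S0 y).
  move=> /nf[s [[[_ fs] <-] _]]; elim: s fs => [|p s IH] fs.
    by exists [::] => y; rewrite big_nil mulg1.
  have [|D hD] := IH; first by move=> q hq; apply: fs; rewrite inE hq orbT.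
  have [_ fp] := fs _ (mem_head _ _).
  exists [:: 1, p.2^-1 & [seq d * p.2^-1 | d <- D]] => y Hy.
  rewrite !inE !negb_or => /and3P[/eqP n1 /eqP n2 nD].
  rewrite big_cons mulgA hD; first last.
  - apply: contra nD => hy; apply/mapP; exists (y * p.2) => //.
    by rewrite mulgK.
  - by apply: HM => //; apply: factH fp.
  have [s' [[als ey] _]] := nf _ Hy.
  have [s2 [as2 e2] [e|]] := step s' p.1 p.2 als fp; last by rewrite [prod s']ey => -[_ []].
  by rewrite -ey -/(prod s') -e2 !S0E // e.
(* Translate so that the normal form of [x] loses a first syllable from [K]. *)
have [k Kk nx] : exists2 k, K k & ~ S0 (k^-1 * x).
  have [s [[als ex] _]] := nf _ Hx.
  case: s als ex => [|[[] k] s] als ex.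
  - by case: nKx; rewrite -ex big_nil.
  - exists 1 => //; rewrite invg1 mul1g -ex -[\prod_(_ <- _) _]/(prod _) S0E //.
  case: (als) => a f.
  have Kk : K k by have [] := f _ (mem_head _ _).
  exists k => //; rewrite -ex big_cons mulKg -[\prod_(_ <- _) _]/(prod _) S0E.
    case: s a {f als} ex => [_|[[] c] s] //=; rewrite /first //=.
    by rewrite big_cons big_nil mulg1 /= => ex; case: nKx; rewrite -ex.
  split; first by move: a; apply: path_sorted.
  by move=> q hq; apply: f; rewrite inE hq orbT.
have Hk : H k^-1 by apply: HV; apply: KH.
exists [set y | S0 (k^-1 * y)]; split=> //=.
- rewrite mulg1 -[k^-1]mul1g; apply/S0K => //; first exact: KV.
  by exists [::]; rewrite /prod big_nil.
- by move=> y k' Hy Kk'; rewrite mulgA; apply: S0K => //; apply: HM.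
- move=> b /S0fin[D hD]; exists [seq k * d | d <- D] => y Hy nD.
  rewrite mulgA; apply: hD; first exact: HM.
  by apply: contra nD => hy; apply/mapP; exists (k^-1 * y); rewrite // mulVKg.
Qed.

(** ** Free generation by a finite family *)

Section FiniteFamily.
Variable X : eqType.
Implicit Types (G : seq X) (v : X -> F) (u w : word X).

Definition span G v : set F := [set h | exists2 w, over G w & word_val v w = h].

(** Freeness is stated as triviality of the kernel, a form that passes from one
    basis to another along substitutions. *)
Definition fgen G v H : Prop :=
  H = span G v /\ forall w, over G w -> word_val v w = 1 -> red w = [::].

Lemma span_gen G v : span G v = gen [set y | exists2 x, x \in G & v x = y].
Proof.
apply/seteqP; split=> [_ [w hw <-]|_ [w hw <-]].
  exists [seq (v l.1, l.2) | l <- w]; last by rewrite word_val_map.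
  by move=> _ /mapP[l hl ->]; exists l.1 => //; apply: (allP hw).
elim: w hw => [|[y b] w IH] hw; first by exists [::]; rewrite // !word_val_nil.
have [|u hu e] := IH; first by move=> l hl; apply: hw; rewrite inE hl orbT.
have [x hx /= exy] := hw _ (mem_head _ _).
exists ((x, b) :: u); first by rewrite /= hx.
by rewrite !word_val_cons e /= exy.
Qed.

Lemma span_subgroup G v : subgroup (span G v).
Proof. by rewrite span_gen; apply: gen_subgroup. Qed.

Section Fgen.
Variables (G : seq X) (v : X -> F) (H : set F).
Hypothesis fg : fgen G v H.

Lemma fgen_subgroup : subgroup H.
Proof. by case: fg => -> _; apply: span_subgroup. Qed.

Lemma fgen_mem w : over G w -> H (word_val v w).
Proof. by case: fg => -> _ hw; exists w. Qed.

Lemma fgen_inj u w : over G u -> over G w -> word_val v u = word_val v w -> red u = red w.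
Proof.
move=> hu hw e; case: fg => _ /(_ (u ++ winv w)) h.
rewrite -[u]cats0 -(red_Vcat w) red_cat_red catA.
by rewrite -red_red_cat h ?over_cat ?over_winv ?hu // word_val_cat word_val_winv e mulgV.
Qed.

Lemma fgen_basis : free_basis H [set y | exists2 x, x \in G & v x = y].
Proof.
have vinj x y : x \in G -> y \in G -> v x = v y -> x = y.
  move=> hx hy e; have : red [:: (x, false)] = red [:: (y, false)].
    by apply: fgen_inj; rewrite /= ?hx ?hy // !word_val1.
  by case.
pose f (l : X * bool) := (v l.1, l.2).
have finj p q : p.1 \in G -> q.1 \in G -> (f q == linv (f p)) = (q == linv p).
  case: p q => [x b] [y c] /= hx hy; rewrite /f /linv /= !xpair_eqE.
  by congr (_ && _); apply/eqP/eqP => [/vinj->|->].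
split; first exact: fgen_subgroup.
  by move=> _ [x hx <-]; rewrite -[v x](word_val1 v (x, false)); apply: fgen_mem; rewrite /= hx.
case: fg => {1}-> _ h [w hw <-].
exists (map f (red w)); split; first split.
- by move=> _ /mapP[l hl ->]; exists l.1 => //; apply: (allP (over_red hw)).
- rewrite reducedE sorted_map; have := red_reduced w; rewrite reducedE.
  apply: (@sub_in_sorted _ [pred l | l.1 \in G]); last exact: over_red.
  by move=> p q /= hp hq; rewrite finj.
- by rewrite word_val_map word_val_red.
move=> w' [ow' rw' vw'].
have [w2 ow2 e2] : exists2 w2, over G w2 & w' = map f w2.
  elim: w' ow' {rw' vw'} => [|[y b] w' IH] ow'; first by exists [::].
  have [|w2 ow2 ->] := IH; first by move=> l hl; apply: ow'; rewrite inE hl orbT.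
  have [x hx /= <-] := ow' _ (mem_head _ _).
  by exists ((x, b) :: w2) => //=; rewrite hx.
have rw2 : reduced w2.
  move: rw'; rewrite e2 !reducedE sorted_map.
  apply: (@sub_in_sorted _ [pred l | l.1 \in G]); last exact: ow2.
  by move=> p q /= hp hq; rewrite finj.
by rewrite e2 -(red_id rw2); congr map; apply: fgen_inj => //; rewrite -vw' e2 word_val_map.
Qed.

Lemma fgen_not_span G' x : x \in G -> {subset G' <= G} -> x \notin G' -> ~ span G' v (v x).
Proof.
move=> hx sG nx [w hw e].
have : red w = red [:: (x, false)].
  by apply: fgen_inj; rewrite ?e ?word_val1 //= ?hx //; apply: over_sub hw.
move=> /= ew; have := over_red hw; rewrite ew /= (negbTE nx).
by [].
Qed.

Lemma fgen_free_factor x : free_factor H (span [seq y <- G | y != x] v).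
Proof.
rewrite span_gen; apply: ex_intro; apply: (free_basis_split fgen_basis).
by move=> t [y]; rewrite mem_filter => /andP[_ hy] <-; exists y.
Qed.

(** An invertible substitution changes the basis: the new generators are the values of
    the inverse substitution, so that substituting in a word preserves its value. *)
Lemma fgen_change (f f' : X * bool -> word X) :
    compatible f -> compatible f' ->
    (forall l, l.1 \in G -> over G (f l)) -> (forall l, l.1 \in G -> over G (f' l)) ->
    (forall l, l.1 \in G -> red (sub f' (f l)) = [:: l]) ->
    (forall l, l.1 \in G -> red (sub f (f' l)) = [:: l]) ->
  let v' x := word_val v (f' (x, false)) in
  fgen G v' H /\ forall w, over G w -> word_val v' (sub f w) = word_val v w.
Proof.
move=> cf cf' of_ of' ff' f'f v'.
have inv_sub (g g' : X * bool -> word X) w : (forall l, l.1 \in G -> red (sub g' (g l)) = [:: l]) ->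
    over G w -> red (sub g' (sub g w)) = red w.
  by move=> e hw; rewrite sub_sub -[in RHS](sub_letter w); apply: red_sub_eq hw _ => l /e.
have v'E w : word_val v' w = word_val v (sub f' w).
  symmetry; apply: word_val_sub => -[x b] _; rewrite word_val1 /=; case: b => //=.
  apply/esym/mulg1_eq; rewrite -word_val_cat -(word_val_nil v).
  by apply: word_val_eq; rewrite (cf' (x, false)).
have v'f w : over G w -> word_val v' (sub f w) = word_val v w.
  by move=> hw; rewrite v'E; apply: word_val_eq; apply: inv_sub.
split=> //; case: fg => -> fr; split.
  apply/seteqP; split=> _ [w hw <-].
    by exists (sub f w); rewrite ?v'f //; apply: over_sub_word hw.
  by exists (sub f' w); rewrite ?v'E //; apply: over_sub_word hw.
move=> w hw; rewrite v'E => /fr h; rewrite -(inv_sub f' f) // -red_sub // h //.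
exact: over_sub_word hw.
Qed.

End Fgen.

(** For an inverse letter, take the basis in which its generator is inverted. *)
Lemma fgen_letter_primitive G v H l : fgen G v H -> l.1 \in G ->
  primitive_in H (word_val v [:: l]).
Proof.
move=> fg hl; split.
  by move=> e; have : red [:: l] = [::] by case: fg => _; apply; rewrite //= hl.
pose f (m : X * bool) : word X := if m.1 == l.1 then [:: (m.1, m.2 (+) l.2)] else [:: m].
have cf : compatible f.
  move=> [x b]; rewrite /f /=; case: (x == l.1) => /=.
    by rewrite /linv /= addNb eqxx.
  by rewrite eqxx.
have of_ m : m.1 \in G -> over G (f m) by move=> hm; rewrite /f; case: ifP; rewrite /= hm.
have ff m : m.1 \in G -> red (sub f (f m)) = [:: m].
  by case: m => x b _; rewrite /f /=; case E: (x == l.1); rewrite /sub /= E //= addbK.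
have [fg' e] := fgen_change fg cf cf of_ of_ ff ff.
exists [set y | exists2 x, x \in G & word_val v (f (x, false)) = y]; split.
  exact: fgen_basis fg'.
by exists l.1 => //; rewrite /f /= eqxx; case: (l).
Qed.

Lemma fgen_omit_simple G v H w x : fgen G v H -> x \in G -> over G w ->
  all (fun l => l.1 != x) w -> word_val v w <> 1 -> simple_in H (word_val v w).
Proof.
move=> fg hx hw nx ne; split=> //; exists (span [seq y <- G | y != x] v); split.
- exact: fgen_free_factor.
- move=> e; have : H (v x).
    by rewrite -[v x](word_val1 v (x, false)); apply: (fgen_mem fg); rewrite /= hx.
  rewrite -e; apply: (fgen_not_span fg) => //; last by rewrite mem_filter eqxx.
  by move=> y; rewrite mem_filter => /andP[].
- exists w => //; apply/allP => l hl; rewrite mem_filter (allP nx) //.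
  exact: (allP hw).
Qed.

End FiniteFamily.

Lemma primitive_free_factor H g : primitive_in H g -> free_factor H (gen [set g]).
Proof.
move=> [_ [B [fb Bg]]]; exists (gen (B `\` [set g])).
by apply: free_basis_split => // _ ->.
Qed.

End FreeGeneration.

(** * Whitehead moves and the cut vertex lemma *)

Section Whitehead.
Variable X : eqType.
Implicit Types (l m : X * bool) (u w c : word X) (Z : pred (X * bool)).

(** The Whitehead move of the multiplier [m] and of a set [Z] of letters sends
    [l] to [m^-a l m^a'], where [a] tells whether [l] is in [Z] and [a'] whether
    [l^-1] is. The multiplier, which must be fixed, fits in the same
    formula if [m^-1] counts as in [Z], [m] as outside, and the middle factor is
    erased. This uniformity lets the length of an image be read off the pairs of
    consecutive letters. *)
Definition side Z m l : bool :=
  if l == m then false else if l == linv m then true else Z l.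
Definition middle m l : word X := if (l == m) || (l == linv m) then [::] else [:: l].
Definition white Z m l : word X :=
  nseq (side Z m l) (linv m) ++ middle m l ++ nseq (side Z m (linv l)) m.

Lemma winv_white Z m l : winv (white Z m l) = white Z m (linv l).
Proof.
have wn b x : winv (nseq b x) = nseq b (linv x) :> word X by rewrite /winv map_nseq rev_nseq.
rewrite /white !winv_cat !wn !linvK -catA; congr (_ ++ _ ++ _).
rewrite /middle linv_eq (inj_eq (inv_inj linvK)) orbC.
by case: ifP.
Qed.

Lemma white_compatible Z m : compatible (white Z m).
Proof. by move=> l; rewrite -winv_white red_catV. Qed.

Lemma over_white G Z m l : m.1 \in G -> l.1 \in G -> over G (white Z m l).
Proof.
move=> hm hl; have hn (b : bool) x : x.1 = m.1 -> over G (nseq b x) by case: b => //= ->; rewrite hm.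
rewrite /white !over_cat !hn // andbT /= /middle.
by case: ifP => //= _; rewrite hl.
Qed.

Lemma whiteK Z m l : red (sub (white Z (linv m)) (white Z m l)) = [:: l].
Proof.
have wm : white Z (linv m) m = [:: m].
  by rewrite /white /side /middle linvK eqxx orbT (eq_sym m) linv_neq eqxx.
have wm' : white Z (linv m) (linv m) = [:: linv m].
  by rewrite /white /side /middle linvK !eqxx (eq_sym m) linv_neq.
have [->|n1] := eqVneq l m.
  have -> : white Z m m = [:: m].
    by rewrite /white /side /middle !eqxx linv_neq.
  by rewrite /sub /= wm.
have [->|n2] := eqVneq l (linv m).
  have -> : white Z m (linv m) = [:: linv m].
    by rewrite /white /side /middle linvK !eqxx orbT linv_neq.
  by rewrite /sub /= wm'.
have wl m' : m' = m \/ m' = linv m -> white Z m' l =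
    nseq (Z l) (linv m') ++ [:: l] ++ nseq (Z (linv l)) m'.
  rewrite /white /side /middle !(linv_eq l) => -[->|->].
    by rewrite linvK (negbTE n1) (negbTE n2).
  by rewrite linvK (negbTE n1) (negbTE n2).
rewrite wl; last by left.
rewrite !sub_cat {2}/sub /= cats0 wl; last by right.
have e1 b : sub (white Z (linv m)) (nseq (nat_of_bool b) m) = nseq b m.
  by case: b; rewrite // /sub /= wm.
have e2 b : sub (white Z (linv m)) (nseq (nat_of_bool b) (linv m)) = nseq b (linv m).
  by case: b; rewrite // /sub /= wm'.
rewrite e1 e2 linvK -!catA.
have c1 (b : bool) w : red (nseq b (linv m) ++ nseq b m ++ w) = red w.
  by case: b => //; rewrite -[RHS](red_cancel (linv m)) linvK.
rewrite c1; case: (Z (linv l)) => //=.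
by rewrite linvK eqxx.
Qed.

Lemma white_red_eq G Z Z' m w : {in letters G, Z =1 Z'} -> over G w ->
  sub (white Z m) w = sub (white Z' m) w.
Proof.
move=> e; elim: w => //= l w IH /andP[hl /IH]; rewrite /sub /= => ->; congr (_ ++ _).
by rewrite /white /side !e ?mem_letters.
Qed.

(** ** The length of the image of a cyclic word *)

(** The pairs [(x, y)] of consecutive letters of a cyclic word are the edges of its
    Whitehead graph, whose vertices are the letters: the edge joins [x^-1] to [y]. *)
Definition cyclic_pairs c := if c is l :: w then zip c (rcons w l) else [::].
Definition cyclically_reduced c := all (fun p => p.2 != linv p.1) (cyclic_pairs c).

Definition crossing Z m (p : (X * bool) * (X * bool)) : bool :=
  side Z m (linv p.1) != side Z m p.2.
Definition not_multiplier m l : bool := ~~ ((l == m) || (l == linv m)).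

Lemma count_zip_rcons (T : Type) (f : pred (T * T)) x y s :
  count f (zip (x :: s) (rcons s y)) = count f (zip (x :: s) s) + f (last x s, y).
Proof. by elim: s x => //= [|z s IH] x; rewrite ?addn0 // IH addnA. Qed.

(** In the image of [l :: w], a multiplier survives between two consecutive
    letters [x], [y] exactly when [x^-1] and [y] are on different sides. *)
Lemma white_image_linear Z m l w : exists2 t,
  red (sub (white Z m) (l :: w)) =
  red (nseq (side Z m l) (linv m) ++ t ++ nseq (side Z m (linv (last l w))) m) &
  size t <= count (not_multiplier m) (l :: w) + count (crossing Z m) (zip (l :: w) w).
Proof.
have size_mid x : size (middle m x) = not_multiplier m x.
  by rewrite /middle /not_multiplier; case: ifP.
elim: w l => [|l' w IH] l.
  exists (middle m l); first by rewrite /sub /= cats0.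
  by rewrite /= size_mid !addn0.
have [t et st] := IH l'.
set a := side Z m (linv l); set b := side Z m l'.
exists (middle m l ++ (if a == b then [::] else if a then [:: m] else [:: linv m]) ++ t).
  rewrite {1}/sub /= -red_cat_red et red_cat_red /white -!catA -/a -/b.
  apply: red_congr => //; apply: red_congr => //.
  case: (a); case: (b) => //=; rewrite ?eqxx //.
  by rewrite -[RHS](@red_cancel _ m).
move: st; rewrite !size_cat size_mid /crossing /= -/a -/b; case: (a); case: (b) => /=; lia.
Qed.

(** Closing the word up costs at most one more multiplier if exactly one of its
    two ends carries one; if both do, the complementary set, with the inverse
    multiplier, gives a conjugate image in which neither end does. *)
Lemma white_image_cyclic Z m l w : exists Z' m', m'.1 = m.1 /\
  size (red (sub (white Z' m') (l :: w))) <=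
  count (not_multiplier m) (l :: w) + count (crossing Z m) (cyclic_pairs (l :: w)).
Proof.
rewrite count_zip_rcons.
have bound Z' m' : ~~ (side Z' m' l && side Z' m' (linv (last l w))) ->
    size (red (sub (white Z' m') (l :: w))) <= count (not_multiplier m') (l :: w) +
    (count (crossing Z' m') (zip (l :: w) w) + crossing Z' m' (last l w, l)).
  move=> h; have [t -> st] := white_image_linear Z' m' l w.
  apply: leq_trans (size_red _) _; move: h st.
  rewrite !size_cat !size_nseq /crossing /=.
  by case: (side Z' m' l); case: (side Z' m' (linv _)) => //=; lia.
have [both|] := boolP (side Z m l && side Z m (linv (last l w))); last first.
  by move=> h; exists Z, m; split=> //; apply: bound.
have sideC x : side (predC Z) (linv m) x = ~~ side Z m x.
  rewrite /side linvK; case: eqVneq => [->|n1]; first by rewrite linv_neq.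
  by case: ifP.
exists (predC Z), (linv m); split=> //.
have -> : count (not_multiplier m) (l :: w) = count (not_multiplier (linv m)) (l :: w).
  by apply: eq_count => x; rewrite /not_multiplier linvK orbC.
have crossC : crossing Z m =1 crossing (predC Z) (linv m).
  by move=> p; rewrite /crossing !sideC; case: (side Z m _); case: (side Z m _).
rewrite (eq_count crossC) crossC; apply: bound; rewrite !sideC.
by case/andP: both => -> ->.
Qed.

Lemma mem_zip_fst (S T : eqType) (s : seq S) (t : seq T) p : p \in zip s t -> p.1 \in s.
Proof.
elim: s t => [|x s IH] [|y t] //=; rewrite !inE => /orP[/eqP->|/IH ->].
  by rewrite eqxx.
by rewrite orbT.
Qed.

Lemma count_pairs_fst l w (f : pred (X * bool)) :
  count (fun p => f p.1) (cyclic_pairs (l :: w)) = count f (l :: w).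
Proof.
by rewrite -[in RHS](@unzip1_zip _ _ (l :: w) (rcons w l)) ?count_map ?size_rcons.
Qed.

Lemma count_pairs_snd l w (f : pred (X * bool)) :
  count (fun p => f p.2) (cyclic_pairs (l :: w)) = count f (l :: w).
Proof.
transitivity (count f (rcons w l)); last by rewrite -cats1 count_cat /=; lia.
by rewrite -[in RHS](@unzip2_zip _ _ (l :: w) (rcons w l)) ?count_map ?size_rcons.
Qed.

(** The right-hand side counts the occurrences of [m] and [m^-1], which are erased,
    and the left-hand side bounds the number of multipliers that appear. *)
Lemma white_shortens Z m l w :
  count (crossing Z m) (cyclic_pairs (l :: w)) <
    count (fun p => p.1 == m) (cyclic_pairs (l :: w)) +
    count (fun p => p.2 == linv m) (cyclic_pairs (l :: w)) ->
  exists Z' m', m'.1 = m.1 /\ size (red (sub (white Z' m') (l :: w))) < size (l :: w).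
Proof.
have [Z' [m' [em h]]] := white_image_cyclic Z m l w => lt.
exists Z', m'; split=> //; apply: leq_ltn_trans h _.
apply: leq_trans (_ : count (not_multiplier m) (l :: w) +
  (count_mem m (l :: w) + count_mem (linv m) (l :: w)) <= _).
  by rewrite ltn_add2l -(count_pairs_fst l w) -(count_pairs_snd l w).
elim: (l :: w) => //= x s IH; rewrite /not_multiplier in IH *.
have [->|n1] := eqVneq x m; first by rewrite eq_sym linv_neq /=; lia.
by case: eqVneq => [|n2] /=; lia.
Qed.

Lemma no_crossing_side Z z : Z z -> ~~ Z (linv z) -> side Z (linv z) =1 Z.
Proof.
move=> Zz Zz' l; rewrite /side linvK; case: eqP => [->|_]; first by rewrite (negbTE Zz').
by case: eqP => [->|].
Qed.

(** If no generator were separated from its inverse by [Z], then all letters of the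
    word would be on the same side; a separated generator serves as multiplier. *)
Lemma disconnected_shortens G Z l w z z' :
  over G (l :: w) ->
  (forall x, x \in G -> x \in map fst (l :: w)) ->
  (forall p, p \in cyclic_pairs (l :: w) -> Z (linv p.1) = Z p.2) ->
  z.1 \in G -> z'.1 \in G -> Z z -> ~~ Z z' ->
  exists Z' m', m'.1 \in G /\ size (red (sub (white Z' m') (l :: w))) < size (l :: w).
Proof.
move=> hw full nc Gz Gz' Zz Zz'.
have [y [Gy Zy nZy]] : exists y, [/\ y.1 \in G, Z y & ~~ Z (linv y)].
  apply: contrapT => none.
  have ZV y : y.1 \in G -> Z (linv y) = Z y.
    move=> Gy; apply/idP/idP => h; apply: contrapT => /negP n; apply: none.
      by exists (linv y); rewrite linvK.
    by exists y.
  have const x : x \in l :: w -> Z x = Z l.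
    have {}nc p : p \in zip (l :: w) w -> Z p.2 = Z p.1.
      move=> hp; rewrite -nc; last first.
        move: hp; rewrite /cyclic_pairs; move: {1 2}l => k.
        elim: w k {full nc hw} => // y w IH k /=.
        by rewrite !inE => /orP[->//|/IH ->]; rewrite orbT.
      by rewrite ZV //; apply: (allP hw); apply: mem_zip_fst hp.
    elim: w l nc {full hw} => [|k w IH] l nc /=; first by rewrite inE => /eqP->.
    have e : Z k = Z l by apply: (nc (l, k)); rewrite mem_head.
    rewrite inE => /orP[/eqP->//|hx]; rewrite -e; apply: IH => // p hp.
    by apply: nc; rewrite inE hp orbT.
  have occ y : y.1 \in G -> Z y = Z l.
    move=> Gy; have /mapP[x hx ex] := full _ Gy.
    rewrite -(const x) //.
    have [->//|->] : y = x \/ y = linv x.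
      by case: y x ex {hx Gy} => [y b] [x c] /= ->; case: b c => [] []; by [left | right].
    by rewrite ZV // -ex.
  by move: Zz'; rewrite occ // -(occ z) // Zz.
have sE := no_crossing_side Zy nZy.
have [|Z' [m' [em h]]] := @white_shortens Z (linv y) l w; last by exists Z', m'; rewrite em.
rewrite (@eq_in_count _ _ pred0) ?count_pred0; last first.
  by move=> p hp; rewrite /crossing !sE nc // eqxx.
rewrite linvK (count_pairs_fst l w (fun k => k == linv y)).
rewrite (count_pairs_snd l w (fun k => k == y)) addn_gt0 -!has_count.
have /mapP[x hx ex] := full _ Gy.
case: (eqVneq x.2 y.2) => e; apply/orP; [right | left]; apply/hasP; exists x => //=.
  by rewrite (surjective_pairing x) -ex e -surjective_pairing.
by case: x y ex e {hx Gy Zy nZy sE} => [x b] [y c] /= ->; case: b c => [] [].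
Qed.

Lemma count_lt_add (T : eqType) (f g h : pred T) (s : seq T) p0 :
  (forall p, p \in s -> f p <= g p + h p) -> p0 \in s -> f p0 < g p0 + h p0 ->
  count f s < count g s + count h s.
Proof.
move=> le hp lt.
have le_count s' : {subset s' <= s} -> count f s' <= count g s' + count h s'.
  elim: s' => //= q s' IH sub_s; have := le _ (sub_s _ (mem_head _ _)).
  have /IH : {subset s' <= s} by move=> x hx; apply: sub_s; rewrite inE hx orbT.
  lia.
case/path.splitPr: hp le_count => s1 s2 le_count; rewrite !count_cat /=.
have h1 : count f s1 <= count g s1 + count h s1.
  by apply: le_count => x hx; rewrite mem_cat hx.
have h2 : count f s2 <= count g s2 + count h s2.
  by apply: le_count => x hx; rewrite mem_cat inE hx !orbT.
lia.
Qed.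

(** Here the graph only falls apart after the vertex [m^-1] is removed. If
    no edge joins [m^-1] to the part [Z], then the whole graph is disconnected;
    otherwise [m] shortens. *)
Lemma cut_vertex_shortens G Z l w m z :
  over G (l :: w) -> (forall x, x \in G -> x \in map fst (l :: w)) ->
  m.1 \in G -> ~~ Z m -> ~~ Z (linv m) -> z.1 \in G -> Z z ->
  (forall p, p \in cyclic_pairs (l :: w) -> p.1 != m -> p.2 != linv m ->
     Z (linv p.1) = Z p.2) ->
  exists Z' m', m'.1 \in G /\ size (red (sub (white Z' m') (l :: w))) < size (l :: w).
Proof.
move=> hw full Gm nZm nZm' Gz Zz nc.
have sE k : side Z m k = (k == linv m) || Z k.
  rewrite /side; case: eqVneq => [->|_]; last by case: eqP.
  by rewrite eq_sym linv_neq (negbTE nZm).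
pose joined (p : (X * bool) * (X * bool)) :=
  (p.1 == m) && Z p.2 || (p.2 == linv m) && Z (linv p.1).
have [/hasP[p hp jp]|/hasPn none] := boolP (has joined (cyclic_pairs (l :: w))).
  have [|Z' [m' [em h]]] := @white_shortens Z m l w; last by exists Z', m'; rewrite em.
  apply: (count_lt_add (p0 := p)) => //= [q hq|].
    rewrite /crossing !sE (inj_eq (inv_inj linvK)).
    have := nc q hq; case: (q.1 == m); case: (q.2 == linv m) => /=;
      case: (Z (linv q.1)); case: (Z q.2) => //= h; by have := h isT isT.
  rewrite /crossing !sE (inj_eq (inv_inj linvK)).
  by case/orP: jp => /andP[-> ->]; rewrite ?orbT /= ?addn1.
apply: (@disconnected_shortens G Z l w z m) => // p hp.
have /norP[n1 n2] := none p hp.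
have [e|ne1] := eqVneq p.1 m; first by move: n1; rewrite e eqxx (negbTE nZm') /= => /negbTE ->.
have [e|ne2] := eqVneq p.2 (linv m); first by move: n2; rewrite e eqxx (negbTE nZm') /= => /negbTE ->.
exact: nc.
Qed.

(** ** Powers of cyclically reduced words *)

Definition wpow c n : word X := flatten (nseq n c).

Lemma wpowS c n : wpow c n.+1 = c ++ wpow c n.
Proof. by []. Qed.

Lemma wpowSr c n : wpow c n.+1 = wpow c n ++ c.
Proof.
elim: n => [|n IH]; first by rewrite /wpow /= cats0.
by rewrite wpowS {1}IH catA.
Qed.

Lemma size_wpow c n : size (wpow c n) = n * size c.
Proof. by elim: n => // n IH; rewrite wpowS size_cat IH mulSn. Qed.

Lemma over_wpow G c n : over G c -> over G (wpow c n).
Proof. by move=> h; elim: n => // n IH; rewrite wpowS over_cat h. Qed.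

Lemma reduced_zip l w : reduced (l :: w) = all (fun p => p.2 != linv p.1) (zip (l :: w) w).
Proof. by rewrite reducedE /=; elim: w l => //= k w IH l; rewrite IH. Qed.

Lemma cyclically_reducedE l w :
  cyclically_reduced (l :: w) = reduced (l :: w) && (l != linv (last l w)).
Proof.
rewrite reduced_zip /cyclically_reduced /cyclic_pairs.
have := count_zip_rcons (fun p => p.2 != linv p.1) l l w.
rewrite !all_count !size_zip size_rcons /= minnn.
have := count_size (fun p => p.2 != linv p.1) (zip (l :: w) w); rewrite size_zip /=.
rewrite (minn_idPr _) // => h ->; case: (l != linv _) => /=; last lia.
by rewrite andbT addn1 eqSS.
Qed.

Lemma wpow_reduced c n : cyclically_reduced c -> reduced (wpow c n).
Proof.
case: c => [|l w]; first by rewrite /wpow; elim: n.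
rewrite cyclically_reducedE => /andP[rw hl].
elim: n => // n IH; rewrite wpowS; case: n IH => [|n]; first by rewrite cats0.
rewrite wpowS reducedE => IH; rewrite reducedE /= cat_path -cat_cons /=.
by move: rw IH; rewrite reducedE /= => -> ->; rewrite hl.
Qed.

(** ** The cut vertex lemma *)

Lemma size_red_cat u v : reduced v -> size v <= size (red (u ++ v)) + size u.
Proof. by move=> hv; rewrite red_catE (red_id hv) size_foldr_push. Qed.

Lemma cyclic_pairs_split l w p : p \in cyclic_pairs (l :: w) ->
  exists s t, l :: w = rcons s p.1 ++ t /\ p.2 = head l t.
Proof.
move=> /(nthP (l, l))[i]; rewrite size_zip size_rcons minnn => hi <-.
rewrite nth_zip ?size_rcons // /=.
exists (take i (l :: w)), (drop i w); split.
  by rewrite -take_nth // -[drop i w]/(drop i.+1 (l :: w)) cat_take_drop.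
rewrite nth_rcons -nth0 nth_drop addn0; case: ltngtP => // [h|->].
  by move: hi; rewrite /= ltnS leqNgt h.
by rewrite nth_default.
Qed.

(** Let [P] be a colouring of the vertices of the Cayley tree that is invariant
    under right multiplication by the cyclically reduced word [c] and changes
    along finitely many edges only. It extends to the ends of the tree, and the
    two ends of every translate of the axis of [c] get the same colour. If [P] is
    not constant, take a vertex [u] as far from the root as possible such that
    the ends behind [u] have both colours. Behind each letter that continues [u]
    there is only one colour, so these letters are coloured; a pair of consecutive
    letters of [c], read as a line through [u], joins two letters of the same
    colour. Hence the Whitehead graph of [c] falls apart, at the latest after the
    vertex that points from [u] to the root is removed. *)
Lemma invariant_colouring_shortens G (P : word X -> bool) l w :
    let c := l :: w in
    over G c -> (forall x, x \in G -> x \in map fst c) -> cyclically_reduced c ->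
    (forall u u', red u = red u' -> P u = P u') ->
    (forall u, over G u -> P (u ++ c) = P u) ->
    (exists M, forall u k, over G (rcons u k) -> reduced u -> M <= size u ->
       P (rcons u k) = P u) ->
    (exists2 x, over G x & P x != P [::]) ->
  exists Z m, m.1 \in G /\ size (red (sub (white Z m) c)) < size c.
Proof.
move=> c oc full crc Pred Pc [M PM] [x ox Px].
have Pcn u n : over G u -> P (u ++ wpow c n) = P u.
  move=> ou; elim: n => [|n IH]; first by rewrite cats0.
  by rewrite wpowSr catA Pc // over_cat ou over_wpow.
have size_cn n : n <= size (wpow c n) by rewrite size_wpow /= leq_pmulr.
pose cone u b := forall t, over G (u ++ t) -> reduced (u ++ t) -> M <= size (u ++ t) ->
  P (u ++ t) = b.
have cone_far u : reduced u -> M <= size u -> cone u (P u).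
  move=> ru hM; elim/last_ind => [|t k IH]; first by rewrite cats0.
  rewrite -rcons_cat => ok rk _.
  have [ot _] : over G (u ++ t) /\ k.1 \in G.
    by move: ok; rewrite -cats1 over_cat /= andbT => /andP[].
  have [rt _] : reduced (u ++ t) /\ true.
    by move: rk; rewrite -cats1 => /reduced_cat[].
  have sM : M <= size (u ++ t) by rewrite size_cat (leq_trans hM) ?leq_addr.
  by rewrite PM // IH.
have root_mixed : ~ exists b, cone [::] b.
  move=> [b cb]; have long u : over G u -> P u = b.
    move=> ou; pose n := M + size u.
    have h := size_red_cat u (wpow_reduced n crc).
    rewrite -(Pcn u n ou) -(Pred _ _ (redK _)); apply: (cb (red (u ++ wpow c n))).
    - by apply: over_red; rewrite over_cat ou over_wpow.
    - exact: red_reduced.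
    - by move: h (size_cn n); rewrite /n /=; lia.
  by move: Px; rewrite !long ?eqxx.
(* The search for [u] ends, as behind a vertex at distance [M] the colour is constant. *)
have [u [ou ru nu hu]] : exists u, [/\ over G u, reduced u, ~ (exists b, cone u b) &
    forall k, k.1 \in G -> reduced (rcons u k) -> exists b, cone (rcons u k) b].
  have [n] := ubnP M; rewrite -[n]addn0 -[0]/(size ([::] : word X)).
  have : over G ([::] : word X) by [].
  have : reduced ([::] : word X) by [].
  elim: n [::] root_mixed => [|n IH] u nu ru ou hn.
    by case: nu; exists (P u); apply: cone_far => //; lia.
  have [all_k|/existsNP[k /not_implyP[Gk /not_implyP[rk nk]]]] := pselect (forall k,
      k.1 \in G -> reduced (rcons u k) -> exists b, cone (rcons u k) b).
    by exists u.
  apply: IH nk rk _ _; last by rewrite size_rcons addnS.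
  by rewrite -cats1 over_cat ou /= Gk.
(* The colour of the ends behind the letter [k], seen from [u]. *)
pose col k := `[< cone (rcons u k) true >].
have colP k : k.1 \in G -> reduced (rcons u k) -> cone (rcons u k) (col k).
  move=> Gk rk; have [[] h] := hu k Gk rk; rewrite /col; case: asboolP => // _.
have letters_c p : p \in cyclic_pairs c -> p.1.1 \in G /\ p.2.1 \in G.
  move=> /cyclic_pairs_split[s [t [e ->]]]; have := oc.
  rewrite /c e over_cat -cats1 over_cat => /andP[/andP[_ /andP[-> _]] ot]; split=> //.
  by case: t ot {e} => [_|k t] /=; [case/andP: oc | case/andP].
(* The line through [u] along the pair [p] is a translate of the axis of [c]. By
   invariance its two ends have the colour of the vertices one period apart on it. *)
have line p : p \in cyclic_pairs c -> reduced (rcons u (linv p.1)) ->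
    reduced (rcons u p.2) -> col (linv p.1) = col p.2.
  move=> hp r1 r2; have [G1 G2] := letters_c p hp.
  have [s [t [e e2]]] := cyclic_pairs_split hp.
  have ray k q : k.1 \in G -> reduced (rcons u k) -> over G q -> reduced q ->
      M < size q -> head l q = k -> P (u ++ q) = col k.
    move=> Gk rk; case: q => // k' q oq rq hM /= ek; rewrite {}ek in oq rq *.
    rewrite -cat_rcons; apply: colP => //; rewrite cat_rcons.
    - by rewrite over_cat ou.
    - by move: rk rq; rewrite !reducedE sorted_cat_cons => -> /=.
    - by rewrite size_cat; apply: leq_trans (ltnW hM) (leq_addl _ _).
  have ot : over G t by move: oc; rewrite /c e over_cat => /andP[].
  have os : over G (rcons s p.1) by move: oc; rewrite /c e over_cat => /andP[].
  have fwd : P (u ++ t) = col p.2.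
    rewrite -(Pcn _ M.+1) ?over_cat ?ou // -catA; apply: ray => //.
    - by rewrite over_cat ot over_wpow.
    - have := wpow_reduced M.+2 crc; rewrite wpowS {1}/c e -catA.
      by case/reduced_cat.
    - by rewrite size_cat; apply: leq_trans (leq_addl _ _); apply: size_cn.
    - by rewrite e2 wpowS; case: (t).
  rewrite -fwd.
  pose q := wpow c M.+1 ++ rcons s p.1.
  have bwd : P (u ++ winv q) = col (linv p.1).
    apply: ray; rewrite ?over_winv ?size_winv //.
    - by rewrite over_cat over_wpow.
    - apply: reduced_winv; have := wpow_reduced M.+2 crc.
      by rewrite wpowSr {2}/c e catA; case/reduced_cat.
    - by rewrite size_cat; apply: leq_trans (leq_addr _ _); apply: size_cn.
    - by rewrite /q -rcons_cat /winv map_rcons rev_rcons.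
  have ouq : over G (u ++ winv q).
    by rewrite over_cat ou over_winv over_cat over_wpow.
  rewrite -bwd -(Pcn _ M.+2) //; apply: Pred; rewrite wpowSr {2}/c e.
  rewrite -catA; apply: red_congr => //.
  have -> : wpow c M.+1 ++ rcons s p.1 ++ t = q ++ t by rewrite /q catA.
  by rewrite catA -red_red_cat red_Vcat.
have [k1 [k2 [[G1 r1] [G2 r2] ne]]] : exists k1 k2, [/\ k1.1 \in G /\ reduced (rcons u k1),
    k2.1 \in G /\ reduced (rcons u k2) & col k1 != col k2].
  apply: contrapT => none; apply: (nu).
  have [k [Gk rk]] : exists k, k.1 \in G /\ reduced (rcons u k).
    have Gl : l.1 \in G by case/andP: oc.
    case/lastP: u ru {none nu ou hu col colP line} => [|u0 k0] ru; first by exists l.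
    have [e|ne] := eqVneq l (linv k0).
      by exists (linv l); split=> //; rewrite reduced_rcons ru e linvK eq_sym linv_neq.
    by exists l; rewrite reduced_rcons ru ne; split=> //; case/andP: oc.
  exists (col k) => -[|k' t] ot rt sM.
    have := cone_far u ru; rewrite cats0 in sM *; move=> /(_ sM) h.
    by case: nu; exists (P u).
  rewrite -cat_rcons; rewrite -cat_rcons in ot rt sM.
  have rk' : reduced (rcons u k') by case/reduced_cat: rt.
  have Gk' : k'.1 \in G by move: ot; rewrite -cats1 !over_cat /= => /andP[/andP[_ /andP[]]].
  rewrite (colP k') //; apply/eqP/negP => /negP nek; apply: none.
  by exists k', k.
pose Z (k0 : X * bool) : pred (X * bool) := fun k =>
  [&& k.1 \in G, reduced (rcons u k) & col k != col k0].
have Zline k0 p : p \in cyclic_pairs c -> reduced (rcons u (linv p.1)) ->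
    reduced (rcons u p.2) -> Z k0 (linv p.1) = Z k0 p.2.
  move=> hp ra rb; have [Ga Gb] := letters_c p hp.
  by rewrite /Z ra rb Gb /= Ga line.
have Zex k0 : exists2 z, z.1 \in G & Z k0 z.
  have [e|n] := eqVneq (col k1) (col k0).
    by exists k2; rewrite // /Z G2 r2 -e eq_sym.
  by exists k1; rewrite // /Z G1 r1.
have Zself k : ~~ Z k k by rewrite /Z eqxx !andbF.
have Zbad k k' : ~~ reduced (rcons u k') -> ~~ Z k k'.
  by rewrite /Z => /negbTE ->; rewrite andbF.
clear nu hu colP r1 r2 ne cone_far root_mixed.
case/lastP: u ru ou @col line @Z Zself Zbad Zline Zex =>
    [|u0 m] ru ou col line Z Zself Zbad Zline Zex.
  have [z Gz Zz] := Zex l.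
  apply: (@disconnected_shortens G (Z l) l w z l) => //.
  - by move=> p hp; apply: Zline.
  - by case/andP: oc.
have red_m k : reduced (rcons (rcons u0 m) k) = (k != linv m).
  by rewrite reduced_rcons ru.
have Gm : m.1 \in G by move: ou; rewrite -cats1 over_cat /= => /andP[_ /andP[]].
have [z Gz Zz] := Zex m.
apply: (@cut_vertex_shortens G (Z m) l w m z) => //.
- by apply: Zbad; rewrite red_m eqxx.
- by move=> p hp n1 n2; apply: Zline; rewrite // red_m // (inj_eq (inv_inj linvK)).
Qed.

End Whitehead.
(** * Recognizing primitive and simple elements *)

Section Reduction.
Variables (X : eqType) (F : groupType).
Local Open Scope group_scope.
Implicit Types (G : seq X) (v : X -> F) (H K : set F) (m : X * bool) (w c : word X).

(** Conjugations by letters are Whitehead moves, so that cyclic reduction needs no moves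
    of its own. *)
Lemma white_conj m w : red (sub (white predT m) w) = red (linv m :: rcons w m).
Proof.
have wE k : red (white predT m k) = red [:: linv m; k; m].
  rewrite /white /side /middle (linv_eq k) (inj_eq (inv_inj linvK)).
  have [->|n1] := eqVneq k m.
    by rewrite (eq_sym m) linv_neq /= (eq_sym m) linv_neq /= linvK eqxx.
  have [->|n2] := eqVneq k (linv m); first by rewrite /= linvK eqxx.
  by [].
elim: w => [|k w IH]; first by rewrite /= linvK eqxx.
rewrite {1}/sub /= -/(sub _ w) (red_congr (wE k) IH).
rewrite -[RHS]/(red ([:: linv m; k] ++ rcons w m)) -[[:: linv m; k; m]]/([:: linv m; k] ++ [:: m]).
rewrite -catA; apply: red_congr => //=.
by rewrite -{1}[m]linvK pushK ?red_reduced.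
Qed.

Lemma not_cyclically_reduced_shortens l w :
  reduced (l :: w) -> ~~ cyclically_reduced (l :: w) ->
  size (red (sub (white predT l) (l :: w))) < size (l :: w).
Proof.
move=> rc; rewrite cyclically_reducedE rc /= negbK => /eqP el.
case/lastP: w el {rc} => [|w k] /=; first by move=> /eqP; rewrite eq_sym linv_neq.
rewrite last_rcons => ->; rewrite white_conj linvK.
have -> : red (k :: rcons (linv k :: rcons w k) (linv k)) = red w.
  rewrite rcons_cons red_cancel -!cats1 -catA.
  exact: (red_catVK w [:: k]).
by apply: leq_ltn_trans (size_red _) _; rewrite size_rcons ltnW.
Qed.

Lemma fgen_ball G v H (D : seq F) : fgen G v H ->
  exists M, forall u, over G u -> reduced u -> word_val v u \in D -> size u < M.
Proof.
move=> fg; elim: D => [|d D [M hM]]; first by exists 0.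
have [[u0 [ou0 ru0 e0]]|no] := pselect (exists u, [/\ over G u, reduced u & word_val v u = d]).
  exists (maxn M (size u0).+1) => u ou ru; rewrite inE => /orP[/eqP e|h].
    have : red u = red u0 by apply: (fgen_inj fg); rewrite // e.
    by rewrite !red_id // => ->; rewrite leq_maxr.
  by apply: leq_trans (hM u ou ru h) (leq_maxl _ _).
exists M => u ou ru; rewrite inE => /orP[/eqP e|]; last exact: hM.
by case: no; exists u.
Qed.

(** The set that separates [1] from a generator outside [K] colours the Cayley tree of
    the generators in use, and right multiplication by the element of [K] preserves
    the colouring. *)
Lemma free_factor_shortens G v H K c : fgen G v H -> free_factor H K ->
    over G c -> reduced c -> K (word_val v c) ->
    (exists2 l, l \in c & ~ K (v l.1)) ->
  exists Z m, m.1 \in G /\ size (red (sub (white Z m) c)) < size c.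
Proof.
move=> fg ff oc rc Kc [l0 l0c nK].
case: c oc rc Kc l0c => [//|l w] oc rc Kc l0c.
have [cr|ncr] := boolP (cyclically_reduced (l :: w)); last first.
  exists predT, l; split; first by case/andP: oc.
  exact: not_cyclically_reduced_shortens.
pose G' := undup (map fst (l :: w)).
have sG' : {subset G' <= G}.
  by move=> x; rewrite mem_undup => /mapP[k hk ->]; apply: (allP oc).
have oc' : over G' (l :: w) by apply/allP => k hk; rewrite mem_undup map_f.
have Gl0 : l0.1 \in G by apply: (allP oc).
have sp w' : over G w' -> H (word_val v w') by apply: (fgen_mem fg).
have Hx : H (v l0.1) by rewrite -[v _](word_val1 v (l0.1, false)); apply: sp; rewrite /= Gl0.
have [S [S1 Sx SK Sfin]] := free_factor_separation ff Hx nK.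
suff [Z [m [hm hs]]] : exists Z m, m.1 \in G' /\ size (red (sub (white Z m) (l :: w))) < size (l :: w).
  by exists Z, m; split=> //; apply: sG'.
apply: (@invariant_colouring_shortens _ G' (fun u => `[< S (word_val v u) >])) => //.
- by move=> x; rewrite mem_undup.
- by move=> u u' e; rewrite (word_val_eq v e).
- move=> u ou; rewrite word_val_cat; apply: asbool_equiv_eq; apply: SK => //.
  by apply: sp; apply: over_sub ou.
- have [D hD] : exists D : seq F, forall y k, H y -> k \in letters G' -> y \notin D ->
      (S (y * word_val v [:: k]) <-> S y).
    have : {subset letters G' <= letters G}.
      by move=> k; rewrite !mem_letters => /sG'.
    elim: (letters G') => [|k s IH] hs; first by exists [::].
    have [|D hD] := IH; first by move=> j hj; apply: hs; rewrite inE hj orbT.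
    have [|D' hD'] := Sfin (word_val v [:: k]).
      by apply: sp; rewrite /= -mem_letters hs ?mem_head.
    exists (D ++ D') => y j Hy; rewrite inE mem_cat => + /norP[n1 n2].
    by case/orP => [/eqP->|hj]; [apply: hD' | apply: hD].
  have [M hM] := fgen_ball D fg.
  exists M => u k; rewrite -cats1 over_cat /= andbT => /andP[ou hk] ru sM.
  have ou' : over G u by apply: over_sub ou.
  rewrite word_val_cat; apply: asbool_equiv_eq; apply: hD; first exact: sp.
    by rewrite mem_letters.
  by apply/negP => /(hM u ou' ru); rewrite ltnNge sM.
- exists [:: (l0.1, false)]; first by rewrite /= mem_undup map_f.
  by rewrite word_val1 word_val_nil /=; case: asboolP => // _; case: asboolP.
Qed.

(** ** The reduction procedure *)

Fixpoint subsets (T : Type) (s : seq T) : seq (seq T) :=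
  if s is x :: s' then subsets s' ++ [seq x :: t | t <- subsets s'] else [:: [::]].

Lemma filter_subsets (T : eqType) (p : pred T) (s : seq T) : filter p s \in subsets s.
Proof.
elim: s => //= x s IH; rewrite mem_cat; case: ifP => _; last by rewrite IH.
by rewrite (map_f (cons x)) ?orbT.
Qed.

Definition moves G w : seq (word X) :=
  [seq red (sub (white (mem Z) m) w) | m <- letters G, Z <- subsets (letters G)].
Definition shorter w u : word X := if size u < size w then u else w.
Definition shorten G w : word X := foldl shorter w (moves G w).
Definition minimize G w : word X := iter (size w) (shorten G) (red w).

Definition minimal G w := forall Z m, m.1 \in G -> size w <= size (red (sub (white Z m) w)).

Lemma foldl_shorter w s : foldl shorter w s \in w :: s /\
  forall u, u \in w :: s -> size (foldl shorter w s) <= size u.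
Proof.
elim: s w => [|x s IH] w /=.
  by rewrite mem_head; split=> // u; rewrite inE => /eqP->.
have [h1 h2] := IH (shorter w x); split.
  move: h1; rewrite !inE => /orP[/eqP->|->]; last by rewrite !orbT.
  by rewrite /shorter; case: ifP; rewrite eqxx ?orbT.
have [le1 le2] : size (shorter w x) <= size w /\ size (shorter w x) <= size x.
  by rewrite /shorter; case: ltnP => [/ltnW|].
have hs := h2 _ (mem_head _ _) => u.
rewrite !inE => /or3P[/eqP->|/eqP->|hu]; try exact: leq_trans hs _.
by apply: h2; rewrite inE hu orbT.
Qed.

Lemma mem_moves G Z m w : over G w -> m.1 \in G ->
  red (sub (white Z m) w) \in moves G w.
Proof.
move=> ow hm; apply/allpairsP; exists (m, filter Z (letters G)); split=> /=.
- by rewrite mem_letters.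
- exact: filter_subsets.
- congr red; apply: white_red_eq ow => k hk /=.
  by rewrite mem_filter hk andbT.
Qed.

Lemma shorten_minimal G w : over G w -> size (shorten G w) < size w \/ minimal G w.
Proof.
move=> ow; have [_ h] := foldl_shorter w (moves G w).
have [|big] := ltnP (size (shorten G w)) (size w); [by left | right].
move=> Z m hm; apply: leq_trans big _; apply: h; rewrite inE; apply/orP; right.
exact: mem_moves.
Qed.

Lemma shorten_fixed G w : minimal G w -> shorten G w = w.
Proof.
move=> mw; rewrite /shorten.
have : forall x, x \in moves G w -> size w <= size x.
  move=> x /allpairsP[[m Z] [/= hm _ ->]]; apply: mw.
  by rewrite -mem_letters.
elim: (moves G w) => //= x s IH hs.
rewrite {2}/shorter ltnNge hs ?mem_head //=; apply: IH => y hy.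
by apply: hs; rewrite inE hy orbT.
Qed.

(** Moves are invertible substitutions and only change the basis. Each round that
    does not stop removes a letter, so there are enough rounds. *)
Lemma minimizeP G v H w : fgen G v H -> over G w -> exists v',
  [/\ fgen G v' H, over G (minimize G w), reduced (minimize G w),
      word_val v' (minimize G w) = word_val v w & minimal G (minimize G w)].
Proof.
move=> fg ow.
have step v1 u : fgen G v1 H -> over G u -> reduced u -> exists v2,
    [/\ fgen G v2 H, over G (shorten G u), reduced (shorten G u) &
        word_val v2 (shorten G u) = word_val v1 u].
  move=> fg1 ou ru; have [+ _] := foldl_shorter u (moves G u); rewrite -/(shorten G u).
  rewrite inE => /orP[/eqP->|/allpairsP[[m Z] [/= hm _ ->]]]; first by exists v1.
  rewrite mem_letters in hm.
  have ow1 := @over_white X G (mem Z) m; have ow2 := @over_white X G (mem Z) (linv m).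
  have [||fg2 e2] := fgen_change fg1 (white_compatible (mem Z) m)
    (white_compatible (mem Z) (linv m)) (fun l => ow1 l hm) (fun l => ow2 l hm).
  - by move=> l _; apply: whiteK.
  - by move=> l _; rewrite -{1}[m]linvK; apply: whiteK.
  eexists; split; [exact: fg2 | | exact: red_reduced | by rewrite word_val_red; apply: e2].
  by apply: over_red; apply: over_sub_word ou => l; apply: over_white.
have iterP n : exists v',
    [/\ fgen G v' H, over G (iter n (shorten G) (red w)), reduced (iter n (shorten G) (red w)) &
        word_val v' (iter n (shorten G) (red w)) = word_val v w].
  elim: n => [|n [v1 [fg1 o1 r1 e1]]].
    by exists v; split; rewrite ?over_red ?red_reduced ?word_val_red.
  by have [v2 [? ? ? e2]] := step v1 _ fg1 o1 r1; exists v2; split; rewrite // e2.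
have [v' [fg' o' r' e']] := iterP (size w); exists v'; split=> //.
have drop n : size (iter n (shorten G) (red w)) + n <= size w \/
    minimal G (iter n (shorten G) (red w)).
  elim: n => [|n [IH|IH]] /=; first by left; rewrite addn0 size_red.
    have [_ [_ on _ _]] := iterP n.
    have [lt|mn] := shorten_minimal on; [left | by right; rewrite shorten_fixed].
    by rewrite addnS -addSn; apply: leq_trans IH; rewrite leq_add2r.
  by right; rewrite shorten_fixed.
have [h|//] := drop (size w) => Z m _.
suff -> : size (minimize G w) = 0 by [].
by move: h; rewrite /minimize -{3}[size w]add0n leq_add2r leqn0 => /eqP.
Qed.

Lemma minimal_cyclically_reduced G c : over G c -> reduced c -> minimal G c ->
  cyclically_reduced c.
Proof.
case: c => // l w oc rc mc; apply/negPn/negP => /(not_cyclically_reduced_shortens rc).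
by rewrite ltnNge mc //; case/andP: oc.
Qed.

Definition primitive_word G w : bool := size (minimize G w) == 1%N.
Definition simple_word G w : bool :=
  has (fun x => all (fun l => l.1 != x) (minimize G w)) G.

Lemma wpow_val v c n : word_val v (wpow c n) = word_val v c ^+ n.
Proof.
elim: n => [|n IH]; first by rewrite word_val_nil expg0.
by rewrite wpowS word_val_cat IH expgS.
Qed.

(** If a minimal word of length at least two were primitive, the cyclic group that it
    generates would be a free factor without the generators that occur in the word:
    the nontrivial powers of a cyclically reduced word are at least as long. *)
Lemma primitive_wordP G v H w : fgen G v H -> over G w ->
  primitive_word G w <-> primitive_in H (word_val v w).
Proof.
move=> fg ow; have [v' [fg' oc rc <- mc]] := minimizeP fg ow.
rewrite /primitive_word; set c := minimize G w in oc rc mc *; split.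
  case: c oc {rc mc} => [|l [|]] //= /andP[hl _] _.
  exact: fgen_letter_primitive fg' hl.
move=> pr; have ff := primitive_free_factor pr.
have cr := minimal_cyclically_reduced oc rc mc.
case: c oc rc mc cr pr ff => [|l c] oc rc mc cr pr ff.
  by case: pr; rewrite word_val_nil.
have [e|n1] := eqVneq (size (l :: c)) 1%N; first by [].
have Gl : l.1 \in G by case/andP: oc.
have nK : ~ gen [set word_val v' (l :: c)]%classic (v' l.1).
  move=> /gen_single[n hn].
  have [b eb] : exists b, word_val v' [:: (l.1, b)] = word_val v' (wpow (l :: c) n).
    by rewrite wpow_val; case: hn => <-; [exists false | exists true]; rewrite word_val1.
  have : red [:: (l.1, b)] = red (wpow (l :: c) n).
    by apply: (fgen_inj fg') eb; rewrite ?over_wpow //= Gl.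
  rewrite (red_id (wpow_reduced n cr)) => /(congr1 size); rewrite size_wpow /=.
  by move=> /esym/eqP; rewrite muln_eq1 (negbTE n1) andbF.
exfalso.
have [||Z [m [hm]]] := free_factor_shortens fg' ff oc rc.
- by exists [:: (word_val v' (l :: c), false)]; rewrite ?word_val1 // => k; rewrite inE => /eqP->.
- by exists l; rewrite ?mem_head.
- by rewrite ltnNge mc.
Qed.

Lemma simple_wordP G v H w : fgen G v H -> over G w -> word_val v w <> 1 ->
  simple_word G w <-> simple_in H (word_val v w).
Proof.
move=> fg ow; have [v' [fg' oc rc <- mc]] := minimizeP fg ow => ne.
split; first by move=> /hasP[x hx nx]; apply: fgen_omit_simple fg' hx oc nx ne.
move=> [_ [K [ff nKH Kc]]]; apply: contrapT => /negP/hasPn full.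
have [x hx nK] : exists2 x, x \in G & ~ K (v' x).
  apply: contrapT => h; apply: nKH.
  have [L [_ [sK _] [KH _] _]] := ff.
  apply/seteqP; split=> //; case: (fg') => -> _ _ [u ou <-].
  apply: subgroup_word => // k hk; apply: contrapT => nk; apply: h.
  by exists k.1 => //; apply: (allP ou).
have [|Z [m [hm]]] := free_factor_shortens fg' ff oc rc Kc; last by rewrite ltnNge mc.
have /allPn[l hl] := full x hx; rewrite negbK => /eqP e.
by exists l; rewrite // e.
Qed.

End Reduction.

(** * Subgroups of finite index as pointed covers *)

Section Covers.
Implicit Types (i k N : nat) (w : word nat).

(** The action of the letters on the vertices [0, .., k-1] of a cover of the rose
    with [N] petals. The letter [par i] leads from the vertex [i > 0] to a smaller
    one; hence the cover is connected, and the edges of these letters form a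
    spanning tree rooted at [0]. *)
Definition is_cover N k (act : nat -> nat * bool -> nat) (par : nat -> nat * bool) :=
  [/\ 0 < k,
      (forall i l, i < k -> l.1 < N -> act i l < k /\ act (act i l) (linv l) = i) &
      (forall i, 0 < i < k -> (par i).1 < N /\ act i (par i) < i)].

Variables (N k : nat) (act : nat -> nat * bool -> nat) (par : nat -> nat * bool).

(** The edge of the cover from [i] to [act i (a, false)] is named [(i, a)]. *)
Definition edge i l : (nat * nat) * bool :=
  if l.2 then ((act i l, l.1), true) else ((i, l.1), false).
Fixpoint trace i w : word (nat * nat)%type :=
  if w is l :: w' then edge i l :: trace (act i l) w' else [::].
Definition endpoint i w : nat := foldl act i w.
Definition tree : seq (nat * nat) := [seq (edge i (par i)).1 | i <- iota 1 k.-1].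
Definition cotree : seq (nat * nat) :=
  [seq e <- [seq (i, a) | i <- iota 0 k, a <- iota 0 N] | e \notin tree].
Definition off_tree (u : word (nat * nat)%type) := [seq l <- u | l.1 \notin tree].

Lemma over_iota n w : over (iota 0 n) w = all (fun l => l.1 < n) w.
Proof. by apply: eq_all => l; rewrite mem_iota. Qed.

Hypothesis cov : is_cover N k act par.
Local Notation base := (over (iota 0 N)).

Let k_gt0 : 0 < k. Proof. by case: cov. Qed.

Lemma act_lt i l : i < k -> l.1 < N -> act i l < k.
Proof. by case: cov => _ h _ hi hl; case: (h i l hi hl). Qed.

Lemma actK i l : i < k -> l.1 < N -> act (act i l) (linv l) = i.
Proof. by case: cov => _ h _ hi hl; case: (h i l hi hl). Qed.

Lemma edge_linv i l : i < k -> l.1 < N -> edge (act i l) (linv l) = linv (edge i l).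
Proof. by move=> hi hl; rewrite /edge actK //; case: l hl => a []. Qed.

Lemma trace_cat i u w : trace i (u ++ w) = trace i u ++ trace (endpoint i u) w.
Proof. by elim: u i => //= l u IH i; rewrite IH. Qed.

Lemma endpoint_cat i u w : endpoint i (u ++ w) = endpoint (endpoint i u) w.
Proof. exact: foldl_cat. Qed.

Lemma endpoint_lt i w : i < k -> base w -> endpoint i w < k.
Proof.
rewrite over_iota; elim: w i => //= l w IH i hi /andP[hl hw].
by apply: IH => //; apply: act_lt.
Qed.

Lemma trace_winv i w : i < k -> base w ->
  trace (endpoint i w) (winv w) = winv (trace i w) /\ endpoint (endpoint i w) (winv w) = i.
Proof.
rewrite over_iota; elim: w i => //= l w IH i hi /andP[hl hw].
have hi' : act i l < k by apply: act_lt.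
have [e1 e2] := IH _ hi' hw.
rewrite !winv_cons -!cats1 trace_cat endpoint_cat e1 e2 /= actK //.
by rewrite edge_linv.
Qed.

Lemma trace_red i w : i < k -> base w ->
  red (trace i (red w)) = red (trace i w) /\ endpoint i (red w) = endpoint i w.
Proof.
rewrite over_iota; elim: w i => //= l w IH i hi /andP[hl hw].
have hi' : act i l < k by apply: act_lt.
have [e1 e2] := IH _ hi' hw.
suff [-> ->] : red (trace i (push l (red w))) = red (trace i (l :: red w)) /\
    endpoint i (push l (red w)) = endpoint i (l :: red w) by rewrite /= e1 e2.
case: (red w) => [|h s] //; rewrite /push; case: eqP => [->|//].
by rewrite [trace i (l :: _)]/= edge_linv // actK // red_cancel /= actK.
Qed.

Lemma off_tree_cat s t : off_tree (s ++ t) = off_tree s ++ off_tree t.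
Proof. exact: filter_cat. Qed.

Lemma off_tree_winv u : off_tree (winv u) = winv (off_tree u).
Proof.
elim: u => //= l u IH; rewrite winv_cons -cats1 off_tree_cat IH /=.
by case: ifP => _; rewrite ?cats0 // winv_cons cats1.
Qed.

Lemma off_tree_congr s t : red s = red t -> red (off_tree s) = red (off_tree t).
Proof.
have offE u : off_tree u = sub (fun l => if l.1 \notin tree then [:: l] else [::]) u.
  by elim: u => //= l u IH; rewrite /sub /= -/(sub _ u) -IH; case: ifP.
rewrite !offE; apply: sub_congr => l /=; case: ifP => // _.
by rewrite cat1s -[[:: l; linv l]]/([:: l] ++ winv [:: l]) red_catV.
Qed.

Lemma over_cotree u : all (fun l => (l.1.1 < k) && (l.1.2 < N)) u -> over cotree (off_tree u).
Proof.
elim: u => //= -[[i a] b] u IH /andP[/= /andP[hi ha] /IH hu]; case: ifP => //= hn.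
rewrite hu andbT mem_filter hn; apply/allpairsP; exists (i, a).
by rewrite !mem_iota.
Qed.

Lemma trace_bounds i w : i < k -> base w ->
  all (fun l => (l.1.1 < k) && (l.1.2 < N)) (trace i w).
Proof.
rewrite over_iota; elim: w i => //= l w IH i hi /andP[hl hw].
have hi' : act i l < k by apply: act_lt.
by rewrite IH // andbT /edge; case: ifP => /= _; rewrite ?hi ?hi' hl.
Qed.

(** ** The branches of the tree *)

(** The path in the tree from [0] to [i]; the parents decrease, so [i] bounds its length. *)
Fixpoint branch_rec n i : word nat :=
  if n is n'.+1 then
    if i == 0 then [::] else rcons (branch_rec n' (act i (par i))) (linv (par i))
  else [::].
Definition branch i := branch_rec i i.

Lemma branchS i : 0 < i < k -> branch i = rcons (branch (act i (par i))) (linv (par i)).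
Proof.
have fuel n m j : j <= n -> j <= m -> j < k -> branch_rec n j = branch_rec m j.
  elim: n m j => [|n IH] [|m] j //=.
  - by rewrite leqn0 => /eqP->.
  - by move=> _; rewrite leqn0 => /eqP->.
  move=> hn hm hk; case: eqP => // /eqP j0.
  have jk : 0 < j < k by rewrite lt0n j0 hk.
  have [_ _ /(_ j jk)[_ lt]] := cov.
  congr rcons; apply: IH; last exact: ltn_trans lt hk.
    by rewrite -ltnS; apply: leq_trans lt hn.
  by rewrite -ltnS; apply: leq_trans lt hm.
move=> hi; have [_ _ /(_ i hi)[_ lt]] := cov.
move: hi; rewrite /branch; case: i lt => // i lt hi /=.
by congr rcons; apply: fuel => //; apply: ltn_trans lt _.
Qed.

Lemma branchP i : i < k ->
  [/\ base (branch i), endpoint 0 (branch i) = i & off_tree (trace 0 (branch i)) = [::]].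
Proof.
elim/ltn_ind: i => i IH hi; case: (posnP i) => [->|i0]; first by [].
have hik : 0 < i < k by rewrite i0.
have [_ _ /(_ i hik)[Np lt]] := cov; have hj := ltn_trans lt hi.
have [b e o] := IH _ lt hj; rewrite branchS // -cats1; split.
- by rewrite over_cat b /= mem_iota /= Np.
- by rewrite endpoint_cat e /= actK.
rewrite trace_cat off_tree_cat e o /= edge_linv // ifN //= negbK.
by apply/mapP; exists i; rewrite // mem_iota; lia.
Qed.

(** ** The Schreier basis *)

Variables (F : groupType) (a : nat -> F).
Local Open Scope group_scope.

Definition loop_of (e : nat * nat) : word nat :=
  branch e.1 ++ (e.2, false) :: winv (branch (act e.1 (e.2, false))).
Definition loop_letter (l : (nat * nat) * bool) : word nat :=
  if l.2 then winv (loop_of l.1) else loop_of l.1.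
Definition schreier (e : nat * nat) : F := word_val a (loop_of e).
Definition cover_group : set F :=
  [set h | exists w, [/\ base w, endpoint 0 w = 0 & word_val a w = h]]%classic.

Lemma schreier_edge i l : i < k -> l.1 < N ->
  word_val schreier [:: edge i l] =
  word_val a (branch i) * word_val a [:: l] * (word_val a (branch (act i l)))^-1.
Proof.
move=> hi hl; rewrite word_val1 /edge; case: l hl => x [] /= hl.
  rewrite /schreier /loop_of /= (actK (l := (x, true))) // word_val_cat word_val_cons /=.
  by rewrite word_val_winv word_val1 /= !invgM !invgK.
by rewrite /schreier /loop_of /= word_val_cat word_val_cons word_val_winv word_val1 /= mulgA.
Qed.

Lemma schreier_trace i w : i < k -> base w ->
  word_val schreier (off_tree (trace i w)) =
  word_val a (branch i) * word_val a w * (word_val a (branch (endpoint i w)))^-1.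
Proof.
have tree1 l : l.1 \in tree -> word_val schreier [:: l] = 1.
  move=> /mapP[j]; rewrite mem_iota => hj el.
  have hjk : 0 < j < k by move: hj; lia.
  have [_ _ /(_ j hjk)[Np _]] := cov; have hk : j < k by case/andP: hjk.
  have : word_val schreier [:: edge j (par j)] = 1.
    rewrite schreier_edge // (branchS hjk) -cats1 word_val_cat word_val_linv.
    by rewrite mulgVK mulgV.
  rewrite !word_val1 el; case: (edge _ _).2 => [/(congr1 (fun x => x^-1))|] e.
    by move: e; rewrite invgK invg1 => ->; case: l.2; rewrite ?invg1.
  by rewrite e; case: l.2; rewrite ?invg1.
rewrite over_iota; elim: w i => [|l w IH] i hi /=.
  by move=> _; rewrite !word_val_nil mulg1 mulgV.
move=> /andP[hl hw]; have hi' : act i l < k by apply: act_lt.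
transitivity (word_val schreier [:: edge i l] *
              word_val schreier (off_tree (trace (act i l) w))).
  case: ifP => [_|/negbFE h]; first by rewrite -cat1s word_val_cat.
  by rewrite tree1 // mul1g.
rewrite IH // schreier_edge // -[l :: w]cat1s word_val_cat.
by rewrite !mulgA mulgVK.
Qed.

Lemma loop_letterP l : l.1 \in cotree ->
  [/\ base (loop_letter l), endpoint 0 (loop_letter l) = 0 &
      off_tree (trace 0 (loop_letter l)) = [:: l]].
Proof.
case: l => -[i x] b; rewrite mem_filter => /andP[nt /allpairsP[[i' x'] [/=]]].
rewrite !mem_iota /= !add0n => hi hx [ei ex]; rewrite -{i'}ei -{x'}ex in hi hx.
have hj : act i (x, false) < k by apply: act_lt.
have [bi ei oi] := branchP hi; have [bj ej oj] := branchP hj.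
have [tj tj'] := trace_winv k_gt0 bj; rewrite ej in tj tj'.
have bl : base (loop_of (i, x)).
  by rewrite over_cat bi /= over_winv bj mem_iota add0n hx.
have el : endpoint 0 (loop_of (i, x)) = 0 by rewrite endpoint_cat ei.
have ol : off_tree (trace 0 (loop_of (i, x))) = [:: ((i, x), false)].
  rewrite trace_cat off_tree_cat oi ei /= {1}/edge /= nt tj.
  by rewrite -/(off_tree _) off_tree_winv oj.
case: b nt => nt; rewrite /loop_letter //=.
have [tl tl'] := trace_winv k_gt0 bl; rewrite el in tl tl'.
by split; rewrite ?over_winv // tl off_tree_winv ol.
Qed.

Hypothesis fa : fgen (iota 0 N) a setT.

(** Reading a word in the cover and dropping the edges of the tree inverts the map that
    sends a word in the remaining edges to the corresponding word in the loops. As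
    it respects free reduction, the loops have no relation. *)
Lemma schreier_fgen : fgen cotree schreier cover_group.
Proof.
have loops u : over cotree u -> [/\ base (sub loop_letter u),
    endpoint 0 (sub loop_letter u) = 0 & off_tree (trace 0 (sub loop_letter u)) = u].
  elim: u => // l u IH /= /andP[hl /IH[b e o]]; have [bl el ol] := loop_letterP hl.
  rewrite /sub /= -/(sub _ u); split; first by rewrite over_cat bl.
    by rewrite endpoint_cat el.
  by rewrite trace_cat off_tree_cat el o ol.
have val_loops u : word_val a (sub loop_letter u) = word_val schreier u.
  by apply: word_val_sub => l _; rewrite word_val1 /loop_letter; case: ifP; rewrite ?word_val_winv.
split.
  apply/seteqP; split=> h.
    move=> [w [bw ew <-]]; exists (off_tree (trace 0 w)).
      by apply: over_cotree; apply: trace_bounds.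
    by rewrite schreier_trace // ew word_val_nil mul1g invg1 mulg1.
  move=> [u ou <-]; have [b e _] := loops u ou.
  by exists (sub loop_letter u); split.
move=> u ou; rewrite -val_loops => e; have [b _ o] := loops u ou.
rewrite -o; have [h _] := trace_red k_gt0 b.
rewrite -(off_tree_congr h); have -> // : red (sub loop_letter u) = [::].
by case: fa => _; apply.
Qed.

(** Words with equal values lead to the same vertex, because reduction does not change the
    endpoint; so the endpoint tells the coset. *)
Lemma cover_coset_code : exists q : F -> nat,
  [/\ (forall x, q x < k), (forall x y, q x = q y <-> cover_group (x * y^-1)),
      (forall i, i < k -> exists x, q x = i) &
      (forall w, base w -> q (word_val a w) = endpoint 0 w)].
Proof.
have [aT fr] := fa.
have word_of x : exists w, base w /\ word_val a w = x.
  have : [set: F]%classic x by [].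
  by rewrite aT => -[w]; exists w.
have [wd wdP] := choice word_of.
have ends u w : base u -> base w -> word_val a u = word_val a w -> endpoint 0 u = endpoint 0 w.
  move=> bu bw e; have [_ <-] := trace_red k_gt0 bu; have [_ <-] := trace_red k_gt0 bw.
  by rewrite (fgen_inj fa bu bw e).
exists (fun x => endpoint 0 (wd x)); split.
- by move=> x; apply: endpoint_lt => //; case: (wdP x).
- move=> x y; have [bx vx] := wdP x; have [b_y vy] := wdP y.
  have [_ ey] := trace_winv k_gt0 b_y; split=> [e|].
    exists (wd x ++ winv (wd y)); split; first by rewrite over_cat bx over_winv.
      by rewrite endpoint_cat e.
    by rewrite word_val_cat word_val_winv vx vy.
  move=> [w [bw ew vw]].
  have <- : endpoint 0 (w ++ wd y) = endpoint 0 (wd x).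
    by apply: ends => //; rewrite ?over_cat ?bw // word_val_cat vw vx vy mulgVK.
  by rewrite endpoint_cat ew.
- move=> i hi; have [bi ei _] := branchP hi; exists (word_val a (branch i)).
  by rewrite -[RHS]ei; have [b v] := wdP (word_val a (branch i)); apply: ends.
- by move=> w bw; have [b v] := wdP (word_val a w); apply: ends.
Qed.

End Covers.
(** ** Every subgroup of finite index comes from a cover *)

Section Index.
Variables (F : groupType).
Local Open Scope group_scope.
Implicit Types (H : set F) (q : F -> nat).

Definition coset_code H k q :=
  [/\ (forall x, q x < k), (forall x y, q x = q y <-> H (x * y^-1)) &
      (forall i, i < k -> exists x, q x = i)].

Lemma coset_eq H x y : subgroup H -> H (x * y^-1) ->
  ([set h * x | h in H] = [set h * y | h in H])%classic.
Proof.
move=> sH Hxy; have [H1 HV HM] := subgroup_closed sH.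
apply/seteqP; split=> _ [h hh <-].
  by exists (h * (x * y^-1)); [apply: HM | rewrite -!mulgA mulVg mulg1].
exists (h * (x * y^-1)^-1); first by apply: HM => //; apply: HV.
by rewrite invgM invgK -!mulgA mulVg mulg1.
Qed.

Lemma eq_coset H x y : subgroup H ->
  ([set h * x | h in H] = [set h * y | h in H])%classic -> H (x * y^-1).
Proof.
move=> sH e; have [H1 _ _] := subgroup_closed sH.
have : ([set h * x | h in H] x)%classic by exists 1; rewrite ?mul1g.
by rewrite e => -[h hh <-]; rewrite mulgK.
Qed.

Lemma has_indexP H k : subgroup H -> has_index H k <-> exists q, coset_code H k q.
Proof.
move=> sH; split.
  move=> /card_set_bijP[f [f1 f2 f3]].
  exists (fun x => f [set h * x | h in H]%classic); split.
  - by move=> x; apply: f1; exists x.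
  - move=> x y; split=> [e|hxy]; last by rewrite (coset_eq sH hxy).
    by apply: eq_coset => //; apply: f2 => //; apply/mem_set; [exists x | exists y].
  - by move=> i hi; have [_ [x _ <-] <-] := f3 i hi; exists x.
move=> [q [q1 q2 q3]]; apply/card_set_bijP.
have [rep repP] : exists rep : set F -> F, forall x,
    H (x * (rep [set h * x | h in H]%classic)^-1).
  have /choice[rep hrep] : forall C : set F, exists y,
      forall x, C = [set h * x | h in H]%classic -> H (x * y^-1).
    move=> C; have [[y ->]|no] := pselect (exists y, C = [set h * y | h in H]%classic).
      by exists y => x e; apply: eq_coset.
    by exists 1 => x e; case: no; exists x.
  by exists rep => x; apply: hrep.
have qrep x : q (rep [set h * x | h in H]%classic) = q x by apply/esym/q2/repP.
exists (fun C => q (rep C)); split.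
- by move=> C _; apply: q1.
- move=> C D /set_mem[x _ <-] /set_mem[y _ <-]; rewrite !qrep => /q2; exact: coset_eq.
- by move=> i /q3[x <-]; exists [set h * x | h in H]%classic; [exists x | rewrite qrep].
Qed.

Variables (N : nat) (a : nat -> F).
Hypothesis fa : fgen (iota 0 N) a setT.

Lemma word_over_base x : exists2 w, over (iota 0 N) w & word_val a w = x.
Proof.
have [aT _] := fa; have : [set: F]%classic x by [].
by rewrite aT.
Qed.

(** The cosets can be numbered in the order in which a connected search reaches them. *)
Lemma coset_code_search H k q : subgroup H -> coset_code H k q ->
  exists q', [/\ coset_code H k q', q' 1 = 0 &
    forall x, 0 < q' x -> exists2 l, l.1 < N & q' (x * word_val a [:: l]) < q' x].
Proof.
move=> sH [q1 q2 q3].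
have qM x y g : q x = q y -> q (x * g) = q (y * g).
  by move=> /q2 h; apply/q2; rewrite invgM mulgA mulgK.
have k0 : 0 < k by apply: leq_ltn_trans (q1 1).
have search j : 0 < j <= k -> exists s, [/\ uniq s, size s = j, all (fun i => i < k) s,
    nth 0 s 0 = q 1 & forall i, 0 < i < j -> exists x l,
      [/\ q x = nth 0 s i, l.1 < N & index (q (x * word_val a [:: l])) s < i]].
  elim: j => // -[_ _|j IH hj].
    exists [:: q 1]; rewrite /= q1; split=> // -[|i] //.
  have [|s [us ss as_ s0 par]] := IH; first by rewrite /= ltnW.
  have [x [l [lN xs xls]]] : exists x l, [/\ l.1 < N, q x \in s & q (x * word_val a [:: l]) \notin s].
    apply: contrapT => closed.
    have all_s w : over (iota 0 N) w -> q (word_val a w) \in s.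
      elim/last_ind: w => [_|w l IHw].
        by rewrite word_val_nil -s0 mem_nth // ss.
      rewrite -cats1 over_cat word_val_cat /= andbT mem_iota => /andP[/IHw hw hl].
      by apply: contrapT => /negP n; apply: closed; exists (word_val a w), l.
    have : k <= size s.
      rewrite -{1}(size_iota 0 k); apply: uniq_leq_size (iota_uniq _ _) _ => i.
      rewrite mem_iota => /q3[x <-]; have [w hw <-] := word_over_base x.
      exact: all_s.
    by rewrite ss leqNgt; case/andP: hj => _ ->.
  exists (rcons s (q (x * word_val a [:: l]))); split.
  - by rewrite rcons_uniq xls.
  - by rewrite size_rcons ss.
  - by rewrite all_rcons q1.
  - by rewrite nth_rcons ss.
  move=> i /andP[i0]; rewrite ltnS leq_eqVlt => /orP[/eqP->|hi].
    exists (x * word_val a [:: l]), (linv l); split=> //.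
      by rewrite nth_rcons ss ltnn eqxx.
    by rewrite word_val_linv mulgK -cats1 index_cat xs -ss index_mem.
  have [|y [m [e mN lt]]] := par i; first by rewrite i0.
  exists y, m; split=> //; first by rewrite nth_rcons ss hi.
  have hm : q (y * word_val a [:: m]) \in s by rewrite -index_mem ss (ltn_trans lt).
  by rewrite -cats1 index_cat hm.
have [|s [us ss as_ s0 par]] := search k; first by rewrite k0 leqnn.
have in_s x : q x \in s.
  have /uniq_min_size h : {subset s <= iota 0 k} by move=> i hi; rewrite mem_iota (allP as_).
  by have [|_ ->] := h us; rewrite ?size_iota ?ss // mem_iota q1.
exists (fun x => index (q x) s); split.
- split=> [x|x y|i hi]; first by rewrite -ss index_mem.
    split=> [/(congr1 (nth 0 s))|/q2->//].
    by rewrite !nth_index //; move/q2.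
  have [|x e] := q3 (nth 0 s i); first by apply: (allP as_); rewrite mem_nth ?ss.
  by exists x; rewrite e index_uniq ?ss.
- by rewrite -s0 index_uniq // ss.
move=> x x0; have [|y [l [e lN lt]]] := par (index (q x) s).
  by rewrite x0 -ss index_mem in_s.
exists l => //; rewrite (qM x y) //.
by rewrite e nth_index.
Qed.

Lemma subgroup_cover H k : subgroup H -> has_index H k ->
  exists act par, is_cover N k act par /\ cover_group N act a = H.
Proof.
move=> sH /(has_indexP _ sH)[q0 /(coset_code_search sH)[q [[q1 q2 q3] q_1 qpar]]].
have [rep repP] : exists rep, forall i, i < k -> q (rep i) = i.
  have /choice[rep h] : forall i, exists x, i < k -> q x = i.
    by move=> i; case: (ltnP i k) => [/q3[x e]|_]; [exists x | exists 1].
  by exists rep.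
have qM x y g : q x = q y -> q (x * g) = q (y * g).
  by move=> /q2 h; apply/q2; rewrite invgM mulgA mulgK.
have [par parP] : exists par : nat -> nat * bool, forall i, 0 < i < k ->
    (par i).1 < N /\ q (rep i * word_val a [:: par i]) < i.
  have /choice[par h] : forall i, exists l : nat * bool, 0 < i < k ->
      l.1 < N /\ q (rep i * word_val a [:: l]) < i.
    move=> i; have [/andP[i0 ik]|] := boolP (0 < i < k); last by exists (0, false).
    by have [|l lN] := qpar (rep i); rewrite repP //; exists l.
  by exists par.
pose act i l := q (rep i * word_val a [:: l]).
have act_q x l : act (q x) l = q (x * word_val a [:: l]) by apply: qM; rewrite repP.
have ends w x : endpoint act (q x) w = q (x * word_val a w).
  elim: w x => [|l w IH] x; first by rewrite word_val_nil mulg1.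
  by rewrite -cat1s word_val_cat mulgA -IH /= act_q.
exists act, par; split.
  split=> //; first by apply: leq_ltn_trans (q1 1).
  move=> i l hi lN; split; first exact: q1.
  by rewrite {2}/act act_q word_val_linv mulgK repP.
apply/seteqP; split=> h.
  move=> [w [bw]]; rewrite -q_1 ends mul1g => /q2 + <-.
  by rewrite invg1 mulg1.
move=> Hh; have [w hw e] := word_over_base h; exists w; split=> //.
by rewrite -q_1 ends mul1g e; apply/q2; rewrite invg1 mulg1.
Qed.

End Index.

(** * Marshall Hall's theorem for one element *)

Lemma conj_cyclically_reduced (X : eqType) (w : word X) : reduced w -> exists u c,
  w = u ++ c ++ winv u /\ cyclically_reduced c.
Proof.
have [n] := ubnP (size w); elim: n w => // n IH [|l w] hn rw.
  by exists [::], [::].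
have [cr|] := boolP (cyclically_reduced (l :: w)).
  by exists [::], (l :: w); rewrite cats0.
rewrite cyclically_reducedE rw /= negbK => /eqP el.
case/lastP: w el hn rw => [|w k] /=; first by move=> /eqP; rewrite eq_sym linv_neq.
rewrite last_rcons => -> hn; rewrite -cats1 -cat_cons => /reduced_cat[].
rewrite -cat1s => /reduced_cat[_ rw] _.
have [||u [c [-> cr]]] := IH w => //; first by move: hn; rewrite size_rcons; lia.
exists (linv k :: u), c; split=> //.
by rewrite winv_cons linvK -cats1 /= !catA.
Qed.

Lemma fgen_conj (F : groupType) (X : eqType) (G : seq X) (v : X -> F) (h : F) :
  fgen G v setT -> fgen G (fun x => h * v x * h^-1)%g setT.
Proof.
move=> [vT fr]; split.
  apply/seteqP; split=> // g _; have : [set: F]%classic (h^-1 * g * h)%g by [].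
  rewrite vT => -[w hw e]; exists w => //.
  by rewrite word_val_conj e !mulgA mulgV mul1g mulgK.
move=> w hw; rewrite word_val_conj => e; apply: fr => //.
by apply: (mulgI h); apply: (mulIg (h^-1)%g); rewrite e mulg1 mulgV.
Qed.

Section Hall.
Variables (N : nat) (c : word nat).
Hypotheses (oc : over (iota 0 N) c) (cr : cyclically_reduced c) (c0 : 0 < size c).
Local Notation n := (size c).
Local Notation letter := (nth (0, false) c).

Let next i := if i.+1 == n then 0 else i.+1.

(** The letters of [c], written around a circle of [n] vertices, are partial
    injections of the vertices because [c] is cyclically reduced. The [i]-th letter
    moves [source i] to [target i], if it is read in the positive direction. *)
Let source i := if (letter i).2 then next i else i.
Let target i := if (letter i).2 then i else next i.

Let next_inj i j : i < n -> j < n -> next i = next j -> i = j.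
Proof. by rewrite /next; case: eqP; case: eqP; lia. Qed.

Let next_lt i : i < n -> next i < n.
Proof. by rewrite /next; case: eqP; lia. Qed.

Let letter_next i : i < n -> letter (next i) <> linv (letter i).
Proof.
move: cr; rewrite /next; case: c c0 => // l w _ /allP h hi.
have := h (nth ((0, false), (0, false)) (zip (l :: w) (rcons w l)) i).
rewrite mem_nth ?size_zip ?size_rcons ?minnn // => /(_ isT).
rewrite nth_zip ?size_rcons //= nth_rcons eqSS => /eqP.
by case: (ltngtP i (size w)) hi => //=; lia.
Qed.

Let opposite i j : (letter i).1 = (letter j).1 -> (letter i).2 <> (letter j).2 ->
  letter i = linv (letter j).
Proof.
by case: (letter i) => x b; case: (letter j) => y b' /= -> ne; congr pair; case: b b' ne => [] [].
Qed.

Let source_inj i j : i < n -> j < n -> (letter i).1 = (letter j).1 ->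
  source i = source j -> i = j.
Proof.
move=> hi hj el; rewrite /source; case Ei: (letter i).2; case Ej: (letter j).2 => // e.
- exact: next_inj.
- case: (letter_next hi); rewrite e; apply: opposite; by rewrite ?el // Ei Ej.
- case: (letter_next hj); rewrite -e; apply: opposite; by rewrite ?el // Ei Ej.
Qed.

Let target_inj i j : i < n -> j < n -> (letter i).1 = (letter j).1 ->
  target i = target j -> i = j.
Proof.
move=> hi hj el; rewrite /target; case Ei: (letter i).2; case Ej: (letter j).2 => // e.
- case: (letter_next hj); rewrite -e; apply: opposite; by rewrite ?el // Ei Ej.
- case: (letter_next hi); rewrite e; apply: opposite; by rewrite ?el // Ei Ej.
- exact: next_inj.
Qed.

(** A partial injection, given by the lists of its arguments and of its values,
    becomes a permutation when both lists are completed by the missing vertices. *)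
Let extend s := s ++ [seq i <- iota 0 n | i \notin s].
Let occurrences a := [seq i <- iota 0 n | (letter i).1 == a].
Let sources a := extend (map source (occurrences a)).
Let targets a := extend (map target (occurrences a)).
Let act i (l : nat * bool) :=
  if l.2 then nth 0 (sources l.1) (index i (targets l.1))
  else nth 0 (targets l.1) (index i (sources l.1)).
Let par i := linv (letter i.-1).

Let extend_perm f a : (forall i, i < n -> f i < n) ->
  (forall i j, i < n -> j < n -> (letter i).1 = (letter j).1 -> f i = f j -> i = j) ->
  perm_eq (extend (map f (occurrences a))) (iota 0 n).
Proof.
move=> f_lt f_inj; apply: uniq_perm; last 1 first.
- move=> i; rewrite mem_cat mem_filter; case: (boolP (i \in map f _)) => //= /mapP[j].
  by rewrite mem_filter mem_iota => /and3P[_ _ hj] ->; rewrite mem_iota f_lt.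
- rewrite cat_uniq filter_uniq ?iota_uniq // andbT; apply/andP; split.
    rewrite map_inj_in_uniq ?filter_uniq ?iota_uniq // => i j.
    rewrite !mem_filter !mem_iota => /and3P[/eqP ei _ hi] /and3P[/eqP ej _ hj].
    by apply: f_inj; rewrite // ei ej.
  by apply/hasPn => i; rewrite mem_filter => /andP[].
- exact: iota_uniq.
Qed.

Let source_lt i : i < n -> source i < n.
Proof. by rewrite /source; case: ifP => // _; apply: next_lt. Qed.

Let target_lt i : i < n -> target i < n.
Proof. by rewrite /target; case: ifP => // _; apply: next_lt. Qed.

Let sources_perm a : perm_eq (sources a) (iota 0 n).
Proof. exact: extend_perm source_lt source_inj. Qed.

Let targets_perm a : perm_eq (targets a) (iota 0 n).
Proof. exact: extend_perm target_lt target_inj. Qed.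

Let act_letter i : i < n -> act i (letter i) = next i.
Proof.
move=> hi; set a := (letter i).1.
have hocc : i \in occurrences a by rewrite mem_filter eqxx mem_iota hi.
have idx f : (forall i j, i < n -> j < n -> (letter i).1 = (letter j).1 -> f i = f j -> i = j) ->
    index (f i) (extend (map f (occurrences a))) = index i (occurrences a).
  move=> f_inj; rewrite index_cat map_f //.
  rewrite -{1}(nth_index 0 hocc) -(nth_map 0 (f 0)) ?index_mem // index_uniq ?size_map ?index_mem //.
  rewrite map_inj_in_uniq ?filter_uniq ?iota_uniq // => j j'.
  rewrite !mem_filter !mem_iota => /and3P[/eqP ei _ hj] /and3P[/eqP ej _ hj'].
  by apply: f_inj; rewrite // ei ej.
have val f : nth 0 (extend (map f (occurrences a))) (index i (occurrences a)) = f i.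
  by rewrite nth_cat size_map index_mem hocc (nth_map 0) ?index_mem // nth_index.
rewrite /act -/a; case: ifP => hb.
  have -> : next i = source i by rewrite /source hb.
  have ei : target i = i by rewrite /target hb.
  by have := idx target target_inj; rewrite ei /targets => ->; apply: val.
have -> : next i = target i by rewrite /target hb.
have ei : source i = i by rewrite /source hb.
by have := idx source source_inj; rewrite ei /sources => ->; apply: val.
Qed.

Lemma circle_cover : is_cover N n act par.
Proof.
have act_inv i a b : i < n -> act i (a, b) < n /\ act (act i (a, b)) (a, ~~ b) = i.
  move=> hi; have in_s s : perm_eq s (iota 0 n) -> i \in s.
    by move=> /perm_mem ->; rewrite mem_iota.
  have size_s s : perm_eq s (iota 0 n) -> size s = n.
    by move=> /perm_size ->; rewrite size_iota.
  have lt s x : perm_eq s (iota 0 n) -> x < n -> nth 0 s x < n.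
    move=> ps hx; have : nth 0 s x \in s by rewrite mem_nth // size_s.
    by rewrite (perm_mem ps) mem_iota.
  have uq s : perm_eq s (iota 0 n) -> uniq s by move=> /perm_uniq ->; apply: iota_uniq.
  have ix s : perm_eq s (iota 0 n) -> index i s < n.
    by move=> ps; have := in_s s ps; rewrite -index_mem size_s.
  have sp := sources_perm a; have tp := targets_perm a.
  rewrite /act /=; case: b => /=; split.
  - by apply: lt => //; apply: ix.
  - by rewrite index_uniq ?size_s ?uq ?ix // nth_index ?in_s.
  - by apply: lt => //; apply: ix.
  - by rewrite index_uniq ?size_s ?uq ?ix // nth_index ?in_s.
split=> // [i [a b] hi _|i /andP[i0 hi]]; first exact: act_inv.
have hi' : i.-1 < n by lia.
have ni : next i.-1 = i by rewrite /next prednK // ltn_eqF.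
split.
  have := mem_nth (0, false) hi'; move: oc; rewrite over_iota => /allP h /h.
  by [].
have [_] := act_inv i.-1 (letter i.-1).1 (letter i.-1).2 hi'.
rewrite -surjective_pairing act_letter // ni /par => ->.
by rewrite prednK.
Qed.

(** The parents follow the circle backwards, so the tree misses only its last edge. *)
Lemma circle_trace : endpoint act 0 c = 0 /\
  off_tree n act par (trace act 0 c) = [:: edge act n.-1 (letter n.-1)].
Proof.
have iotaSr j : iota 0 j.+1 = iota 0 j ++ [:: j] by rewrite -addn1 iotaD.
have run j : j <= n -> trace act 0 (take j c) = [seq edge act i (letter i) | i <- iota 0 j] /\
    endpoint act 0 (take j c) = if j == n then 0 else j.
  elim: j => [|j IH] hj; first by rewrite take0 /=; case: eqP c0 => // <-.
  have [e1 e2] := IH (ltnW hj).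
  rewrite iotaSr (take_nth (0, false)) // -cats1 trace_cat endpoint_cat e1 e2 (ltn_eqF hj) /=.
  by rewrite act_letter // map_cat.
have [t e] := run n (leqnn _); rewrite take_size eqxx in t e; split=> //.
have name i : (edge act i (letter i)).1 = (source i, (letter i).1) \/ n <= i.
  have [|hi] := leqP n i; [by right | left].
  by rewrite /edge /source act_letter //; case: ifP.
have treeE : tree n act par = [seq (edge act i (letter i)).1 | i <- iota 0 n.-1].
  rewrite /tree -[1]add1n iotaDl -map_comp; apply/eq_in_map => i.
  rewrite mem_iota add0n /= => hi.
  have hi' : i < n by lia.
  have ni : next i = i.+1 by rewrite /next; case: eqP => //; lia.
  have li : (letter i).1 < N by move: oc; rewrite over_iota => /allP; apply; apply: mem_nth.
  rewrite add1n /par /= -{1}ni -act_letter //.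
  by rewrite (edge_linv circle_cover).
rewrite t; have -> : iota 0 n = iota 0 n.-1 ++ [:: n.-1] by rewrite -iotaSr prednK.
rewrite map_cat /off_tree filter_cat /=.
rewrite (@eq_in_filter _ _ pred0) ?filter_pred0 => [|_ /mapP[i hi ->]]; last first.
  by apply/negbTE; rewrite negbK treeE; apply/mapP; exists i.
rewrite ifT // treeE; apply/mapP => -[i]; rewrite mem_iota add0n => /andP[_ hi].
have [ei|] := name i; last by lia.
have [en|] := name n.-1; last by lia.
rewrite ei en => -[es el].
have : n.-1 = i by apply: source_inj es => //; lia.
by lia.
Qed.

End Hall.

Lemma cover_group_index (F : groupType) (a : nat -> F) N k act par :
  fgen (iota 0 N) a setT -> is_cover N k act par ->
  subgroup (cover_group N act a) /\ has_index (cover_group N act a) k.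
Proof.
move=> fa cov; have sH := fgen_subgroup (schreier_fgen cov fa).
split=> //; have [q [q1 q2 q3 _]] := cover_coset_code cov fa.
by apply/(has_indexP _ sH); exists q.
Qed.

Lemma size_cotree N k act par : N * k < size (cotree N k act par) + k \/ k = 0.
Proof.
case: k => [|k]; [by right | left].
set s := [seq (i, a) | i <- iota 0 k.+1, a <- iota 0 N].
have us : uniq s by apply: allpairs_uniq; rewrite ?iota_uniq // => -[? ?] [? ?].
have : count (mem (tree k.+1 act par)) s <= k.
  have st : size (tree k.+1 act par) = k by rewrite size_map size_iota.
  rewrite -size_filter -[X in _ <= X]st; apply: uniq_leq_size => [|e]; first exact: filter_uniq.
  by rewrite mem_filter => /andP[].
have := count_predC (mem (tree k.+1 act par)) s.
rewrite /cotree size_filter -/s size_allpairs !size_iota.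
have -> : count (predC (mem (tree k.+1 act par))) s = count (fun e => e \notin tree k.+1 act par) s.
  by apply: eq_count.
lia.
Qed.

(** Write the element as [u c u^-1] with [c] cyclically reduced, and let [c] run
    once around a circle of [size c] vertices. The circle can be completed to a
    cover without new vertices; there [c] crosses a single edge off the tree. For the
    free basis conjugated by [u], the group of the cover contains the element as a
    basis letter. *)
Theorem hall_primitive (F : groupType) (a : nat -> F) N w :
  1 < N -> fgen (iota 0 N) a setT -> over (iota 0 N) w -> word_val a w <> 1%g ->
  exists k H, [/\ k <= size w, subgroup H /\ has_index H k, H (word_val a w),
    primitive_in H (word_val a w) & simple_in H (word_val a w)].
Proof.
move=> N1 fa ow ne; have [u [c [ew cr]]] := conj_cyclically_reduced (red_reduced w).
have oc : over (iota 0 N) c by move: (over_red ow); rewrite ew !over_cat => /and3P[].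
have c0 : 0 < size c.
  rewrite lt0n; apply/eqP => /size0nil ec; apply: ne.
  by rewrite -word_val_red ew ec /= -word_val_red red_catV word_val_nil.
have sc : size c <= size w.
  by apply: leq_trans (size_red w); rewrite ew !size_cat; lia.
have [act [par [cov [e t]]]] : exists act par, is_cover N (size c) act par /\
    exists l, endpoint act 0 c = 0 /\ off_tree (size c) act par (trace act 0 c) = [:: l].
  eexists; eexists; split; first exact: circle_cover oc cr c0.
  by have [e t] := circle_trace oc cr c0; eexists; split; [exact: e | exact: t].
have fa' := fgen_conj (word_val a u) fa; set a' := fun x => _ in fa'.
have va' : word_val a' c = word_val a w.
  by rewrite word_val_conj -[in RHS]word_val_red ew !word_val_cat word_val_winv mulgA.
have fs := schreier_fgen cov fa'.
have [sH iH] := cover_group_index fa' cov.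
have vl : word_val (schreier act par a') [:: e] = word_val a w.
  case: t => et <-; rewrite (schreier_trace cov a' c0 oc) et.
  by rewrite word_val_nil mul1g invg1 mulg1.
have ol : over (cotree N (size c) act par) [:: e].
  by case: t => _ <-; apply: over_cotree; apply: (trace_bounds cov).
have le : e.1 \in cotree N (size c) act par by case/andP: ol.
exists (size c), (cover_group N act a'); split=> //.
- by exists c; split=> //; case: t.
- by rewrite -vl; apply: fgen_letter_primitive fs le.
have [x hx nx] : exists2 x, x \in cotree N (size c) act par & e.1 != x.
  have us : uniq (cotree N (size c) act par).
    by apply: filter_uniq; apply: allpairs_uniq; rewrite ?iota_uniq // => -[? ?] [? ?].
  have : 0 < size (rem e.1 (cotree N (size c) act par)).
    rewrite size_rem //; have [h|h] := size_cotree N (size c) act par; last by rewrite h in c0.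
    rewrite -subn1 subn_gt0 -(ltn_add2r (size c)); apply: leq_ltn_trans h.
    apply: (@leq_trans (2 * size c)); last by rewrite leq_mul2r N1 orbT.
    by rewrite mul2n -addnn leq_add2r.
  case er: (rem _ _) => [|x s] // _.
  have : x \in rem e.1 (cotree N (size c) act par) by rewrite er mem_head.
  by rewrite mem_rem_uniq // inE eq_sym => /andP[]; exists x.
rewrite -vl; apply: (fgen_omit_simple fs hx ol); first by rewrite /= nx.
by rewrite vl.
Qed.

(** * The algorithm *)

Fixpoint lists (T : Type) (n : nat) (s : seq T) : seq (seq T) :=
  if n is n'.+1 then [seq x :: t | x <- s, t <- lists n' s] else [:: [::]].

Lemma mem_lists (T : eqType) n (s t : seq T) :
  (t \in lists n s) = (size t == n) && all (fun x => x \in s) t.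
Proof.
elim: n t => [|n IH] [|x t] //=.
  by apply/allpairsP => -[[y u] [_ _]].
rewrite eqSS andbCA -IH; apply/allpairsP/andP => [[[y u] [/= hy hu [-> ->]]]|[hx ht]] //.
by exists (x, t).
Qed.

Section Tables.

(** A table [tb] lists the images of the vertices under each generator; inverse
    letters act by searching the table. *)
Definition table_act (tb : seq (seq nat)) (i : nat) (l : nat * bool) : nat :=
  if l.2 then index i (nth [::] tb l.1) else nth 0 (nth [::] tb l.1) i.
Definition table_par (ps : seq (nat * bool)) (i : nat) : nat * bool := nth (0, false) ps i.-1.

(** A row of a table, a list of length [k], is a permutation if it contains all vertices. *)
Definition table_ok N k (tb : seq (seq nat)) (ps : seq (nat * bool)) : bool :=
  [&& 0 < k,
      all (fun b => all (fun j => j \in nth [::] tb b) (iota 0 k)) (iota 0 N) &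
      all (fun i => table_act tb i (table_par ps i) < i) (iota 1 k.-1)].

Definition tables N k := lists N (lists k (iota 0 k)).
Definition parents N k := lists k.-1 (letters (iota 0 N)).

Definition accepts (crit : seq (nat * nat) -> word (nat * nat)%type -> bool)
    N k (w : word nat) : bool :=
  has (fun tb => has (fun ps =>
    [&& table_ok N k tb ps, endpoint (table_act tb) 0 w == 0 &
        crit (cotree N k (table_act tb) (table_par ps))
             (off_tree k (table_act tb) (table_par ps) (trace (table_act tb) 0 w))])
    (parents N k)) (tables N k).

Lemma table_cover N k tb ps : tb \in tables N k -> ps \in parents N k ->
  table_ok N k tb ps -> is_cover N k (table_act tb) (table_par ps).
Proof.
rewrite mem_lists => /andP[/eqP stb htb]; rewrite mem_lists => /andP[/eqP sps hps].
case/and3P => k0 perm par.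
have tbP b : b < N -> [/\ size (nth [::] tb b) = k, uniq (nth [::] tb b) &
    nth [::] tb b =i iota 0 k].
  move=> hb; have sub_b : {subset iota 0 k <= nth [::] tb b}.
    by apply/allP; apply: (allP perm); rewrite mem_iota.
  have : nth [::] tb b \in lists k (iota 0 k) by apply: (allP htb); rewrite mem_nth ?stb.
  rewrite mem_lists => /andP[/eqP sb _]; split=> //.
    by apply: leq_size_uniq (iota_uniq 0 k) sub_b _; rewrite size_iota sb.
  have [|_ e] := uniq_min_size (iota_uniq 0 k) sub_b; first by rewrite size_iota sb.
  by move=> i; rewrite e.
split=> // [i [b s] hi /= hb|i hi].
  have [sb ub mb] := tbP b hb; case: s; rewrite /table_act /=.
    by rewrite -sb index_mem nth_index // mb mem_iota.
  rewrite index_uniq ?sb //; split=> //.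
  by have : nth 0 (nth [::] tb b) i \in nth [::] tb b by [rewrite mem_nth ?sb]; rewrite mb mem_iota.
split; last by apply: (allP par); rewrite mem_iota; lia.
have : table_par ps i \in letters (iota 0 N).
  by apply: (allP hps); rewrite mem_nth // sps; lia.
by rewrite mem_letters mem_iota.
Qed.

Lemma cover_table N k act par : is_cover N k act par -> exists tb ps,
  [/\ tb \in tables N k, ps \in parents N k, table_ok N k tb ps &
      forall i l, i < k -> l.1 < N -> table_act tb i l = act i l].
Proof.
move=> cov; have [k0 _ hpar] := cov.
pose tb := [seq [seq act i (b, false) | i <- iota 0 k] | b <- iota 0 N].
have tbE b : b < N -> nth [::] tb b = [seq act i (b, false) | i <- iota 0 k].
  by move=> hb; rewrite (nth_map 0) ?size_iota // nth_iota.
have actE i l : i < k -> l.1 < N -> table_act tb i l = act i l.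
  case: l => b [] hi /= hb; rewrite /table_act /= tbE //; last first.
    by rewrite (nth_map 0) ?size_iota // nth_iota.
  have hj : act i (b, true) < k by apply: (act_lt cov).
  have -> : i = nth 0 [seq act i (b, false) | i <- iota 0 k] (act i (b, true)).
    rewrite (nth_map 0) ?size_iota // nth_iota // add0n.
    by rewrite (actK cov (l := (b, true))).
  rewrite index_uniq ?size_map ?size_iota //.
    by rewrite (nth_map 0) ?size_iota // nth_iota // add0n (actK cov (l := (b, true))).
  rewrite map_inj_in_uniq ?iota_uniq // => x y; rewrite !mem_iota => hx hy e.
  by rewrite -(actK cov (l := (b, false)) hx) // e (actK cov (l := (b, false)) hy).
exists tb, [seq par i | i <- iota 1 k.-1]; split=> //.
- rewrite mem_lists size_map size_iota eqxx; apply/allP => _ /mapP[b hb ->].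
  rewrite mem_lists size_map size_iota eqxx; apply/allP => _ /mapP[i hi ->].
  by move: hb hi; rewrite !mem_iota => hb hi; apply: (act_lt cov).
- rewrite mem_lists size_map size_iota eqxx; apply/allP => _ /mapP[i hi ->].
  rewrite mem_letters mem_iota; have [] := hpar i; last by [].
  by move: hi; rewrite mem_iota; lia.
rewrite /table_ok k0 /=; apply/andP; split; apply/allP => i; rewrite mem_iota => hi.
  apply/allP => j; rewrite mem_iota tbE // => hj; apply/mapP.
  exists (act j (i, true)); first by rewrite mem_iota; apply: (act_lt cov).
  by rewrite (actK cov (l := (i, true))).
have hik : 0 < i < k by lia.
have [pN lt] := hpar i hik.
have -> : table_par [seq par i | i <- iota 1 k.-1] i = par i.
  rewrite /table_par (nth_map 0) ?size_iota ?nth_iota; try lia.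
  by congr par; lia.
by rewrite actE //; case/andP: hik.
Qed.

Variables (N : nat) (F : groupType) (a : nat -> F).
Hypothesis fa : fgen (iota 0 N) a setT.

(** The criterion must only depend on the subgroup and the element, so that it
    does not matter which cover and tree of the subgroup are met first. *)
Lemma acceptsP (crit : seq (nat * nat) -> word (nat * nat)%type -> bool) (P : set F -> F -> Prop) k w : over (iota 0 N) w ->
  (forall G v H u, fgen G v H -> over G u -> word_val v u = word_val a w ->
     crit G u <-> P H (word_val v u)) ->
  accepts crit N k w <->
  exists H, [/\ subgroup H, has_index H k, H (word_val a w) & P H (word_val a w)].
Proof.
move=> ow critP.
have lifted act par : is_cover N k act par -> endpoint act 0 w = 0 ->
    crit (cotree N k act par) (off_tree k act par (trace act 0 w)) <->
    P (cover_group N act a) (word_val a w).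
  move=> cov e; have k0 : 0 < k by case: cov.
  have vE := schreier_trace cov a k0 ow; rewrite e word_val_nil mul1g invg1 mulg1 in vE.
  rewrite -vE; apply: critP => //; first exact: schreier_fgen.
  by apply: over_cotree; apply: (trace_bounds cov).
split.
  move=> /hasP[tb htb /hasP[ps hps /and3P[ok /eqP e]]].
  have cov := table_cover htb hps ok; move/(lifted _ _ cov e) => Pw.
  exists (cover_group N (table_act tb) a); have [sH iH] := cover_group_index fa cov.
  by split=> //; exists w.
move=> [H [sH iH Hw Pw]].
have [act [par [cov eH]]] := subgroup_cover fa sH iH.
have [tb [ps [htb hps ok actE]]] := cover_table cov.
have endE u : over (iota 0 N) u -> forall i, i < k ->
    endpoint (table_act tb) i u = endpoint act i u.
  rewrite over_iota; elim: u => //= l u IH /andP[hl hu] i hi.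
  by rewrite actE // IH //; apply: (act_lt cov).
have k0 : 0 < k by case: cov.
have eH' : cover_group N (table_act tb) a = H.
  rewrite -eH; apply/seteqP; split=> h [u [ou e v]]; exists u; split=> //.
    by rewrite -endE.
  by rewrite endE.
have e0 : endpoint act 0 w = 0.
  move: Hw; rewrite -eH => -[u [ou eu vu]].
  have [_ <-] := trace_red cov k0 ow; rewrite (fgen_inj fa ow ou) //.
  by have [_ ->] := trace_red cov k0 ou.
apply/hasP; exists tb => //; apply/hasP; exists ps => //.
have e1 : endpoint (table_act tb) 0 w = 0 by rewrite endE.
rewrite ok e1 eqxx /=; apply/lifted => //; first exact: table_cover.
by rewrite eH'.
Qed.

(** By [hall_primitive] the search succeeds at an index that is at most the length. *)
Definition distance crit (w : word nat) : nat :=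
  find (fun k => accepts crit N k w) (iota 0 (size w).+1).

Lemma distanceP (crit : seq (nat * nat) -> word (nat * nat)%type -> bool) (P : set F -> F -> Prop) w : over (iota 0 N) w ->
  (forall G v H u, fgen G v H -> over G u -> word_val v u = word_val a w ->
     crit G u <-> P H (word_val v u)) ->
  (exists k H, [/\ k <= size w, subgroup H /\ has_index H k, H (word_val a w) &
     P H (word_val a w)]) ->
  least (fun k => exists H, [/\ subgroup H, has_index H k, H (word_val a w) &
    P H (word_val a w)]) (distance crit w).
Proof.
move=> ow critP [k0 [H0 [hk0 [sH0 iH0] Hw0 Pw0]]].
have accP k := acceptsP k ow critP.
set p := fun k => accepts crit N k w.
have hp : has p (iota 0 (size w).+1).
  by apply/hasP; exists k0; [rewrite mem_iota | apply/accP; exists H0].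
have lt := hp; rewrite has_find size_iota in lt.
split; first by apply/accP; have := nth_find 0 hp; rewrite nth_iota.
move=> m /accP pm; rewrite leqNgt; apply/negP => ltm.
have := before_find 0 ltm; rewrite nth_iota; last exact: ltn_trans ltm lt.
by rewrite add0n /p pm.
Qed.

End Tables.

Theorem distance_primP (F : groupType) (a : nat -> F) N w :
  1 < N -> fgen (iota 0 N) a setT -> over (iota 0 N) w -> word_val a w <> 1%g ->
  d_prim (word_val a w) (distance N (@primitive_word _) w) /\
  d_simp (word_val a w) (distance N (@simple_word _) w).
Proof.
move=> N1 fa ow ne; have [k [H [hk sH Hw pH siH]]] := hall_primitive N1 fa ow ne.
split; apply: (distanceP fa) => //.
- by move=> G v K u fg ou _; apply: primitive_wordP.
- by exists k, H.
- by move=> G v K u fg ou e; apply: simple_wordP; rewrite ?e.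
- by exists k, H.
Qed.

(** ** Proper powers *)

Definition words N n : seq (word nat) :=
  flatten [seq lists j (letters (iota 0 N)) | j <- iota 0 n.+1].

Lemma mem_words N n w : (w \in words N n) = (size w <= n) && over (iota 0 N) w.
Proof.
apply/flatten_mapP/andP => [[j]|[hw ow]].
  rewrite mem_iota => hj; rewrite mem_lists => /andP[/eqP -> /allP h]; split=> //.
  by apply/allP => l /h; rewrite mem_letters.
exists (size w); rewrite ?mem_iota // mem_lists eqxx.
by apply/allP => l /(allP ow); rewrite mem_letters.
Qed.

Definition is_power N w : bool :=
  has (fun h => has (fun j => red (wpow h j) == red w) (iota 2 (size w))) (words N (size w)).

Section Powers.
Variables (N : nat) (F : groupType) (a : nat -> F).
Hypothesis fa : fgen (iota 0 N) a setT.
Local Open Scope group_scope.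

(** If [u c u^-1] is reduced with [c] cyclically reduced, then so is [u c^k u^-1].
    Hence a [k]-th power is at least as long as its root, and has length at least [k]. *)
Lemma power_root_size w g k : over (iota 0 N) w -> word_val a w <> 1 -> 0 < k ->
  word_val a w = g ^+ k -> exists h,
  [/\ over (iota 0 N) h, word_val a h = g, red (wpow h k) = red w &
      size h <= size (red w) /\ k <= size (red w)].
Proof.
move=> ow ne k0 e; have [h1 oh1 vh1] := word_over_base fa g.
pose h := red h1; have oh : over (iota 0 N) h by apply: over_red.
have vh : word_val a h = g by rewrite word_val_red.
have ehw : red (wpow h k) = red w.
  by apply: (fgen_inj fa); rewrite ?over_wpow // wpow_val vh.
exists h; split=> //; rewrite -ehw.
have [u [c [eh cr]]] := conj_cyclically_reduced (red_reduced h1).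
have c0 : 0 < size c.
  rewrite lt0n; apply/eqP => /size0nil ec; apply: ne.
  by rewrite e -vh /h eh ec /= -word_val_red red_catV word_val_nil expg1n.
have pw : red (wpow h k) = u ++ wpow c k ++ winv u.
  transitivity (red (u ++ wpow c k ++ winv u)).
    elim: (k) => [|j IH]; first by rewrite /= red_catV.
    rewrite !wpowS -red_cat_red IH red_cat_red /h eh -!catA.
    apply: red_congr => //; apply: red_congr => //.
    by rewrite catA -red_red_cat red_Vcat.
  apply: red_id; have : reduced (u ++ c ++ winv u) by rewrite -eh red_reduced.
  case: k k0 {e ehw} => // k _; have := wpow_reduced k.+1 cr.
  rewrite wpowS; case: c c0 {eh} cr => // l t _ cr rp.
  have el : last l (t ++ wpow (l :: t) k) = last l t.
    elim: (k) => [|j IH]; first by rewrite cats0.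
    by rewrite wpowSr catA last_cat.
  rewrite !reducedE /= !sorted_cat_cons => /andP[-> /=].
  rewrite cat_path => /andP[_ hu]; rewrite cat_path el hu andbT.
  by move: rp; rewrite reducedE.
have sh : size h = size u + (size c + size u) by rewrite /h eh !size_cat size_winv.
rewrite pw sh !size_cat size_winv size_wpow; split.
  by rewrite leq_add2l leq_add2r leq_pmull.
by apply: leq_trans (leq_addl _ _); apply: leq_trans (leq_addr _ _); rewrite leq_pmulr.
Qed.

Lemma is_powerP w : over (iota 0 N) w -> word_val a w <> 1 ->
  is_power N w <-> proper_power (word_val a w).
Proof.
move=> ow ne; split.
  move=> /hasP[h _ /hasP[j]]; rewrite mem_iota => /andP[j2 _] /eqP e.
  by exists (word_val a h), j; split=> //; rewrite -wpow_val; apply: word_val_eq.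
move=> [g [k [k1 e]]].
have [h [oh _ eh [sh sk]]] := power_root_size ow ne (ltnW k1) e.
have sw := size_red w.
apply/hasP; exists h; first by rewrite mem_words oh (leq_trans sh).
apply/hasP; exists k; last by rewrite eh.
by rewrite mem_iota k1 /= addSn ltnS leqW // (leq_trans sk).
Qed.

End Powers.

(** ** Free bases indexed by ordinals *)

Section Ordinals.
Variables (N : nat) (F : groupType) (a : 'I_N -> F).
Local Open Scope group_scope.

Definition nat_basis (i : nat) : F := if insub i is Some j then a j else 1.
Definition nat_word (w : word 'I_N) : word nat := [seq (val l.1, l.2) | l <- w].

Lemma nat_basis_ord i : nat_basis (val i) = a i.
Proof. by rewrite /nat_basis valK. Qed.

Lemma word_val_nat w : word_val nat_basis (nat_word w) = word_val a w.
Proof. by rewrite word_val_map; apply: eq_word_val => i; apply: nat_basis_ord. Qed.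

Lemma over_nat w : over (iota 0 N) (nat_word w).
Proof. by rewrite over_iota all_map; apply/allP => l _ /=; apply: ltn_ord. Qed.

Lemma over_nat_word w : over (iota 0 N) w -> exists w', nat_word w' = w.
Proof.
rewrite over_iota; elim: w => [|[i b] w IH] /=; first by exists [::].
by move=> /andP[hi /IH[w' <-]]; exists ((Ordinal hi, b) :: w').
Qed.

Lemma reduced_nat w : reduced (nat_word w) = reduced w.
Proof.
rewrite !reducedE sorted_map; by case: w => //= l w; apply: eq_path.
Qed.

Lemma freely_generates_fgen : freely_generates a -> fgen (iota 0 N) nat_basis setT.
Proof.
move=> [ainj [_ _ fb]].
pose f (l : 'I_N * bool) := (a l.1, l.2).
have fred w : reduced w -> reduced (map f w).
  rewrite !reducedE sorted_map; apply: sub_sorted => -[i b] [j c] /=.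
  by rewrite /f /linv /= !xpair_eqE (inj_eq ainj).
have fover w : word_over (range a) (map f w) by move=> _ /mapP[l _ ->]; exists l.1.
have fval w : word_val id (map f w) = word_val a w by rewrite word_val_map.
split.
  apply/seteqP; split=> // h _; have [w [[ow _ <-] _]] := fb h I.
  have [w' <-] : exists w' : word 'I_N, map f w' = w.
    elim: w ow => [|[y b] w IH] ow; first by exists [::].
    have [|w' <-] := IH; first by move=> l hl; apply: ow; rewrite inE hl orbT.
    by have [i _ /= <-] := ow _ (mem_head _ _); exists ((i, b) :: w').
  by exists (nat_word w'); [apply: over_nat | rewrite word_val_nat fval].
move=> w /over_red /over_nat_word[w' e]; rewrite -word_val_red -e word_val_nat => v1.
have rw' : reduced w' by rewrite -reduced_nat e red_reduced.
have [w0 [_ u]] := fb 1 I.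
have : [::] = map f w'.
  rewrite -(u [::]); last by split=> //; rewrite word_val_nil.
  by apply: u; split; rewrite ?fval //; apply: fred.
by case: (w').
Qed.

(** ** The extremal functions *)

Definition candidates n : seq (word nat) :=
  [seq w <- words N n | (red w != [::]) && ~~ is_power N w].

Definition extremum crit n : nat := foldr maxn 0 [seq distance N crit w | w <- candidates n].

Hypothesis fa : fgen (iota 0 N) nat_basis setT.

Lemma red_nontrivial w : over (iota 0 N) w -> (red w != [::]) <-> word_val nat_basis w <> 1.
Proof.
move=> ow; split=> [/eqP n e|n]; first by apply: n; case: fa => _; apply.
by apply/eqP => e; apply: n; rewrite -word_val_red e word_val_nil.
Qed.

Lemma mem_candidates n g :
  (exists2 w, w \in candidates n & word_val nat_basis w = g) <-> admissible a n g.
Proof.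
split.
  move=> [w]; rewrite mem_filter mem_words => /andP[/andP[nt np] /andP[sw ow]] <-.
  have ne : word_val nat_basis w <> 1 by apply/red_nontrivial.
  split=> //; first by move/(is_powerP fa ow ne); apply/negP.
  have [w' e] := over_nat_word (over_red ow).
  exists (size w'); last first.
    by rewrite -(size_map (fun l => (val l.1, l.2))) -/(nat_word w') e (leq_trans (size_red _)).
  exists w'; split=> //; last by rewrite -word_val_nat e word_val_red.
  by rewrite -reduced_nat e red_reduced.
move=> [ne np [m [w [rw vw sw]] mn]].
have ow := over_nat w; have nw : word_val nat_basis (nat_word w) <> 1 by rewrite word_val_nat vw.
exists (nat_word w); last by rewrite word_val_nat.
rewrite mem_filter mem_words ow size_map sw mn !andbT; apply/andP; split.
  exact/red_nontrivial.
by apply/negP => /(is_powerP fa ow nw); rewrite word_val_nat vw.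
Qed.

Lemma least_unique P k m : least P k -> least P m -> k = m.
Proof. by move=> [Pk hk] [Pm hm]; apply/eqP; rewrite eqn_leq hk // hm. Qed.

Lemma maximum_mem (s : seq nat) : 0 < size s -> foldr maxn 0 s \in s.
Proof.
elim: s => // x s IH _ /=; rewrite /maxn; case: ifP => h; last by rewrite mem_head.
by rewrite inE IH ?orbT //; case: s h {IH}.
Qed.

Lemma maximum_ge (s : seq nat) x : x \in s -> x <= foldr maxn 0 s.
Proof.
by elim: s => //= y s IH; rewrite inE leq_max => /orP[/eqP->|/IH ->]; rewrite ?leqnn ?orbT.
Qed.

Lemma candidates_nonempty n : 0 < N -> 0 < n -> 0 < size (candidates n).
Proof.
move=> N0 n0; set w := [:: (0, false)].
have ow : over (iota 0 N) w by rewrite over_iota /= N0.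
have ne : word_val nat_basis w <> 1 by apply/red_nontrivial.
have : w \in candidates n.
  rewrite mem_filter mem_words ow n0 !andbT; apply/negP => /(is_powerP fa ow ne)[g [k [k1 e]]].
  have [h [_ _ _ [_]]] := power_root_size fa ow ne (ltnW k1) e.
  by rewrite /= leqNgt k1.
by case: (candidates n).
Qed.

Lemma extremumP crit (Q : F -> nat -> Prop) n : 0 < N -> 0 < n ->
  (forall w, over (iota 0 N) w -> word_val nat_basis w <> 1 ->
     least (Q (word_val nat_basis w)) (distance N crit w)) ->
  max_over a (fun g => least (Q g)) n (extremum crit n).
Proof.
move=> N0 n0 dist.
have cand w : w \in candidates n -> over (iota 0 N) w /\ word_val nat_basis w <> 1.
  rewrite mem_filter mem_words => /andP[/andP[nt _] /andP[_ ow]]; split=> //.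
  exact/red_nontrivial.
split.
  have := @maximum_mem [seq distance N crit w | w <- candidates n].
  rewrite size_map candidates_nonempty // -/(extremum crit n) => /(_ isT)/mapP[w hw ->].
  have [ow ne] := cand w hw; exists (word_val nat_basis w); split; last exact: dist.
  by apply/mem_candidates; exists w.
move=> g m /mem_candidates[w hw <-] lm; have [ow ne] := cand w hw.
rewrite (least_unique lm (dist w ow ne)); apply: maximum_ge; exact: map_f.
Qed.

End Ordinals.
(** * Computable functions on encoded data *)

(** ** Arithmetic programs *)

Lemma eval_comp1 p q xs y z : eval q xs y -> eval p [:: y] z -> eval (Comp p [:: q]) xs z.
Proof. by move=> h1 h2; apply: EvalComp h2; apply: EvalsCons h1 (EvalsNil _). Qed.

Lemma eval_comp2 p q1 q2 xs y1 y2 z : eval q1 xs y1 -> eval q2 xs y2 ->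
  eval p [:: y1; y2] z -> eval (Comp p [:: q1; q2]) xs z.
Proof.
by move=> h1 h2 h3; apply: EvalComp h3; apply: EvalsCons h1 (EvalsCons h2 (EvalsNil _)).
Qed.

Lemma eval_comp3 p q1 q2 q3 xs y1 y2 y3 z : eval q1 xs y1 -> eval q2 xs y2 ->
  eval q3 xs y3 -> eval p [:: y1; y2; y3] z -> eval (Comp p [:: q1; q2; q3]) xs z.
Proof.
move=> h1 h2 h3 h4; apply: EvalComp h4.
exact: EvalsCons h1 (EvalsCons h2 (EvalsCons h3 (EvalsNil _))).
Qed.

Lemma eval_proj i xs y : i < size xs -> nth 0 xs i = y -> eval (Proj i) xs y.
Proof. by move=> h <-; apply: EvalProj. Qed.

Lemma eval_rec p q n xs (f : nat -> nat) : eval p xs (f 0) ->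
  (forall m, m < n -> eval q [:: m, f m & xs] (f m.+1)) -> eval (Rec p q) (n :: xs) (f n).
Proof.
move=> h0 hS; elim: n hS => [|n IH] hS; first exact: EvalRec0.
apply: (EvalRecS (r := f n)); last exact: hS.
by apply: IH => m hm; apply: hS; rewrite ltnS ltnW.
Qed.

Local Ltac proj := by apply: eval_proj.

Lemma eval_succ q xs y : eval q xs y -> eval (Comp Succ [:: q]) xs y.+1.
Proof. by move=> h; apply: eval_comp1 h _; apply: EvalSucc. Qed.

Definition p_double := Rec Zero (Comp Succ [:: Comp Succ [:: Proj 1]]).
Lemma eval_double n : eval p_double [:: n] n.*2.
Proof.
apply: (eval_rec (f := double)); first exact: EvalZero.
by move=> m _; apply: eval_succ; apply: eval_succ; proj.
Qed.

Definition p_is0 := Rec (Comp Succ [:: Zero]) Zero.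
Lemma eval_is0 n : eval p_is0 [:: n] (n == 0).
Proof.
apply: (eval_rec (f := fun n => nat_of_bool (n == 0))); last by move=> m _; apply: EvalZero.
by apply: eval_succ; apply: EvalZero.
Qed.

Definition p_odd := Rec Zero (Comp p_is0 [:: Proj 1]).
Lemma eval_odd n : eval p_odd [:: n] (odd n).
Proof.
apply: (eval_rec (f := fun n => nat_of_bool (odd n))); first exact: EvalZero.
move=> m _; apply: eval_comp1; first proj.
by have := eval_is0 (odd m); rewrite /=; case: (odd m).
Qed.

Definition p_add := Rec (Proj 0) (Comp Succ [:: Proj 1]).
Lemma eval_add m n : eval p_add [:: m; n] (m + n).
Proof.
apply: (eval_rec (f := addn ^~ n)); first proj.
by move=> k _; rewrite addSn; apply: eval_succ; proj.
Qed.

Definition p_half := Rec Zero (Comp p_add [:: Comp p_odd [:: Proj 0]; Proj 1]).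
Lemma eval_half n : eval p_half [:: n] n./2.
Proof.
apply: (eval_rec (f := half)); first exact: EvalZero.
move=> m _; have -> : m.+1./2 = odd m + m./2 by rewrite -uphalfE uphalf_half.
apply: eval_comp2 (eval_add _ _); last proj.
by apply: eval_comp1 (eval_odd _); proj.
Qed.

(** The pairing function is the one that codes lists by iteration. *)
Definition pairing x y := 2 ^ x * y.*2.+1.
Definition p_pair := Rec (Comp Succ [:: Comp p_double [:: Proj 0]]) (Comp p_double [:: Proj 1]).
Lemma eval_pair x y : eval p_pair [:: x; y] (pairing x y).
Proof.
apply: (eval_rec (f := pairing ^~ y)).
  by rewrite /pairing mul1n; apply: eval_succ; apply: eval_comp1 (eval_double _); proj.
move=> m _; have -> : pairing m.+1 y = (pairing m y).*2.
  by rewrite /pairing expnS -mulnA mul2n.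
by apply: eval_comp1 (eval_double _); proj.
Qed.

(** Halving removes the power of two from [pairing x y], which gives the second
    component, and the number of halvings is the first one. *)
Definition strip n c := iter n (fun r => if odd r then r else r./2) c.
Definition p_strip := Rec (Proj 0) (Comp (Rec (Proj 1) (Proj 2))
  [:: Comp p_odd [:: Proj 1]; Proj 1; Comp p_half [:: Proj 1]]).
Lemma eval_strip n c : eval p_strip [:: n; c] (strip n c).
Proof.
apply: (eval_rec (f := strip ^~ c)); first proj.
move=> m _; apply: eval_comp3.
- by apply: eval_comp1 (eval_odd _); proj.
- by apply: (eval_proj (y := strip m c)).
- by apply: eval_comp1 (eval_half _); proj.
rewrite /=; case: (odd _).
  by apply: (@eval_rec _ _ 1 _ (fun n => if n is 0 then (strip m c)./2 else strip m c)); [proj | move=> k _; proj].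
by apply: EvalRec0; proj.
Qed.

Definition p_count := Rec Zero (Comp p_add
  [:: Comp p_is0 [:: Comp p_odd [:: Comp p_strip [:: Proj 0; Proj 2]]]; Proj 1]).

Lemma strip_pairing n x y : strip n (pairing x y) = pairing (x - n) y.
Proof.
elim: n => [|n IH]; first by rewrite subn0.
rewrite /= -/(strip n _) IH /pairing subnS; case: (x - n) => [|m].
  by rewrite !mul1n /= odd_double.
by rewrite expnS -mulnA mul2n odd_double doubleK.
Qed.

Lemma eval_count n x y : eval p_count [:: n; pairing x y] (minn n x).
Proof.
apply: (eval_rec (f := fun n => minn n x)); first by rewrite min0n; apply: EvalZero.
move=> m _; have -> : minn m.+1 x = (odd (strip m (pairing x y)) == 0 :> nat) + minn m x.
  rewrite strip_pairing /pairing /minn; case: (ltnP m x) => h.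
    have -> : x - m = (x - m.+1).+1 by lia.
    rewrite expnS -mulnA mul2n odd_double /= add1n.
    by case: ltnP => //; lia.
  have -> : x - m = 0 by lia.
  rewrite mul1n /= odd_double /=; case: ltnP; lia.
apply: eval_comp2 (eval_add _ _); last proj.
apply: eval_comp1 (eval_is0 _); apply: eval_comp1 (eval_odd _).
by apply: eval_comp2 (eval_strip _ _); proj.
Qed.

Lemma pairing_gt x y : x < pairing x y.
Proof. by apply: leq_trans (ltn_expl x (ltnSn 1)) _; rewrite leq_pmulr. Qed.

Lemma pairing_gt2 x y : y < pairing x y.
Proof.
have : 0 < 2 ^ x by rewrite expn_gt0.
rewrite /pairing; case: (2 ^ x) => // n _; rewrite mulSn; apply: leq_trans (leq_addr _ _).
by rewrite ltnS -addnn leq_addr.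
Qed.

Definition p_fst := Comp p_count [:: Proj 0; Proj 0].
Lemma eval_fst x y : eval p_fst [:: pairing x y] x.
Proof.
have -> : x = minn (pairing x y) x by rewrite (minn_idPr _) // ltnW // pairing_gt.
by apply: eval_comp2 (eval_count _ _ y); apply: eval_proj; rewrite //= (minn_idPr _) // ltnW // pairing_gt.
Qed.

Definition p_snd := Comp p_half [:: Comp p_strip [:: Proj 0; Proj 0]].
Lemma eval_snd x y : eval p_snd [:: pairing x y] y.
Proof.
have e : (strip (pairing x y) (pairing x y))./2 = y.
  rewrite strip_pairing (eqP (_ : x - pairing x y == 0)); last by rewrite subn_eq0 ltnW // pairing_gt.
  by rewrite /pairing mul1n /= uphalf_double.
rewrite -{2}e; apply: eval_comp1 (eval_half _); apply: eval_comp2 (eval_strip _ _); proj.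
Qed.

Lemma pairing_inj x y x' y' : pairing x y = pairing x' y' -> x = x' /\ y = y'.
Proof.
move=> e.
have fst_uniq : x = x'.
  have := congr1 (strip (minn x x')) e; rewrite !strip_pairing.
  rewrite /pairing; case: (ltngtP x x') => // h.
    have -> : x' - x = (x' - x).-1.+1 by lia.
    by rewrite subnn mul1n expnS -mulnA mul2n => /(congr1 odd); rewrite /= !odd_double.
  have -> : x - x' = (x - x').-1.+1 by lia.
  by rewrite subnn mul1n expnS -mulnA mul2n => /(congr1 odd); rewrite /= !odd_double.
split=> //; move: e; rewrite fst_uniq /pairing => /eqP.
by rewrite eqn_pmul2l ?expn_gt0 // eqSS => /eqP /double_inj.
Qed.

(** ** Encodable types *)

Class encodable (T : Type) := { enc : T -> nat; enc_inj : injective enc }.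

#[global] Instance encodable_nat : encodable nat := {| enc := id; enc_inj := @inj_id nat |}.

Lemma nat_of_bool_inj : injective nat_of_bool. Proof. by case; case. Qed.
#[global] Instance encodable_bool : encodable bool :=
  {| enc := nat_of_bool; enc_inj := nat_of_bool_inj |}.

Lemma enc_prod_inj (S T : Type) (eS : encodable S) (eT : encodable T) :
  injective (fun p : S * T => pairing (enc p.1) (enc p.2)).
Proof. by move=> [x y] [x' y'] /pairing_inj[ex ey]; congr pair; apply: enc_inj. Qed.
#[global] Instance encodable_prod (S T : Type) (eS : encodable S) (eT : encodable T) :
  encodable (S * T) := {| enc := _; enc_inj := @enc_prod_inj S T eS eT |}.

Lemma enc_seq_inj (T : Type) (eT : encodable T) :
  injective (fun s : seq T => CodeSeq.code (map enc s)).
Proof. by move=> s s' /(can_inj CodeSeq.codeK) /(inj_map enc_inj). Qed.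
#[global] Instance encodable_seq (T : Type) (eT : encodable T) :
  encodable (seq T) := {| enc := _; enc_inj := @enc_seq_inj T eT |}.

Lemma enc_cons (T : Type) {eT : encodable T} (x : T) (s : seq T) :
  enc (x :: s) = enc (x, s).
Proof. by []. Qed.

Lemma size_enc (T : Type) {eT : encodable T} (s : seq T) : size s <= enc s.
Proof.
elim: s => // x s IH; rewrite enc_cons; apply: leq_ltn_trans IH _.
exact: pairing_gt2.
Qed.

Definition comp (X Y : Type) {eX : encodable X} {eY : encodable Y} (f : X -> Y) : Prop :=
  exists p, forall x, eval p [:: enc x] (enc (f x)).

(** ** Closure properties *)

Section Closure.
Context {X Y Z T : Type} {eX : encodable X} {eY : encodable Y}
  {eZ : encodable Z} {eT : encodable T}.

Lemma comp_ext (f g : X -> Y) : f =1 g -> comp f -> comp g.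
Proof. by move=> e [p hp]; exists p => x; rewrite -e. Qed.

Lemma comp_id : comp (fun x : X => x).
Proof. by exists (Proj 0) => x; proj. Qed.

Lemma comp_const (c : Y) : comp (fun _ : X => c).
Proof.
have [p hp] : exists p, forall xs, eval p xs (enc c).
  elim: (enc c) => [|n [p hp]]; first by exists Zero => xs; apply: EvalZero.
  by exists (Comp Succ [:: p]) => xs; apply: eval_succ.
by exists p.
Qed.

Lemma comp_compose (g : Y -> Z) (f : X -> Y) : comp g -> comp f -> comp (fun x => g (f x)).
Proof. by move=> [p hp] [q hq]; exists (Comp p [:: q]) => x; apply: eval_comp1 (hq x) (hp _). Qed.

Lemma comp_pair (f : X -> Y) (g : X -> Z) : comp f -> comp g -> comp (fun x => (f x, g x)).
Proof.
move=> [p hp] [q hq]; exists (Comp p_pair [:: p; q]) => x.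
by apply: eval_comp2 (hp x) (hq x) _; apply: eval_pair.
Qed.

Lemma comp_fst (f : X -> Y * Z) : comp f -> comp (fun x => (f x).1).
Proof.
by move=> [p hp]; exists (Comp p_fst [:: p]) => x; apply: eval_comp1 (hp x) _; apply: eval_fst.
Qed.

Lemma comp_snd (f : X -> Y * Z) : comp f -> comp (fun x => (f x).2).
Proof.
by move=> [p hp]; exists (Comp p_snd [:: p]) => x; apply: eval_comp1 (hp x) _; apply: eval_snd.
Qed.

Lemma comp_natrec (n : X -> nat) (b : X -> Y) (s : X -> nat -> Y -> Y) :
  comp n -> comp b -> comp (fun p : X * (nat * Y) => s p.1 p.2.1 p.2.2) ->
  comp (fun x => nat_rect (fun _ => Y) (b x) (s x) (n x)).
Proof.
move=> [pn hn] [pb hb] [ps hs].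
exists (Comp (Rec pb (Comp ps [:: Comp p_pair [:: Proj 2; Comp p_pair [:: Proj 0; Proj 1]]]))
  [:: pn; Proj 0]) => x.
apply: eval_comp2 (hn x) _ _; first proj.
apply: (eval_rec (f := fun m => enc (nat_rect (fun _ => Y) (b x) (s x) m))) => [|m _]; first exact: hb.
apply: eval_comp1 (hs (x, (m, nat_rect (fun _ => Y) (b x) (s x) m))).
apply: eval_comp2 (eval_pair _ _); first proj.
by apply: eval_comp2 (eval_pair _ _); proj.
Qed.

(** The code of a nonempty list is that of its head and tail; both branches are
    only evaluated where they apply. *)
Lemma comp_list_case (l : X -> seq Y) (g : X -> Z) (f : X -> Y -> seq Y -> Z) :
  comp l -> comp g -> comp (fun p : X * (Y * seq Y) => f p.1 p.2.1 p.2.2) ->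
  comp (fun x => match l x with [::] => g x | y :: s => f x y s end).
Proof.
move=> [pl hl] [pg hg] [pf hf].
exists (Comp (Rec pg (Comp pf [:: Comp p_pair [:: Proj 2; Comp pl [:: Proj 2]]])) [:: pl; Proj 0]) => x.
apply: eval_comp2 (hl x) _ _; first proj.
case el : (l x) => [|y s]; first exact: EvalRec0 (hg x).
pose h n := if n is 0 then @enc Z eZ (g x) else @enc Z eZ (f x y s).
have -> : enc (f x y s) = h (enc (y :: s)).
  have n0 : 0 < enc (y :: s) by apply: leq_trans (size_enc (y :: s)).
  by rewrite -(prednK n0).
apply: eval_rec => [|m _]; first exact: hg.
apply: eval_comp1 (hf (x, (y, s))); apply: eval_comp2 (eval_pair _ _); first proj.
by apply: (eval_comp1 (y := enc x)); [proj | rewrite -[X in eval _ _ X]/(enc (y, s)) -enc_cons -el].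
Qed.

End Closure.

Section Composition.
Context {X Y Z T : Type} {eX : encodable X} {eY : encodable Y}
  {eZ : encodable Z} {eT : encodable T}.

Lemma comp_app2 (h : Y -> Z -> T) (f : X -> Y) (g : X -> Z) :
  comp (fun p : Y * Z => h p.1 p.2) -> comp f -> comp g -> comp (fun x => h (f x) (g x)).
Proof. by move=> hh hf hg; apply: (comp_compose hh (comp_pair hf hg)). Qed.

End Composition.

Section Iteration.
Context {X Y Z T : Type} {eX : encodable X} {eY : encodable Y}
  {eZ : encodable Z} {eT : encodable T}.

Lemma comp_iter (n : X -> nat) (b : X -> Y) (f : X -> Y -> Y) :
  comp n -> comp b -> comp (fun p : X * Y => f p.1 p.2) ->
  comp (fun x => iter (n x) (f x) (b x)).
Proof.
move=> hn hb hf; apply: (comp_ext (f := fun x => nat_rect (fun _ => Y) (b x) (fun _ => f x) (n x))).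
  by move=> x; elim: (n x) => //= m ->.
apply: comp_natrec => //; apply: (comp_app2 (h := f)) => //.
  exact: comp_fst comp_id.
exact: comp_snd (comp_snd comp_id).
Qed.

Lemma comp_if (c : X -> bool) (f g : X -> Y) :
  comp c -> comp f -> comp g -> comp (fun x => if c x then f x else g x).
Proof.
move=> hc hf hg.
apply: (comp_ext (f := fun x => nat_rect (fun _ => Y) (g x) (fun _ _ => f x) (nat_of_bool (c x)))).
  by move=> x; case: (c x).
by apply: comp_natrec => //; apply: (comp_compose hf); apply: comp_fst comp_id.
Qed.

Lemma comp_cons (f : X -> Y) (g : X -> seq Y) : comp f -> comp g -> comp (fun x => f x :: g x).
Proof. by move=> hf hg; have [p hp] := comp_pair hf hg; exists p. Qed.

End Iteration.

Section Folding.
Context {X Y Z T : Type} {eX : encodable X} {eY : encodable Y}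
  {eZ : encodable Z} {eT : encodable T}.

(** The code of a list bounds its length, and further iterations change nothing. *)
Lemma comp_foldl (l : X -> seq Y) (b : X -> Z) (s : X -> Z -> Y -> Z) :
  comp l -> comp b -> comp (fun p : X * (Z * Y) => s p.1 p.2.1 p.2.2) ->
  comp (fun x => foldl (s x) (b x) (l x)).
Proof.
move=> hl hb hs.
pose step (x : X) (st : seq Y * Z) := match st.1 with [::] => st | y :: t => (t, s x st.2 y) end.
apply: (comp_ext (f := fun x => (iter (enc (l x)) (step x) (l x, b x)).2)).
  move=> x; have := @size_enc Y eY (l x); move: (enc (l x)) => n.
  elim: n (l x) (b x) => [|n IH] t z; first by rewrite leqn0 => /nilP ->.
  by case: t => [|y t] h; rewrite iterSr {2}/step /= IH.
apply: comp_snd; apply: comp_iter; first 2 last.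
- apply: comp_list_case; first by apply: comp_fst; apply: comp_snd; apply: comp_id.
    by apply: comp_snd; apply: comp_id.
  apply: comp_pair; first by apply: comp_snd; apply: comp_snd; apply: comp_id.
  apply: (comp_compose (g := fun p : X * (Z * Y) => s p.1 p.2.1 p.2.2)
    (f := fun p => (p.1.1, (p.1.2.2, p.2.1)))) => //.
  apply: comp_pair; first by apply: comp_fst; apply: comp_fst; apply: comp_id.
  apply: comp_pair; first by apply: comp_snd; apply: comp_snd; apply: comp_fst; apply: comp_id.
  by apply: comp_fst; apply: comp_snd; apply: comp_id.
- by have [p hp] := hl; exists p.
- exact: comp_pair.
Qed.

End Folding.

Section Reversal.
Context {X Y Z T : Type} {eX : encodable X} {eY : encodable Y}
  {eZ : encodable Z} {eT : encodable T}.

Lemma comp_rev (l : X -> seq Y) : comp l -> comp (fun x => rev (l x)).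
Proof.
move=> hl; apply: (comp_ext (f := fun x => foldl (fun s y => y :: s) [::] (l x))).
  by move=> x; rewrite /rev; elim: (l x) [::] => //= y s IH acc; rewrite IH.
apply: comp_foldl => //; first exact: comp_const.
by apply: comp_cons; [apply: comp_snd | apply: comp_fst]; apply: comp_snd; apply: comp_id.
Qed.

End Reversal.

(** ** Lists and arithmetic *)

(** Decomposes a goal [comp f] along the head symbol of the body of [f]. The operations
    that [comp_user] knows are extended as they are shown to be computable. *)
Ltac comp_user := fail.

Ltac comp_step :=
  lazymatch goal with
  | |- comp (fun _ => _) => idtac
  | |- @comp ?A ?B ?eA ?eB ?f => change (@comp A B eA eB (fun x => f x))
  end;
  lazymatch goal with
  | |- comp (fun x => x) => apply comp_id
  | |- comp (fun _ => ?c) => apply comp_const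
  | |- comp (fun x => (@?f x, @?g x)) => apply (@comp_pair _ _ _ _ _ _ f g)
  | |- comp (fun x => fst (@?f x)) => apply (@comp_fst _ _ _ _ _ _ f)
  | |- comp (fun x => snd (@?f x)) => apply (@comp_snd _ _ _ _ _ _ f)
  | |- comp (fun x => cons (@?f x) (@?g x)) => apply (@comp_cons _ _ _ _ f g)
  | H : comp ?h |- comp (fun x => ?h (@?g x)) => apply (@comp_compose _ _ _ _ _ _ h g H)
  | H : comp (fun p => ?h (fst p) (snd p)) |- comp (fun x => ?h (@?f x) (@?g x)) =>
      apply (@comp_app2 _ _ _ _ _ _ _ _ h f g H)
  | |- _ => first [ assumption | comp_user | apply comp_if | apply comp_list_case ]
  end; cbv beta.

Ltac comp_auto := repeat comp_step.

Section RightFolding.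
Context {X Y Z : Type} {eX : encodable X} {eY : encodable Y} {eZ : encodable Z}.

Lemma comp_foldr (l : X -> seq Y) (b : X -> Z) (s : X -> Y -> Z -> Z) :
  comp l -> comp b -> comp (fun p : X * (Y * Z) => s p.1 p.2.1 p.2.2) ->
  comp (fun x => foldr (s x) (b x) (l x)).
Proof.
move=> hl hb hs; apply: (comp_ext (f := fun x => foldl (fun z y => s x y z) (b x) (rev (l x)))).
  by move=> x; rewrite foldl_rev.
apply: comp_foldl => //; first exact: comp_rev.
apply: (comp_compose (g := fun p : X * (Y * Z) => s p.1 p.2.1 p.2.2)
  (f := fun p => (p.1, (p.2.2, p.2.1)))) => //.
by comp_auto.
Qed.

End RightFolding.

Section Elementary.
Context {X Y Z : Type} {eX : encodable X} {eY : encodable Y} {eZ : encodable Z}.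
Implicit Types (l : X -> seq Y).

Lemma comp_map l (f : X -> Y -> Z) :
  comp l -> comp (fun p : X * Y => f p.1 p.2) -> comp (fun x => map (f x) (l x)).
Proof.
move=> hl hf; apply: (comp_ext (f := fun x => foldr (fun y s => f x y :: s) [::] (l x))) => //.
by apply: comp_foldr; comp_auto.
Qed.

Lemma comp_cat l (l' : X -> seq Y) : comp l -> comp l' -> comp (fun x => l x ++ l' x).
Proof.
move=> h h'; apply: (comp_ext (f := fun x => foldr (fun y s => y :: s) (l' x) (l x))).
  by move=> x; elim: (l x) => //= y s ->.
by apply: comp_foldr; comp_auto.
Qed.

Lemma comp_andb (b c : X -> bool) : comp b -> comp c -> comp (fun x => b x && c x).
Proof. by move=> hb hc; apply: (comp_if hb hc); comp_auto. Qed.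

Lemma comp_orb (b c : X -> bool) : comp b -> comp c -> comp (fun x => b x || c x).
Proof. by move=> hb hc; apply: (comp_if hb _ hc); comp_auto. Qed.

Lemma comp_negb (b : X -> bool) : comp b -> comp (fun x => ~~ b x).
Proof. by move=> hb; apply: (comp_if hb); comp_auto. Qed.

Lemma comp_filter l (f : X -> Y -> bool) :
  comp l -> comp (fun p : X * Y => f p.1 p.2) -> comp (fun x => filter (f x) (l x)).
Proof.
move=> hl hf.
apply: (comp_ext (f := fun x => foldr (fun y s => if f x y then y :: s else s) [::] (l x))) => //.
by apply: comp_foldr; comp_auto.
Qed.

Lemma comp_S (n : X -> nat) : comp n -> comp (fun x => (n x).+1).
Proof. by move=> [p hp]; exists (Comp Succ [:: p]) => x; apply: eval_succ. Qed.

Lemma comp_add (m n : X -> nat) : comp m -> comp n -> comp (fun x => m x + n x).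
Proof.
move=> [p hp] [q hq]; exists (Comp p_add [:: p; q]) => x.
exact: eval_comp2 (hp x) (hq x) (eval_add _ _).
Qed.

Lemma comp_half (n : X -> nat) : comp n -> comp (fun x => (n x)./2).
Proof. by move=> [p hp]; exists (Comp p_half [:: p]) => x; apply: eval_comp1 (hp x) (eval_half _). Qed.

Lemma comp_odd (n : X -> nat) : comp n -> comp (fun x => odd (n x)).
Proof. by move=> [p hp]; exists (Comp p_odd [:: p]) => x; apply: eval_comp1 (hp x) (eval_odd _). Qed.

Lemma comp_is0 (n : X -> nat) : comp n -> comp (fun x => n x == 0).
Proof. by move=> [p hp]; exists (Comp p_is0 [:: p]) => x; apply: eval_comp1 (hp x) (eval_is0 _). Qed.

Lemma comp_pred (n : X -> nat) : comp n -> comp (fun x => (n x).-1).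
Proof.
move=> hn; apply: (comp_ext (f := fun x => nat_rect (fun _ => nat) 0 (fun m _ => m) (n x))).
  by move=> x; case: (n x).
by apply: comp_natrec; comp_auto.
Qed.

Lemma comp_nat_of_bool (b : X -> bool) : comp b -> comp (fun x => nat_of_bool (b x)).
Proof. by move=> [p hp]; exists p. Qed.

End Elementary.

Section ListOperations.
Context {X Y Z : Type} {eX : encodable X} {eY : encodable Y} {eZ : encodable Z}.
Implicit Types (l : X -> seq Y).

Lemma comp_sub (m n : X -> nat) : comp m -> comp n -> comp (fun x => m x - n x).
Proof.
move=> hm hn; apply: (comp_ext (f := fun x => iter (n x) predn (m x))).
  by move=> x; elim: (n x) => [|k IH]; rewrite ?subn0 // subnS -IH.
by apply: comp_iter; comp_auto; apply: comp_pred; comp_auto.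
Qed.

Lemma comp_flatten (l : X -> seq (seq Y)) : comp l -> comp (fun x => flatten (l x)).
Proof.
move=> hl; apply: (comp_ext (f := fun x => foldr (fun s t => s ++ t) [::] (l x))) => //.
by apply: comp_foldr; comp_auto; apply: comp_cat; comp_auto.
Qed.

Lemma comp_all l (f : X -> Y -> bool) :
  comp l -> comp (fun p : X * Y => f p.1 p.2) -> comp (fun x => all (f x) (l x)).
Proof.
move=> hl hf; apply: (comp_ext (f := fun x => foldr (fun y b => f x y && b) true (l x))) => //.
by apply: comp_foldr; comp_auto; apply: comp_andb; comp_auto.
Qed.

Lemma comp_has l (f : X -> Y -> bool) :
  comp l -> comp (fun p : X * Y => f p.1 p.2) -> comp (fun x => has (f x) (l x)).
Proof.
move=> hl hf; apply: (comp_ext (f := fun x => foldr (fun y b => f x y || b) false (l x))) => //.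
by apply: comp_foldr; comp_auto; apply: comp_orb; comp_auto.
Qed.

Lemma comp_find l (f : X -> Y -> bool) :
  comp l -> comp (fun p : X * Y => f p.1 p.2) -> comp (fun x => find (f x) (l x)).
Proof.
move=> hl hf.
apply: (comp_ext (f := fun x => foldr (fun y n => if f x y then 0 else n.+1) 0 (l x))) => //.
by apply: comp_foldr; comp_auto; apply: comp_S; comp_auto.
Qed.

Lemma comp_size l : comp l -> comp (fun x => size (l x)).
Proof.
move=> hl; apply: (comp_ext (f := fun x => foldr (fun _ n => n.+1) 0 (l x))) => //.
by apply: comp_foldr; comp_auto; apply: comp_S; comp_auto.
Qed.

Lemma comp_nth d l (n : X -> nat) : comp l -> comp n -> comp (fun x => nth d (l x) (n x)).
Proof.
move=> hl hn.
pose tail (s : seq Y) := if s is _ :: t then t else [::].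
have htail : comp tail by rewrite /tail; comp_auto.
apply: (comp_ext (f := fun x => if iter (n x) tail (l x) is y :: _ then y else d)).
  move=> x; elim: (n x) (l x) => [|k IH] [|y s] //; rewrite iterSr IH //.
  by case: k {IH}.
apply: comp_list_case; comp_auto.
by apply: comp_iter; comp_auto.
Qed.

Lemma comp_iota (m n : X -> nat) : comp m -> comp n -> comp (fun x => iota (m x) (n x)).
Proof.
move=> hm hn.
apply: (comp_ext (f := fun x => rev (iter (n x)
  (fun s => (if s is k :: _ then k.+1 else m x) :: s) [::]))).
  move=> x; have h k : rev (iota (m x) k) =
      iter k (fun s => (if s is k :: _ then k.+1 else m x) :: s) [::].
    have step j : rev (iota (m x) j.+1) = (m x + j) :: rev (iota (m x) j).
      by rewrite -addn1 iotaD cats1 rev_rcons.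
    elim: k => // k IH; rewrite step iterS -IH; congr (_ :: _).
    by case: k {IH} => [|k]; rewrite ?addn0 // step addnS.
  by rewrite -h revK.
apply: comp_rev; apply: comp_iter; comp_auto; apply: comp_S; comp_auto.
Qed.

Lemma comp_leq (m n : X -> nat) : comp m -> comp n -> comp (fun x => m x <= n x).
Proof. by move=> hm hn; apply: comp_is0; apply: comp_sub. Qed.

End ListOperations.

Section Comparison.
Context {X Y Z : Type} {eX : encodable X} {eY : encodable Y} {eZ : encodable Z}.

Lemma comp_ltn (m n : X -> nat) : comp m -> comp n -> comp (fun x => m x < n x).
Proof. by move=> hm hn; apply: comp_leq => //; apply: comp_S. Qed.

(** Equality is decided on the codes. *)
Lemma comp_eq (T : eqType) {eT : encodable T} (f g : X -> T) :
  comp f -> comp g -> comp (fun x => f x == g x).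
Proof.
move=> [p hp] [q hq].
apply: (comp_ext (f := fun x => (enc (f x) <= enc (g x)) && (enc (g x) <= enc (f x)))).
  by move=> x; rewrite -eqn_leq (inj_eq enc_inj).
by apply: comp_andb; apply: comp_leq; by [exists p | exists q].
Qed.

Lemma comp_maxn (m n : X -> nat) : comp m -> comp n -> comp (fun x => maxn (m x) (n x)).
Proof. by move=> hm hn; apply: comp_if => //; apply: comp_ltn. Qed.

End Comparison.

Section ListSearch.
Context {X : Type} {eX : encodable X}.

Lemma comp_mem (T : eqType) {eT : encodable T} (f : X -> T) (l : X -> seq T) :
  comp f -> comp l -> comp (fun x => f x \in l x).
Proof.
move=> hf hl; apply: (comp_ext (f := fun x => has (fun y => y == f x) (l x))).
  by move=> x; rewrite has_pred1.
by apply: comp_has; comp_auto; apply: comp_eq; comp_auto.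
Qed.

Lemma comp_index (T : eqType) {eT : encodable T} (f : X -> T) (l : X -> seq T) :
  comp f -> comp l -> comp (fun x => index (f x) (l x)).
Proof. by move=> hf hl; apply: comp_find; comp_auto; apply: comp_eq; comp_auto. Qed.

Lemma comp_nseq (T : Type) {eT : encodable T} (n : X -> nat) (f : X -> T) :
  comp n -> comp f -> comp (fun x => nseq (n x) (f x)).
Proof. by move=> hn hf; apply: comp_iter; comp_auto. Qed.

End ListSearch.

(** ** The algorithm is computable *)

#[local] Hint Extern 5 (encodable ?A) =>
  let B := eval hnf in A in progress change (encodable B) : typeclass_instances.

Opaque comp.

Ltac comp_lib :=
  lazymatch goal with
  | |- comp (fun x => @eq_op ?S (@?f x) (@?g x)) => apply (@comp_eq _ _ S _ f g)
  | |- comp (fun x => @in_mem _ (@?f x) (@mem _ (seq_predType ?S) (@?s x))) =>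
      apply (@comp_mem _ _ S _ f s)
  | |- comp (fun x => @index ?S (@?f x) (@?s x)) => apply (@comp_index _ _ S _ f s)
  | |- comp (fun x => nat_of_bool (@?b x)) => apply (@comp_nat_of_bool _ _ b)
  | |- _ => first
        [ apply comp_cat | apply comp_andb | apply comp_orb | apply comp_negb
        | apply comp_nth
        | apply comp_iota | apply comp_size | apply comp_flatten | apply comp_map
        | apply comp_filter | apply comp_all | apply comp_has | apply comp_find
        | apply comp_nseq | apply comp_maxn | apply comp_add | apply comp_ltn
        | apply comp_leq | apply comp_sub | apply comp_S | apply comp_pred
        | apply comp_half | apply comp_odd
        | apply comp_foldl | apply comp_foldr | apply comp_iter ]
  end.
Ltac comp_user ::= comp_lib.

Section Inverses.
Context {T : Type} {eT : encodable T} {X : eqType} {eX : encodable X}.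
Implicit Types (l m : T -> X * bool) (w u : T -> seq (X * bool)) (G : T -> seq X).

Lemma comp_linv l : comp l -> comp (fun x => linv (l x)).
Proof. by move=> hl; rewrite /linv; comp_auto. Qed.

End Inverses.

Ltac comp_user ::= first [ apply comp_linv | comp_lib ].

Section Letters.
Context {T : Type} {eT : encodable T} {X : eqType} {eX : encodable X}.
Implicit Types (l m : T -> X * bool) (w u : T -> seq (X * bool)) (G : T -> seq X).

Lemma comp_push l w : comp l -> comp w -> comp (fun x => push (l x) (w x)).
Proof. by move=> hl hw; rewrite /push; comp_auto. Qed.

Lemma comp_middle m l : comp m -> comp l -> comp (fun x => middle (m x) (l x)).
Proof. by move=> hm hl; rewrite /middle; comp_auto. Qed.

Lemma comp_side (Z : T -> seq (X * bool)) m l :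
  comp Z -> comp m -> comp l -> comp (fun x => side (mem (Z x)) (m x) (l x)).
Proof.
move=> hZ hm hl; apply: (comp_ext (f := fun x => if l x == m x then false else
  if l x == linv (m x) then true else l x \in Z x)) => //.
by comp_auto.
Qed.

End Letters.

Ltac comp_user ::=
  first [ apply comp_linv | apply comp_push | apply comp_middle | apply comp_side | comp_lib ].

Section Reduction_moves.
Context {T : Type} {eT : encodable T} {X : eqType} {eX : encodable X}.
Implicit Types (l m : T -> X * bool) (w u : T -> seq (X * bool)) (G : T -> seq X).

Lemma comp_red w : comp w -> comp (fun x => red (w x)).
Proof. by move=> hw; rewrite /red; comp_auto. Qed.

Lemma comp_white (Z : T -> seq (X * bool)) m l :
  comp Z -> comp m -> comp l -> comp (fun x => white (mem (Z x)) (m x) (l x)).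
Proof. by move=> hZ hm hl; rewrite /white; comp_auto. Qed.

Lemma comp_letters G : comp G -> comp (fun x => letters (G x)).
Proof. by move=> hG; rewrite /letters; comp_auto. Qed.

Lemma comp_subsets (Y : Type) {eY : encodable Y} (s : T -> seq Y) :
  comp s -> comp (fun x => subsets (s x)).
Proof.
move=> hs; apply: (comp_ext (f := fun x =>
  foldr (fun y t => t ++ [seq y :: r | r <- t]) [:: [::]] (s x))).
  by move=> x; elim: (s x) => //= y t ->.
by comp_auto.
Qed.

Lemma comp_wpow w (n : T -> nat) : comp w -> comp n -> comp (fun x => wpow (w x) (n x)).
Proof. by move=> hw hn; rewrite /wpow; comp_auto. Qed.

Lemma comp_shorter w u : comp w -> comp u -> comp (fun x => shorter (w x) (u x)).
Proof. by move=> hw hu; rewrite /shorter; comp_auto. Qed.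

End Reduction_moves.

Ltac comp_words :=
  first [ apply comp_red | apply comp_white | apply comp_letters | apply comp_subsets
        | apply comp_wpow | apply comp_shorter
        | apply comp_linv | apply comp_push | apply comp_middle | apply comp_side ].
Ltac comp_user ::= first [ comp_words | comp_lib ].

Section Minimization.
Context {T : Type} {eT : encodable T} {X : eqType} {eX : encodable X}.
Implicit Types (w : T -> seq (X * bool)) (G : T -> seq X).

Lemma comp_shorten G w : comp G -> comp w -> comp (fun x => shorten (G x) (w x)).
Proof. by move=> hG hw; rewrite /shorten /moves /sub; comp_auto. Qed.

End Minimization.

Ltac comp_user ::= first [ apply comp_shorten | comp_words | comp_lib ].

Section Criteria.
Context {T : Type} {eT : encodable T} {X : eqType} {eX : encodable X}.
Implicit Types (w : T -> seq (X * bool)) (G : T -> seq X).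

Lemma comp_minimize G w : comp G -> comp w -> comp (fun x => minimize (G x) (w x)).
Proof. by move=> hG hw; rewrite /minimize; comp_auto. Qed.

End Criteria.

Ltac comp_user ::= first [ apply comp_minimize | comp_words | comp_lib ].

Section Recognition.
Context {T : Type} {eT : encodable T} {X : eqType} {eX : encodable X}.
Implicit Types (w : T -> seq (X * bool)) (G : T -> seq X).

Lemma comp_primitive_word G w : comp G -> comp w -> comp (fun x => primitive_word (G x) (w x)).
Proof. by move=> hG hw; rewrite /primitive_word; comp_auto. Qed.

Lemma comp_simple_word G w : comp G -> comp w -> comp (fun x => simple_word (G x) (w x)).
Proof. by move=> hG hw; rewrite /simple_word; comp_auto. Qed.

End Recognition.

Section TableLookup.
Context {T : Type} {eT : encodable T}.
Implicit Types (i k : T -> nat) (l : T -> nat * bool) (w : T -> seq (nat * bool)).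
Implicit Types (tb : T -> seq (seq nat)) (ps : T -> seq (nat * bool)).

Lemma comp_lists (Y : Type) {eY : encodable Y} (n : T -> nat) (s : T -> seq Y) :
  comp n -> comp s -> comp (fun x => lists (n x) (s x)).
Proof.
move=> hn hs; apply: (comp_ext (f := fun x =>
  iter (n x) (fun r => [seq y :: t | y <- s x, t <- r]) [:: [::]])).
  by move=> x; elim: (n x) => //= m ->.
by comp_auto.
Qed.

Lemma comp_table_act tb i l : comp tb -> comp i -> comp l ->
  comp (fun x => table_act (tb x) (i x) (l x)).
Proof. by move=> ht hi hl; rewrite /table_act; comp_auto. Qed.

Lemma comp_table_par ps i : comp ps -> comp i -> comp (fun x => table_par (ps x) (i x)).
Proof. by move=> hp hi; rewrite /table_par; comp_auto. Qed.

End TableLookup.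

Ltac comp_tables := first
  [ apply comp_minimize | apply comp_lists | apply comp_table_act | apply comp_table_par ].
Ltac comp_user ::= first [ comp_tables | comp_words | comp_lib ].

Section Paths.
Context {T : Type} {eT : encodable T}.
Implicit Types (i k : T -> nat) (l : T -> nat * bool) (w : T -> seq (nat * bool)).
Implicit Types (tb : T -> seq (seq nat)) (ps : T -> seq (nat * bool)).

Lemma comp_edge tb i l : comp tb -> comp i -> comp l ->
  comp (fun x => edge (table_act (tb x)) (i x) (l x)).
Proof. by move=> ht hi hl; rewrite /edge; comp_auto. Qed.

Lemma comp_endpoint tb i w : comp tb -> comp i -> comp w ->
  comp (fun x => endpoint (table_act (tb x)) (i x) (w x)).
Proof. by move=> ht hi hw; rewrite /endpoint; comp_auto. Qed.

End Paths.

Ltac comp_covers := first [ apply comp_edge | apply comp_endpoint | comp_tables ].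
Ltac comp_user ::= first [ comp_covers | comp_words | comp_lib ].

Section Tracing.
Context {T : Type} {eT : encodable T} (N : nat).
Implicit Types (i k : T -> nat) (w : T -> seq (nat * bool)).
Implicit Types (tb : T -> seq (seq nat)) (ps : T -> seq (nat * bool)).

Lemma comp_trace tb i w : comp tb -> comp i -> comp w ->
  comp (fun x => trace (table_act (tb x)) (i x) (w x)).
Proof.
move=> ht hi hw.
pose step (x : T) (st : nat * seq ((nat * nat) * bool)) (m : nat * bool) :=
  (table_act (tb x) st.1 m, st.2 ++ [:: edge (table_act (tb x)) st.1 m]).
apply: (comp_ext (f := fun x => (foldl (step x) (i x, [::]) (w x)).2)).
  move=> x; rewrite -[RHS]cat0s; elim: (w x) (i x) (nil : seq ((nat * nat) * bool)) =>
    [|m s IH] j acc; first by rewrite cats0.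
  by rewrite /= IH -catA.
by rewrite /step; comp_auto.
Qed.

Lemma comp_tree k tb ps : comp k -> comp tb -> comp ps ->
  comp (fun x => tree (k x) (table_act (tb x)) (table_par (ps x))).
Proof. by move=> hk ht hp; rewrite /tree; comp_auto. Qed.

Lemma comp_table_ok k tb ps : comp k -> comp tb -> comp ps ->
  comp (fun x => table_ok N (k x) (tb x) (ps x)).
Proof. by move=> hk ht hp; rewrite /table_ok; comp_auto. Qed.

End Tracing.

Ltac comp_user ::= first
  [ apply comp_trace | apply comp_tree | apply comp_table_ok | comp_covers | comp_words | comp_lib ].

Section Trees.
Context {T : Type} {eT : encodable T} (N : nat).
Implicit Types (k : T -> nat) (w : T -> seq (nat * bool)).
Implicit Types (tb : T -> seq (seq nat)) (ps : T -> seq (nat * bool)).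

Lemma comp_cotree k tb ps : comp k -> comp tb -> comp ps ->
  comp (fun x => cotree N (k x) (table_act (tb x)) (table_par (ps x))).
Proof. by move=> hk ht hp; rewrite /cotree; comp_auto. Qed.

Lemma comp_off_tree k tb ps (u : T -> seq ((nat * nat) * bool)) :
  comp k -> comp tb -> comp ps -> comp u ->
  comp (fun x => off_tree (k x) (table_act (tb x)) (table_par (ps x)) (u x)).
Proof. by move=> hk ht hp hu; rewrite /off_tree; comp_auto. Qed.

End Trees.

Ltac comp_user ::= first
  [ apply comp_cotree | apply comp_off_tree | apply comp_trace | apply comp_table_ok
  | comp_covers | comp_words | comp_lib ].

Section Distance.
Variables (crit : seq (nat * nat) -> word (nat * nat)%type -> bool) (N : nat).
Hypothesis hcrit : comp (fun p : seq (nat * nat) * seq ((nat * nat) * bool) => crit p.1 p.2).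

Lemma comp_accepts (T : Type) {eT : encodable T} (k : T -> nat) (w : T -> seq (nat * bool)) :
  comp k -> comp w -> comp (fun x => accepts crit N (k x) (w x)).
Proof. by move=> hk hw; rewrite /accepts /tables /parents; comp_auto. Qed.

Lemma comp_distance (T : Type) {eT : encodable T} (w : T -> seq (nat * bool)) :
  comp w -> comp (fun x => distance N crit (w x)).
Proof.
by move=> hw; rewrite /distance; apply comp_find; comp_auto; apply comp_accepts; comp_auto.
Qed.

Lemma comp_extremum (T : Type) {eT : encodable T} (n : T -> nat) :
  comp n -> comp (fun x => extremum N crit (n x)).
Proof. by move=> hn; rewrite /extremum; comp_auto. Qed.

End Distance.

Theorem theorem4p14 (N : nat) (F : groupType) (a : 'I_N -> F) :
  (2 <= N)%N ->
  freely_generates a ->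
  (exists p : prog, forall w : word 'I_N, word_val a w <> 1%g ->
     exists k l : nat,
       [/\ d_prim (word_val a w) k, d_simp (word_val a w) l
         & eval p [:: word_code w] (pair_code k l)]) /\
  (exists q : prog, forall n : nat, (1 <= n)%N ->
     exists k l : nat,
       [/\ f_prim a n k, f_simp a n l & eval q [:: n] (pair_code k l)]).
Proof.
move=> N2 free_a; have fa := freely_generates_fgen free_a.
have cprim : comp (fun p : seq (nat * nat) * seq ((nat * nat) * bool) => primitive_word p.1 p.2).
  by apply comp_primitive_word; comp_auto.
have csimp : comp (fun p : seq (nat * nat) * seq ((nat * nat) * bool) => simple_word p.1 p.2).
  by apply comp_simple_word; comp_auto.
split.
  pose decode (s : seq nat) := [seq (n./2, odd n) | n <- s].
  have [p hp] : comp (fun s : seq nat =>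
      [:: distance N (@primitive_word _) (decode s); distance N (@simple_word _) (decode s)]).
    have hd : comp decode by rewrite /decode; comp_auto.
    by comp_auto; apply comp_distance.
  exists p => w ne; pose s := [seq (l.1.*2 + l.2)%N | l : 'I_N * bool <- w].
  have es : decode s = nat_word w.
    rewrite /decode /s -map_comp; apply: eq_map => -[i b] /=.
    by rewrite addnC half_bit_double oddD odd_double oddb addbF.
  have ne' : word_val (nat_basis a) (nat_word w) <> 1%g by rewrite word_val_nat.
  have [dp ds] := distance_primP N2 fa (over_nat w) ne'; rewrite word_val_nat in dp ds.
  exists (distance N (@primitive_word _) (nat_word w)), (distance N (@simple_word _) (nat_word w)).
  split=> //; have := hp s; rewrite es /=.
  by rewrite map_id.
have [q hq] : comp (fun n : nat =>
    [:: extremum N (@primitive_word _) n; extremum N (@simple_word _) n]).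
  by comp_auto; apply comp_extremum; comp_auto.
have N0 : 0 < N by apply: ltnW.
exists q => n n1; exists (extremum N (@primitive_word _) n), (extremum N (@simple_word _) n).
split; last exact: hq.
  apply: extremumP => // w ow ne; exact: (distance_primP N2 fa ow ne).1.
by apply: extremumP => // w ow ne; exact: (distance_primP N2 fa ow ne).2.
Qed.
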